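(* Let $(M,g)$ be a connected pseudo-Riemannian manifold and let $(V,h)$ be a quadratic space isometric to the fibers of $(T^\ast M,g^\ast)$. Let $\eta:\mathrm{Cl}(V,h)\rightarrow \mathrm{End}_{\mathbb R}(S_0)$ be a weakly faithful real Clifford representation. Let $\mathcal{B}_\eta$ denote the groupoid of weakly faithful real pinor bundles of type $[\eta]$ on $(M,g)$ (morphisms: based isomorphisms of real pinor bundles) and let $L_\eta(M,g)$ denote the groupoid of real Lipschitz structures on $(M,g)$ relative to $\eta$. Let $Q_\eta:\mathcal{B}_\eta\rightarrow L_\eta(M,g)$ and $S_\eta:L_\eta(M,g)\rightarrow \mathcal{B}_\eta$ be the functors described in the context. Then there exist invertible natural transformations $$\mathcal{F}_\eta:S_\eta\circ Q_\eta\stackrel{\sim}{\rightarrow}\mathrm{id}_{\mathcal{B}_\eta},\qquad \mathcal{G}_\eta:\mathrm{id}_{L_\eta(M,g)}\stackrel{\sim}{\rightarrow}Q_\eta\circ S_\eta .$$ Hence $Q_\eta$ and $S_\eta$ are mutually quasi-inverse equivalences between the groupoids $\mathcal{B}_\eta$ and $L_\eta(M,g)$.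
   Context: Manifolds are smooth, connected, Hausdorff, paracompact, of positive dimension. A quadratic space $(V,h)$ is a nonzero finite-dimensional real vector space $V$ with a nondegenerate symmetric bilinear form $h$; isometries are form-preserving linear maps. $\mathrm{Cl}(V,h)$ is the real Clifford algebra with relations $v^2=h(v,v)$; an isometry $f_0:(V,h)\to(V',h')$ extends uniquely to a unital algebra morphism $\mathrm{Cl}(f_0):\mathrm{Cl}(V,h)\to\mathrm{Cl}(V',h')$. A real Clifford representation is a unital algebra morphism $\gamma:\mathrm{Cl}(V,h)\to\mathrm{End}_{\mathbb R}(S)$ with $S$ a finite-dimensional real vector space; it is weakly faithful if $\gamma|_V$ is injective. In the category $\mathrm{ClRep}$, a morphism from $\gamma:\mathrm{Cl}(V,h)\to\mathrm{End}_{\mathbb R}(S)$ to $\gamma':\mathrm{Cl}(V',h')\to\mathrm{End}_{\mathbb R}(S')$ is a pair $(f_0,f)$ with $f_0:(V,h)\to(V',h')$ an isometry, $f:S\to S'$ linear and $\gamma'(f_0(v))\circ f=f\circ\gamma(v)$ for all $v\in V$; composition is componentwise. It is based if $f_0=\mathrm{id}_V$. For weakly faithful $\gamma,\gamma'$, in an isomorphism $(f_0,f)$ the map $f_0$ is determined by $f$, so isomorphisms are denoted by $f$ alone. $\mathrm{ClRep}^\times$ is the groupoid of isomorphisms of $\mathrm{ClRep}$. The real Lipschitz group of a weakly faithful $\eta:\mathrm{Cl}(V,h)\to\mathrm{End}_{\mathbb R}(S_0)$ is $\mathrm{L}(\eta)=\{a\in\mathrm{Aut}_{\mathbb R}(S_0)\,|\,a\,\eta(V)a^{-1}\subset\eta(V)\}$,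 which is identified with the automorphism group of $\eta$ in $\mathrm{ClRep}$. Its vector representation $\mathrm{Ad}_0:\mathrm{L}(\eta)\to\mathrm{O}(V,h)$ is given by $\mathrm{Ad}_0(a)=(\eta|_V)^{-1}\circ\mathrm{Ad}(a)\circ\eta|_V$, where $\mathrm{Ad}(a)(T)=aTa^{-1}$. A real pinor bundle on $(M,g)$ is a pair $(S,\gamma)$ with $S\neq 0$ a smooth real vector bundle on $M$ and $\gamma:\mathrm{Cl}(T^\ast M,g^\ast)\to\mathrm{End}(S)$ a smooth vector bundle morphism whose fibers $\gamma_m:\mathrm{Cl}(T_m^\ast M,g_m^\ast)\to\mathrm{End}_{\mathbb R}(S_m)$ are unital algebra morphisms. A based morphism $f:(S,\gamma)\to(S',\gamma')$ is a smooth vector bundle morphism over $\mathrm{id}_M$ with $f_m\circ\gamma_m(x)=\gamma'_m(x)\circ f_m$ for all $m$ and $x$. The bundle is weakly faithful if every $\gamma_m|_{T^\ast_mM}$ is injective. Its type is the (common) isomorphism class of the $\gamma_m$ in $\mathrm{ClRep}$; type $[\eta]$ means that each $\gamma_m$ is isomorphic to $\eta$ in $\mathrm{ClRep}$. $P_{\mathrm{O}(V,h)}(M,g)$ is the principal $\mathrm{O}(V,h)$-bundle whose fiber at $m$ is the set of invertible isometries $(V,h)\to(T_m^\ast M,g_m^\ast)$, with right action by composition. For a group morphism $\varphi:H\to G$ and a principal $G$-bundle $P$, a $\varphi$-reduction of $P$ to $H$ is a pair $(Q,\tau)$ with $Q$ a principal $H$-bundle over $M$ and $\tau:Q\to P$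 a bundle map over $\mathrm{id}_M$ with $\tau(qa)=\tau(q)\varphi(a)$; an isomorphism $(Q,\tau)\to(Q',\tau')$ is a based isomorphism of principal $H$-bundles $f$ with $\tau'\circ f=\tau$. A real Lipschitz structure on $(M,g)$ relative to $\eta$ is an $\mathrm{Ad}_0$-reduction of $P_{\mathrm{O}(V,h)}(M,g)$ to $\mathrm{L}(\eta)$; $L_\eta(M,g)$ is the groupoid of these and their isomorphisms. Functor $Q_\eta$: for $(S,\gamma)$ in $\mathcal{B}_\eta$, $Q_\eta(S,\gamma)=(Q,\tau)$, where $Q_m=\mathrm{Hom}_{\mathrm{ClRep}^\times}(\eta,\gamma_m)$ with right action $qa=q\circ a$, and $\tau_m(q)=q_0$ for $q\equiv(q_0,q)$. On a based isomorphism $f:(S,\gamma)\to(S',\gamma')$, $Q_\eta(f)(q)=(\mathrm{id}_{T^\ast_mM},f_m)\circ q$. Functor $S_\eta$: for $(Q,\tau)$ in $L_\eta(M,g)$, $S_\eta(Q,\tau)=(S,\gamma)$ where $S=Q\times_{\mathrm{L}(\eta)}S_0$ is associated through the tautological representation of $\mathrm{L}(\eta)$ on $S_0$ and $\gamma_m(x)([q,s])=[q,\eta(\mathrm{Cl}(\tau_m(q)^{-1})(x))(s)]$ for $x\in\mathrm{Cl}(T_m^\ast M,g_m^\ast)$, $q\in Q_m$, $s\in S_0$. On an isomorphism $f$ of Lipschitz structures, $S_\eta(f)_m([q,s])=[f_m(q),s]$. *)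

(* Defs.v *)
From HB Require Import structures.
From mathcomp Require Import all_boot all_order all_algebra.
From mathcomp Require Import generic_quotient.
From mathcomp Require Import all_classical all_reals.
From mathcomp Require Import topology normedtype landau derive.

Set Implicit Arguments.
Unset Strict Implicit.
Unset Printing Implicit Defensive.
Import Order.TTheory GRing.Theory Num.Theory.
Import numFieldNormedType.Exports.
Local Open Scope classical_set_scope.
Local Open Scope ring_scope.

Section Smooth.
Context {R : realType} {V W : normedModType R}.

Fixpoint of_class (k : nat) (O : set V) (f : V -> W) : Prop :=
  match k with
  | 0 => forall x, O x -> {for x, continuous f}
  | k.+1 => (forall x, O x -> differentiable f x) /\
            forall v, of_class k O ('D_v f)
  end.

Definition smooth_on (O : set V) (f : V -> W) := forall k, of_class k O f.

Lemma diff_near (f g : V -> W) x :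
  {near x, f =1 g} -> differentiable f x ->
  differentiable g x /\ 'd f x =1 'd g x.
Proof.
move=> fg df.
have h0 : (g \- f) \o shift x = cst ((g \- f) x) + (\0 : V -> W) +o_ 0 id.
  apply/eqaddoP => e e0.
  have: \forall y \near (0:V), f (y + x) = g (y + x).
    by move: fg; rewrite (near_shift 0) subr0.
  apply: filterS => y /= fgy; rewrite !fctE /=.
  rewrite -fgy (nbhs_singleton fg) !subrr addr0 subr0 normr0.
  by rewrite mulr_ge0 // ltW.
have c0 : continuous (\0 : V -> W) by move=> y; exact: cst_continuous.
have d0 : 'd (g \- f) x = \0 :> (V -> W) by exact: diff_unique.
have dgf : differentiable (g \- f) x.
  by apply/diff_locallyP; rewrite d0.
have eg : g = f + (g \- f) by apply/funext => y; rewrite !fctE addrC subrK.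
move: {h0 c0} (g \- f) dgf d0 eg => h dh d0 ->.
split; first exact: differentiableD.
have E := diffD df dh => v.
rewrite [RHS](congr1 (@^~ v) E) [RHS]/=.
by rewrite [X in _ + X](congr1 (@^~ v) d0) addr0.
Qed.

Lemma of_classW k (O : set V) (f : V -> W) : of_class k.+1 O f -> of_class k O f.
Proof.
elim: k f => [|k IH] f [df Df].
  by move=> x Ox; apply/differentiable_continuous/df.
by split=> // v; apply: IH; exact: Df.
Qed.

Lemma of_class_ext k (O : set V) (f g : V -> W) : open O -> {in O, f =1 g} ->
  of_class k O f -> of_class k O g.
Proof.
move=> oO; have near_fg (f' g' : V -> W) x : {in O, f' =1 g'} -> O x -> {near x, f' =1 g'}.
  move=> fg Ox; have : nbhs x O by exact: open_nbhs_nbhs.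
  by apply: filterS => y Oy; apply: fg; rewrite inE.
elim: k f g => [|k IH] f g fg /=.
  move=> cf x Ox; rewrite /prop_for /continuous_at -(nbhs_singleton (near_fg _ _ _ fg Ox)).
  by apply: cvg_trans (cf _ Ox); apply: near_eq_cvg; exact: near_fg.
move=> [df Df]; split=> [x Ox|v].
  by have [] := diff_near (near_fg _ _ _ fg Ox) (df _ Ox).
apply: IH (Df v) => x; rewrite inE => Ox.
by apply: near_eq_derive; exact: near_fg.
Qed.

Lemma of_class_local k (O : set V) (f : V -> W) :
  (forall x, O x -> exists U', [/\ open U', U' x & of_class k U' f]) -> of_class k O f.
Proof.
elim: k f => [|k IH] f /= H.
  by move=> x /H [U' [oO U'x]]; apply.
split=> [x /H [U' [oO U'x [df Df]]]|v]; first exact: df.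
by apply: IH => x /H [U' [oU' U'x [df Df]]]; exists U'.
Qed.

Lemma of_class_sub k (O U' : set V) (f : V -> W) : U' `<=` O ->
  of_class k O f -> of_class k U' f.
Proof.
move=> OU'; elim: k f => [|k IH] f /= H; first by move=> x /OU'; exact: H.
by case: H => df Df; split=> [x /OU'/df //|v]; apply: IH.
Qed.

Lemma of_class_cst k (O : set V) (w : W) : of_class k O (cst w).
Proof.
elim: k w => [|k IH] w /=; first by move=> x _; exact: cst_continuous.
split=> [x _|v]; first exact: differentiable_cst.
suff -> : 'D_v (cst w) = cst 0 by exact: IH.
by apply/funext => x; exact: derive_cst.
Qed.

Lemma of_classD k (O : set V) (f g : V -> W) : open O ->
  of_class k O f -> of_class k O g -> of_class k O (f \+ g).
Proof.
move=> oO; elim: k f g => [|k IH] f g /= Hf Hg.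
  by move=> x Ox; apply: continuousD; [exact: Hf|exact: Hg].
case: Hf Hg => df Df [dg Dg]; split=> [x Ox|v].
  by apply: differentiableD; [exact: df|exact: dg].
apply: of_class_ext (IH _ _ (Df v) (Dg v)) => // x; rewrite inE => Ox.
by apply/esym/deriveD; [exact: diff_derivable (df _ Ox) |exact: diff_derivable (dg _ Ox)].
Qed.

End Smooth.

Lemma diff_comp_near {R : realType} {U V W : normedModType R}
    (f : U -> V) (g : V -> W) (h : U -> W) x y v : f x = y ->
  {near x, g \o f =1 h} -> differentiable f x -> differentiable g y ->
  'd g y ('d f x v) = 'd h x v.
Proof.
move=> <- fgh df dg; have dgf := differentiable_comp df dg.
have [_ Eh] := diff_near fgh dgf.
have Ec := diff_comp df dg.
by rewrite -Eh; move: ('d (g \o f) x) Ec {Eh} => D ->.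
Qed.

Lemma of_classM {R : realType} {V : normedModType R} k (O : set V) (f g : V -> R) :
  open O -> of_class k O f -> of_class k O g -> of_class k O (f \* g).
Proof.
move=> oO; elim: k f g => [|k IH] f g Hf Hg.
  by move=> x Ox; apply: continuousM; [exact: Hf|exact: Hg].
have [f' g'] := (of_classW Hf, of_classW Hg).
case: Hf Hg => df Df [dg Dg]; split=> [x Ox|v].
  by apply: differentiableM; [exact: df|exact: dg].
have H := of_classD oO (IH _ _ f' (Dg v)) (IH _ _ g' (Df v)).
apply: of_class_ext H => // x; rewrite inE => Ox.
by apply/esym/deriveM; [exact: diff_derivable (df _ Ox) |exact: diff_derivable (dg _ Ox)].
Qed.

Section Topology.
Context {T : topologicalType}.

Definition locally_finite (F : set (set T)) :=
  forall x : T, exists2 U, nbhs x U & finite_set [set A | F A /\ A `&` U !=set0].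

Definition paracompact :=
  forall F : set (set T), (forall A, F A -> open A) ->
    \bigcup_(A in F) A = setT ->
  exists G : set (set T), [/\ forall B, G B -> open B,
    \bigcup_(B in G) B = setT,
    forall B, G B -> exists2 A, F A & B `<=` A & locally_finite G].

End Topology.
Arguments paracompact : clear implicits.

Record chart (R : realType) (T : topologicalType) (n : nat) := Chart {
  cdom : set T;
  cimg : set 'rV[R]_n;
  cmap : T -> 'rV[R]_n;
  cinv : 'rV[R]_n -> T;
  cdom_open : open cdom;
  cimg_open : open cimg;
  cmap_img : forall m, cdom m -> cimg (cmap m);
  cinv_dom : forall x, cimg x -> cdom (cinv x);
  cmapK : forall m, cdom m -> cinv (cmap m) = m;
  cinvK : forall x, cimg x -> cmap (cinv x) = x;
  cmap_continuous : forall m, cdom m -> {for m, continuous cmap};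
  cinv_continuous : forall x, cimg x -> {for x, continuous cinv} }.

Definition transition (R : realType) (T : topologicalType) (n : nat)
  (c c' : chart R T n) : 'rV[R]_n -> 'rV[R]_n := cmap c' \o cinv c.

Record manifold (R : realType) := Manifold {
  mfd_sort :> topologicalType;
  mfd_dim : nat;
  mfd_dim_gt0 : (0 < mfd_dim)%N;
  atlas : set (chart R mfd_sort mfd_dim);
  atlas_cover : forall m, exists2 c, atlas c & cdom c m;
  atlas_smooth : forall c c', atlas c -> atlas c' ->
    smooth_on (cimg c `&` cinv c @^-1` cdom c') (transition c c');
  mfd_hausdorff : hausdorff_space mfd_sort;
  mfd_paracompact : paracompact mfd_sort;
  mfd_connected : connected [set: mfd_sort] }.

Section SmoothFunctions.
Context {R : realType} {M : manifold R}.
Local Notation n := (mfd_dim M).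
Local Notation mchart := (chart R M n).
Implicit Types (U : set M) (c : mchart).

Definition smooth_fun U (f : M -> R) := forall c, atlas c ->
  smooth_on (cimg c `&` cinv c @^-1` U) (f \o cinv c).

Lemma open_chart_preimage c U : open U -> open (cimg c `&` cinv c @^-1` U).
Proof.
move=> oU; rewrite openE => x [cx Ux].
apply: filterI; first by apply: open_nbhs_nbhs; split=> //; exact: cimg_open.
apply: (cinv_continuous cx).
by apply: open_nbhs_nbhs.
Qed.

Lemma smooth_fun_ext U f g : open U -> {in U, f =1 g} ->
  smooth_fun U f -> smooth_fun U g.
Proof.
move=> oU fg sf c ac k; apply: of_class_ext (sf c ac k).
  exact: open_chart_preimage.
by move=> x; rewrite inE => -[_ Ux]; apply: fg; rewrite inE.
Qed.

Lemma smooth_fun_local U f :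
  (forall m, U m -> exists U', [/\ open U', U' m & smooth_fun U' f]) ->
  smooth_fun U f.
Proof.
move=> H c ac k; apply: of_class_local => x [cx /H [U' [oU' U'x sf]]].
exists (cimg c `&` cinv c @^-1` U'); split=> //; first exact: open_chart_preimage.
exact: sf.
Qed.

Lemma smooth_fun_sub U U' f : U' `<=` U -> smooth_fun U f -> smooth_fun U' f.
Proof.
move=> sU sf c ac k; apply: of_class_sub (sf c ac k).
by move=> x [cx Ux]; split=> //; exact: sU.
Qed.

Lemma smooth_fun_cst U (a : R) : smooth_fun U (cst a).
Proof. by move=> c ac k; exact: of_class_cst. Qed.

Lemma smooth_funD U f g : open U ->
  smooth_fun U f -> smooth_fun U g -> smooth_fun U (f \+ g).
Proof.
move=> oU sf sg c ac k.
by apply: (of_classD _ (sf c ac k) (sg c ac k)); exact: open_chart_preimage.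
Qed.

Lemma smooth_funM U f g : open U ->
  smooth_fun U f -> smooth_fun U g -> smooth_fun U (f \* g).
Proof.
move=> oU sf sg c ac k.
by apply: (of_classM _ (sf c ac k) (sg c ac k)); exact: open_chart_preimage.
Qed.

Lemma smooth_fun_sum U (I : Type) (r : seq I) (f : I -> M -> R) : open U ->
  (forall i, smooth_fun U (f i)) -> smooth_fun U (fun m => \sum_(i <- r) f i m).
Proof.
move=> oU sf; elim: r => [|i r IH].
  apply: smooth_fun_ext (smooth_fun_cst U 0) => // m _.
  by rewrite big_nil.
apply: smooth_fun_ext (smooth_funD oU (sf i) IH) => // m _.
by rewrite big_cons.
Qed.

Definition smooth_vec (F : vectType R) U (f : M -> F) :=
  forall l : 'Hom(F, R^o), smooth_fun U (fun m => l (f m)).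

Definition smooth_hom (F F' : vectType R) U (A : M -> 'Hom(F, F')) :=
  forall v, smooth_vec U (fun m => A m v).

Lemma smooth_hom_comp (F F' F'' : vectType R) U (A : M -> 'Hom(F', F''))
    (B : M -> 'Hom(F, F')) : open U -> smooth_hom U A -> smooth_hom U B ->
  smooth_hom U (fun m => A m \o B m)%VF.
Proof.
move=> oU sA sB v l; pose X := vbasis {:F'}.
pose g m := \sum_(i < \dim {:F'}) (coord X i (B m v) * l (A m X`_i)).
apply: (@smooth_fun_ext U g) => // [m _|].
  rewrite comp_lfunE [in RHS](coord_vbasis (memvf (B m v))) !linear_sum.
  by apply: eq_bigr => i _; rewrite !linearZ.
apply: smooth_fun_sum => // i; apply: smooth_funM => //; last exact: sA.
have := sB v (linfun (coord X i : F' -> R^o)).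
by apply: smooth_fun_ext => // m _; rewrite lfunE.
Qed.

End SmoothFunctions.

Section Tangent.
Context {R : realType} {M : manifold R}.
Local Notation n := (mfd_dim M).
Local Notation mchart := (chart R M n).
Implicit Types (m : M) (c : mchart).

Definition chart_at m : set mchart := [set c | atlas c /\ cdom c m].

(* A tangent vector at [m] is a family of vectors of R^n, one for each chart
   around [m], transforming by the Jacobians of the chart changes.  The value
   at the other charts is fixed to 0 so that the family is unique. *)
Definition tangent_spec m (x : mchart -> 'rV[R]_n) : Prop :=
  (forall c c', chart_at m c -> chart_at m c' ->
     x c' = 'd (transition c c') (cmap c m) (x c)) /\
  (forall c, ~ chart_at m c -> x c = 0).

Definition tangent_pred m : {pred mchart -> 'rV[R]_n} :=
  fun x => `[< tangent_spec m x >].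

Fact tangent_submod_closed m : submod_closed (tangent_pred m).
Proof.
split=> [|a x y /asboolP[xt x0] /asboolP[yt y0]]; apply/asboolP; split=> //.
- by move=> c c' _ _; rewrite linear0.
- by move=> c c' mc mc'; rewrite !fctE linearP (xt c c') // (yt c c').
- by move=> c mc; rewrite !fctE x0 // y0 // scaler0 addr0.
Qed.

HB.instance Definition _ m := GRing.isSubmodClosed.Build R (mchart -> 'rV[R]_n)
  (tangent_pred m) (tangent_submod_closed m).

Record tangent m := Tangent {
  tan_val :> mchart -> 'rV[R]_n;
  _ : tan_val \in tangent_pred m }.

HB.instance Definition _ m := [isSub for @tan_val m].
HB.instance Definition _ m := [Choice of tangent m by <:].
HB.instance Definition _ m := [SubChoice_isSubLmodule of tangent m by <:].

Definition chart_vec m c (v : 'rV[R]_n) : mchart -> 'rV[R]_n := fun c' =>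
  if `[< chart_at m c' >] then 'd (transition c c') (cmap c m) v else 0.

(* the tangent vector at [m] with components [v] in the chart [c] (0 if [c] is
   not a chart around [m]) *)
Definition tvec c m (v : 'rV[R]_n) : tangent m := insubd 0 (chart_vec m c v).

Lemma transition_differentiable m c c' : chart_at m c -> chart_at m c' ->
  differentiable (transition c c') (cmap c m).
Proof.
move=> [ac cm] [ac' c'm].
have [+ _] := atlas_smooth ac ac' 1; apply; split; first exact: cmap_img.
by rewrite /= cmapK.
Qed.

Lemma chart_near m c (U : set M) : chart_at m c -> open U -> U m ->
  nbhs (cmap c m) (cimg c `&` cinv c @^-1` U).
Proof.
move=> [ac cm] oU Um; apply: open_nbhs_nbhs; split.
  exact: open_chart_preimage.
by split; [exact: cmap_img|rewrite /= cmapK].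
Qed.

Lemma diff_transition_id m c v : chart_at m c ->
  'd (transition c c) (cmap c m) v = v.
Proof.
move=> mc.
have nid : {near cmap c m, id =1 transition c c}.
  apply: filterS (chart_near mc (cdom_open c) mc.2) => x [cx _].
  by rewrite /transition /= cinvK.
have di : differentiable (id : 'rV[R]_n -> 'rV[R]_n) (cmap c m) by [].
have [_ <-] := diff_near nid di.
by rewrite diff_val.
Qed.

Lemma diff_transition_comp m c c' c'' v :
  chart_at m c -> chart_at m c' -> chart_at m c'' ->
  'd (transition c' c'') (cmap c' m) ('d (transition c c') (cmap c m) v) =
  'd (transition c c'') (cmap c m) v.
Proof.
move=> mc mc' mc''.
have nid : {near cmap c m,
    (transition c' c'' \o transition c c') =1 transition c c''}.
  apply: filterS (chart_near mc (cdom_open c') mc'.2) => x [cx /= c'x].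
  by rewrite /transition /= cmapK.
have E : transition c c' (cmap c m) = cmap c' m.
  by rewrite /transition /= cmapK //; case: mc.
apply: (diff_comp_near _ E nid); exact: transition_differentiable.
Qed.

Lemma chart_vecP m c v : chart_at m c -> chart_vec m c v \in tangent_pred m.
Proof.
move=> mc; apply/asboolP; split=> [c' c'' mc' mc''|c' /asboolPn mc'].
  rewrite /chart_vec (asboolT mc') (asboolT mc'').
  exact/esym/(diff_transition_comp v mc mc' mc'').
by rewrite /chart_vec (negbTE mc').
Qed.

Lemma tvec_val m c v : chart_at m c -> tvec c m v c = v.
Proof.
move=> mc; have := insubdK (0 : tangent m) (chart_vecP v mc) => /= ->.
by rewrite /chart_vec (asboolT mc) (diff_transition_id v mc).
Qed.

Lemma tangentE m c (x : tangent m) : chart_at m c -> x = tvec c m (x c).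
Proof.
move=> mc; apply: val_inj => /=.
rewrite (insubdK (0 : tangent m) (chart_vecP (x c) mc)).
case: x => x /= /asboolP[xt x0]; apply/funext => c'; rewrite /chart_vec.
by case: asboolP => [mc'|/x0//]; exact: xt.
Qed.

Fact tangent_vect_axiom m : vector_axiom n (tangent m).
Proof.
have [c mc] : {c | chart_at m c}.
  by apply: cid; have [c ac cm] := atlas_cover m; exists c.
exists (fun x : tangent m => x c) => [a x y //|].
by exists (tvec c m) => [x|v]; [rewrite -tangentE|rewrite tvec_val].
Qed.

HB.instance Definition _ m := Lmodule_hasFinDim.Build R (tangent m)
  (tangent_vect_axiom m).

Definition cotangent m : vectType R := 'Hom(tangent m, R^o).

Definition smooth_covector U (a : forall m, cotangent m) :=
  forall c, atlas c -> forall v, smooth_fun (U `&` cdom c) (fun m => a m (tvec c m v)).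

Definition dcoord c m (i : 'I_n) : cotangent m :=
  linfun (fun x : tangent m => x c 0 i : R^o).

End Tangent.
Arguments tangent {R} M m.
Arguments cotangent {R} M m.

Record category := Category {
  ob :> Type;
  hom : ob -> ob -> Type;
  idm : forall x, hom x x;
  compm : forall x y z, hom y z -> hom x y -> hom x z;
  comp1m : forall x y (f : hom x y), compm (idm y) f = f;
  compm1 : forall x y (f : hom x y), compm f (idm x) = f;
  compmA : forall x y z t (h : hom z t) (g : hom y z) (f : hom x y),
    compm h (compm g f) = compm (compm h g) f }.
Arguments hom {c} x y.
Arguments idm {c} x.
Arguments compm {c x y z} g f.

Record functor (C D : category) := Functor {
  fob :> C -> D;
  fmap : forall x y : C, hom x y -> hom (fob x) (fob y);
  fmap_id : forall x, fmap (idm x) = idm (fob x);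
  fmap_comp : forall (x y z : C) (g : hom y z) (f : hom x y),
    fmap (compm g f) = compm (fmap g) (fmap f) }.
Arguments fmap {C D} F {x y} f : rename.

Section CategoryTheory.

Definition id_functor (C : category) : functor C C :=
  @Functor C C id (fun x y f => f) (fun x => erefl) (fun x y z g f => erefl).

Definition comp_functor (C D E : category) (G : functor D E) (F : functor C D) :
  functor C E.
Proof.
refine (@Functor C E (fun x => G (F x)) (fun x y f => fmap G (fmap F f)) _ _).
- by move=> x; rewrite !fmap_id.
- by move=> x y z g f; rewrite !fmap_comp.
Defined.

Record nat_trans (C D : category) (F G : functor C D) := NatTrans {
  ntc :> forall x : C, hom (F x) (G x);
  ntP : forall (x y : C) (f : hom x y),
    compm (ntc y) (fmap F f) = compm (fmap G f) (ntc x) }.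

Definition nat_invertible (C D : category) (F G : functor C D)
    (a : nat_trans F G) : Prop :=
  exists b : nat_trans G F, forall x : C,
    compm (b x) (a x) = idm (F x) /\ compm (a x) (b x) = idm (G x).

Definition nat_isomorphic (C D : category) (F G : functor C D) : Prop :=
  exists a : nat_trans F G, nat_invertible a.

Definition quasi_inverse (C D : category) (F : functor C D) (G : functor D C) :
    Prop :=
  nat_isomorphic (comp_functor G F) (id_functor C) /\
  nat_isomorphic (comp_functor F G) (id_functor D).

Definition is_iso (C : category) (x y : C) (f : hom x y) : Prop :=
  exists g : hom y x, compm g f = idm x /\ compm f g = idm y.

Lemma is_iso_id (C : category) (x : C) : is_iso (idm x).
Proof. by exists (idm x); rewrite !comp1m. Qed.

Lemma is_iso_comp (C : category) (x y z : C) (g : hom y z) (f : hom x y) :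
  is_iso g -> is_iso f -> is_iso (compm g f).
Proof.
move=> [g' [g'g gg']] [f' [f'f ff']]; exists (compm f' g'); split.
  by rewrite compmA -[X in compm X f]compmA g'g compm1.
by rewrite compmA -[X in compm X g']compmA ff' compm1.
Qed.

Definition iso (C : category) (x y : C) := {f : hom x y | is_iso f}.

Lemma sval_inj (T : Type) (P : T -> Prop) (u v : {x | P x}) :
  sval u = sval v -> u = v.
Proof.
case: u v => [x px] [y py] /= xy; case: _ / xy py => py.
by congr exist; exact: Prop_irrelevance.
Qed.

Definition core (C : category) : category.
Proof.
refine (@Category C (@iso C) (fun x => exist _ (idm x) (is_iso_id x))
  (fun x y z g f => exist _ (compm (sval g) (sval f))
                            (is_iso_comp (svalP g) (svalP f))) _ _ _).
- by move=> x y f; apply: sval_inj; exact: comp1m.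
- by move=> x y f; apply: sval_inj; exact: compm1.
- by move=> x y z t h g f; apply: sval_inj; exact: compmA.
Defined.

Definition full_subcategory (C : category) (P : C -> Prop) : category :=
  @Category {x : C | P x} (fun x y => hom (sval x) (sval y))
    (fun x => idm (sval x)) (fun x y z g f => compm g f)
    (fun x y => @comp1m C _ _) (fun x y => @compm1 C _ _)
    (fun x y z t => @compmA C _ _ _ _).

End CategoryTheory.

Lemma linfunE (R : realType) (U V : vectType R) (f : U -> V) :
  linear f -> linfun f =1 f.
Proof.
move=> lf; pose g : {linear U -> V} := HB.pack f (GRing.isLinear.Build _ _ _ _ f lf).
by move=> u; rewrite -[f]/(g : U -> V) lfunE.
Qed.

Record quad_space (R : realType) := QuadSpace {
  qs_sort :> vectType R;
  qform : qs_sort -> qs_sort -> R;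
  qformC : forall u v, qform u v = qform v u;
  qform_linear : forall u a v w,
    qform u (a *: v + w) = a * qform u v + qform u w;
  qform_nondeg : forall u, (forall v, qform u v = 0) -> u = 0;
  qs_dim_gt0 : (0 < \dim {:qs_sort})%N }.

Section QuadSpace.
Context {R : realType}.
Implicit Types V : quad_space R.

Definition is_isometry V V' (f : 'Hom(V, V')) : Prop :=
  forall u v, qform (f u) (f v) = qform u v.

Lemma qform0 V (u : V) : qform u 0 = 0.
Proof.
have := qform_linear u 1 0 0; rewrite scale1r addr0 mul1r => E.
by apply: (addrI (qform u 0)); rewrite addr0 -E.
Qed.

Lemma isometry_inj V V' (f : 'Hom(V, V')) : is_isometry f -> lker f == 0%VS.
Proof.
move=> If; apply/lker0P => u v fuv; apply/eqP; rewrite -subr_eq0; apply/eqP.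
apply: qform_nondeg => w.
by rewrite -If linearB /= fuv subrr qformC qform0.
Qed.

Lemma isometry_id V : is_isometry (\1%VF : 'End(V)).
Proof. by move=> u v; rewrite !id_lfunE. Qed.

Lemma isometry_comp V V' V'' (g : 'Hom(V', V'')) (f : 'Hom(V, V')) :
  is_isometry g -> is_isometry f -> is_isometry (g \o f)%VF.
Proof. by move=> Ig If u v; rewrite !comp_lfunE Ig. Qed.

End QuadSpace.

(* The Clifford algebra is the unital associative R-algebra generated by the
   vectors of [V], subject to linearity and to v * v = h(v, v): the quotient of
   the terms below by the congruence [cl_rel]. *)
Section Clifford.
Context {R : realType} (V : quad_space R).

Inductive cl_term :=
  | ClScal of R
  | ClVec of V
  | ClAdd of cl_term & cl_term
  | ClMul of cl_term & cl_term.

Inductive cl_rel : cl_term -> cl_term -> Prop :=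
  | cl_refl x : cl_rel x x
  | cl_sym x y : cl_rel x y -> cl_rel y x
  | cl_trans y x z : cl_rel x y -> cl_rel y z -> cl_rel x z
  | cl_addl x x' y : cl_rel x x' -> cl_rel (ClAdd x y) (ClAdd x' y)
  | cl_mull x x' y : cl_rel x x' -> cl_rel (ClMul x y) (ClMul x' y)
  | cl_mulr x y y' : cl_rel y y' -> cl_rel (ClMul x y) (ClMul x y')
  | cl_addA x y z : cl_rel (ClAdd x (ClAdd y z)) (ClAdd (ClAdd x y) z)
  | cl_addC x y : cl_rel (ClAdd x y) (ClAdd y x)
  | cl_add0 x : cl_rel (ClAdd (ClScal 0) x) x
  | cl_addN x : cl_rel (ClAdd (ClMul (ClScal (-1)) x) x) (ClScal 0)
  | cl_mulA x y z : cl_rel (ClMul x (ClMul y z)) (ClMul (ClMul x y) z)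
  | cl_mul1l x : cl_rel (ClMul (ClScal 1) x) x
  | cl_mulDl x y z :
      cl_rel (ClMul (ClAdd x y) z) (ClAdd (ClMul x z) (ClMul y z))
  | cl_mulDr x y z :
      cl_rel (ClMul x (ClAdd y z)) (ClAdd (ClMul x y) (ClMul x z))
  | cl_scalD a b : cl_rel (ClScal (a + b)) (ClAdd (ClScal a) (ClScal b))
  | cl_scalM a b : cl_rel (ClScal (a * b)) (ClMul (ClScal a) (ClScal b))
  | cl_scalC a x : cl_rel (ClMul (ClScal a) x) (ClMul x (ClScal a))
  | cl_vec_linear a u v :
      cl_rel (ClVec (a *: u + v)) (ClAdd (ClMul (ClScal a) (ClVec u)) (ClVec v))
  | cl_vec_sqr v : cl_rel (ClMul (ClVec v) (ClVec v)) (ClScal (qform v v)).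

HB.instance Definition _ := gen_eqMixin cl_term.
HB.instance Definition _ := gen_choiceMixin cl_term.

Definition cl_eqv : rel cl_term := fun x y => `[< cl_rel x y >].

Fact cl_eqv_refl : reflexive cl_eqv.
Proof. by move=> x; apply/asboolP; exact: cl_refl. Qed.

Fact cl_eqv_sym : symmetric cl_eqv.
Proof. by move=> x y; apply/asboolP/asboolP => /cl_sym. Qed.

Fact cl_eqv_trans : transitive cl_eqv.
Proof. by move=> y x z /asboolP xy /asboolP yz; apply/asboolP/(cl_trans xy yz). Qed.

Canonical cl_equiv := EquivRel cl_eqv cl_eqv_refl cl_eqv_sym cl_eqv_trans.

Definition cliff := {eq_quot cl_equiv}%qT.

HB.instance Definition _ := Choice.on cliff.
HB.instance Definition _ := Quotient.on cliff.

Definition cl_pi (x : cl_term) : cliff := (\pi_cliff x)%qT.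

Lemma cl_piP x y : cl_pi x = cl_pi y <-> cl_rel x y.
Proof. by split=> [/eqP|xy]; [rewrite eqmodE => /asboolP|apply/eqP; rewrite eqmodE; apply/asboolP]. Qed.

Lemma cl_pi_surj (x : cliff) : cl_pi (repr x) = x.
Proof. exact: reprK. Qed.

Lemma cl_reprP x : cl_rel (repr (cl_pi x)) x.
Proof. by apply/cl_piP; rewrite cl_pi_surj. Qed.

Definition cl_scal (a : R) : cliff := cl_pi (ClScal a).
Definition cl_vec (v : V) : cliff := cl_pi (ClVec v).
Definition cl_add (x y : cliff) : cliff := cl_pi (ClAdd (repr x) (repr y)).
Definition cl_mul (x y : cliff) : cliff := cl_pi (ClMul (repr x) (repr y)).

Lemma cl_pi_add x y : cl_pi (ClAdd x y) = cl_add (cl_pi x) (cl_pi y).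
Proof.
apply/cl_piP; apply: (cl_trans (cl_addl y (cl_sym (cl_reprP x)))).
apply: (cl_trans (cl_addC _ _)); apply: cl_trans (cl_addC _ _).
exact/cl_addl/cl_sym/cl_reprP.
Qed.

Lemma cl_pi_mul x y : cl_pi (ClMul x y) = cl_mul (cl_pi x) (cl_pi y).
Proof.
apply/cl_piP; apply: (cl_trans (cl_mull y (cl_sym (cl_reprP x)))).
exact/cl_mulr/cl_sym/cl_reprP.
Qed.

Lemma cl_quotW (P : cliff -> Prop) : (forall x, P (cl_pi x)) -> forall x, P x.
Proof. by move=> H x; rewrite -(cl_pi_surj x). Qed.

Let clE := (cl_pi_add, cl_pi_mul).
Let cl_law (x y : cl_term) : cl_rel x y -> cl_pi x = cl_pi y.
Proof. by move/cl_piP. Qed.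

Fact cliff_addA : associative cl_add.
Proof.
elim/cl_quotW=> x; elim/cl_quotW=> y; elim/cl_quotW=> z.
by have := cl_law (cl_addA x y z); rewrite !clE.
Qed.
Fact cliff_addC : commutative cl_add.
Proof.
elim/cl_quotW=> x; elim/cl_quotW=> y.
by have := cl_law (cl_addC x y); rewrite !clE.
Qed.
Fact cliff_add0 : left_id (cl_scal 0) cl_add.
Proof. by elim/cl_quotW=> x; have := cl_law (cl_add0 x); rewrite !clE. Qed.
Fact cliff_addN : left_inverse (cl_scal 0) (cl_mul (cl_scal (-1))) cl_add.
Proof. by elim/cl_quotW=> x; have := cl_law (cl_addN x); rewrite !clE. Qed.
Fact cliff_mulA : associative cl_mul.
Proof.
elim/cl_quotW=> x; elim/cl_quotW=> y; elim/cl_quotW=> z.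
by have := cl_law (cl_mulA x y z); rewrite !clE.
Qed.
Fact cliff_mul1l : left_id (cl_scal 1) cl_mul.
Proof. by elim/cl_quotW=> x; have := cl_law (cl_mul1l x); rewrite !clE. Qed.
Fact cliff_scalC a x : cl_mul (cl_scal a) x = cl_mul x (cl_scal a).
Proof. by move: x; elim/cl_quotW=> x; have := cl_law (cl_scalC a x); rewrite !clE. Qed.
Fact cliff_mul1r : right_id (cl_scal 1) cl_mul.
Proof. by move=> x; rewrite -cliff_scalC cliff_mul1l. Qed.
Fact cliff_mulDl : left_distributive cl_mul cl_add.
Proof.
elim/cl_quotW=> x; elim/cl_quotW=> y; elim/cl_quotW=> z.
by have := cl_law (cl_mulDl x y z); rewrite !clE.
Qed.
Fact cliff_mulDr : right_distributive cl_mul cl_add.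
Proof.
elim/cl_quotW=> x; elim/cl_quotW=> y; elim/cl_quotW=> z.
by have := cl_law (cl_mulDr x y z); rewrite !clE.
Qed.

HB.instance Definition _ := GRing.isZmodule.Build cliff
  cliff_addA cliff_addC cliff_add0 cliff_addN.
HB.instance Definition _ := GRing.Zmodule_isPzRing.Build cliff
  cliff_mulA cliff_mul1l cliff_mul1r cliff_mulDl cliff_mulDr.

Lemma cl_scalM_mul a b : cl_scal (a * b) = cl_scal a * cl_scal b.
Proof. by have := cl_law (cl_scalM a b); rewrite !clE. Qed.
Lemma cl_scalD_add a b : cl_scal (a + b) = cl_scal a + cl_scal b.
Proof. by have := cl_law (cl_scalD a b); rewrite !clE. Qed.

Definition cl_scale (a : R) (x : cliff) : cliff := cl_scal a * x.

Fact cl_scaleA a b x : cl_scale a (cl_scale b x) = cl_scale (a * b) x.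
Proof. by rewrite /cl_scale mulrA cl_scalM_mul. Qed.
Fact cl_scale1 : left_id 1 cl_scale.
Proof. by move=> x; exact: mul1r. Qed.
Fact cl_scaleDr : right_distributive cl_scale +%R.
Proof. by move=> a x y; exact: mulrDr. Qed.
Fact cl_scaleDl x : {morph cl_scale^~ x : a b / a + b}.
Proof. by move=> a b; rewrite /cl_scale cl_scalD_add mulrDl. Qed.

HB.instance Definition _ := GRing.Zmodule_isLmodule.Build R cliff
  cl_scaleA cl_scale1 cl_scaleDr cl_scaleDl.

Lemma cl_scalE a : cl_scal a = a *: (1 : cliff).
Proof. by rewrite -[RHS]/(cl_scal a * 1) mulr1. Qed.

Lemma cl_scaleAl a (x y : cliff) : a *: (x * y) = (a *: x) * y.
Proof. exact: mulrA. Qed.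

Lemma cl_scaleAr a (x y : cliff) : a *: (x * y) = x * (a *: y).
Proof.
rewrite -[LHS]/(cl_scal a * _) -[a *: y]/(cl_scal a * y) !mulrA.
by congr (_ * _); exact: cliff_scalC.
Qed.

Lemma cl_vec_is_linear : linear cl_vec.
Proof. by move=> a u v; have := cl_law (cl_vec_linear a u v); rewrite !clE. Qed.

Lemma cl_vec_square v : cl_vec v * cl_vec v = qform v v *: (1 : cliff).
Proof. by rewrite -cl_scalE; have := cl_law (cl_vec_sqr v); rewrite !clE. Qed.

Lemma cliff_ind (P : cliff -> Prop) : P 1 -> (forall v, P (cl_vec v)) ->
  (forall a x y, P x -> P y -> P (a *: x + y)) ->
  (forall x y, P x -> P y -> P (x * y)) -> forall x, P x.
Proof.
move=> P1 Pv PD PM; have P0 : P 0.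
  by have := PD (-1) 1 1 P1 P1; rewrite scaleN1r addNr.
elim/cl_quotW; elim=> [a|v|x Px y Py|x Px y Py].
- by rewrite -/(cl_scal a) cl_scalE -[_ *: _]addr0; exact: PD.
- exact: Pv.
- by rewrite cl_pi_add -[cl_pi x]scale1r; exact: PD.
- by rewrite cl_pi_mul; exact: PM.
Qed.

Definition clifford_morphism (S : vectType R) (gam : cliff -> 'End(S)) : Prop :=
  [/\ linear gam, gam 1 = \1%VF & forall x y, gam (x * y) = (gam x \o gam y)%VF].

End Clifford.

Section ClMap.
Context {R : realType}.

Fixpoint cl_term_map (V V' : quad_space R) (f : V -> V') (x : cl_term V) :
    cl_term V' :=
  match x with
  | ClScal a => ClScal V' a
  | ClVec v => ClVec (f v)
  | ClAdd x y => ClAdd (cl_term_map f x) (cl_term_map f y)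
  | ClMul x y => ClMul (cl_term_map f x) (cl_term_map f y)
  end.

(* Well defined on the quotient only when [f] is an isometry, see [cl_map_pi]. *)
Definition cl_map (V V' : quad_space R) (f : 'Hom(V, V')) (x : cliff V) : cliff V' :=
  cl_pi (cl_term_map f (repr x)).

Section ClMapTheory.
Context (V V' : quad_space R) (f : 'Hom(V, V')) (If : is_isometry f).

Lemma cl_map_pi x : cl_map f (cl_pi x) = cl_pi (cl_term_map f x).
Proof.
apply/cl_piP; have := cl_reprP x; move: (repr _) => y.
elim=> {x y} /=; try by econstructor.
- by move=> y x z _ + _; exact: cl_trans.
- by move=> a u v; rewrite linearP; exact: cl_vec_linear.
- by move=> v; rewrite -If; exact: cl_vec_sqr.
Qed.

Lemma cl_map1 : cl_map f 1 = 1. Proof. exact: cl_map_pi. Qed.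

Lemma cl_map_vec v : cl_map f (cl_vec v) = cl_vec (f v).
Proof. exact: cl_map_pi. Qed.

Lemma cl_mapM x y : cl_map f (x * y) = cl_map f x * cl_map f y.
Proof.
rewrite -(cl_pi_surj x) -(cl_pi_surj y); move: (repr x) (repr y) => {}x {}y.
by rewrite -[_ * _]cl_pi_mul !cl_map_pi /= cl_pi_mul.
Qed.

Lemma cl_map_is_linear : linear (cl_map f).
Proof.
move=> a x y; rewrite -(cl_pi_surj x) -(cl_pi_surj y); move: (repr x) (repr y) => {}x {}y.
rewrite -[a *: cl_pi x]/(cl_mul (cl_scal V a) _) -[cl_scal V a]/(cl_pi _).
by rewrite -cl_pi_mul -[_ + _]cl_pi_add !cl_map_pi /= cl_pi_add cl_pi_mul.
Qed.

End ClMapTheory.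

End ClMap.

Record metric (R : realType) (M : manifold R) := Metric {
  met : forall m, tangent M m -> tangent M m -> R;
  metC : forall m (x y : tangent M m), met x y = met y x;
  met_linear : forall m (x : tangent M m) a y z,
    met x (a *: y + z) = a * met x y + met x z;
  met_nondeg : forall m (x : tangent M m), (forall y, met x y = 0) -> x = 0;
  met_smooth : forall c, atlas c -> forall v w,
    smooth_fun (cdom c) (fun m => met (tvec c m v) (tvec c m w)) }.

Section Cometric.
Context {R : realType} {M : manifold R} (g : metric M) (m : M).

Definition flat : 'Hom(tangent M m, cotangent M m) :=
  linfun (fun x => linfun (fun y => met g x y : R^o) : cotangent M m).

Definition cometric (a b : cotangent M m) : R :=
  met g ((flat^-1)%VF a) ((flat^-1)%VF b).

Lemma flatE x y : flat x y = met g x y.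
Proof.
have met_lin (z : tangent M m) : linear (fun y => met g z y : R^o).
  by move=> a u v; exact: met_linear.
rewrite /flat linfunE; first by rewrite (linfunE (met_lin x)).
move=> a u v; apply/lfunP => w; rewrite add_lfunE scale_lfunE.
by rewrite !(linfunE (met_lin _)) metC met_linear !(metC _ w).
Qed.

Lemma flat_lker : lker flat == 0%VS.
Proof.
apply/lker0P => x y xy; apply/eqP; rewrite -subr_eq0; apply/eqP.
apply: (@met_nondeg _ _ g) => z.
by rewrite -flatE linearB /= xy subrr zero_lfunE.
Qed.

Lemma flat_limg : limg flat = fullv.
Proof.
apply/eqP; rewrite eqEdim subvf limg_dim_eq ?(eqP flat_lker) ?capv0 //.
by rewrite !dimvf /dim /= muln1 leqnn.
Qed.

Lemma flatVK : cancel (flat^-1)%VF flat.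
Proof. by move=> a; rewrite limg_lfunVK // flat_limg memvf. Qed.

Lemma flatK : cancel flat (flat^-1)%VF.
Proof. exact: lker0_lfunK flat_lker. Qed.

Definition cotangent_qs : quad_space R.
Proof.
refine (@QuadSpace R (cotangent M m) cometric _ _ _ _).
- by move=> a b; exact: metC.
- by move=> a k b c; rewrite /cometric linearP met_linear.
- move=> a Ha; rewrite -[a]flatVK; suff -> : (flat^-1)%VF a = 0 by rewrite linear0.
  by apply: (@met_nondeg _ _ g) => y; rewrite -[y]flatK; exact: Ha.
- by rewrite dimvf /dim /= muln1 mfd_dim_gt0.
Defined.

End Cometric.

Section ClRep.
Context (R : realType).

Record clrep := ClRep {
  cr_qs : quad_space R;
  cr_mod : vectType R;
  cr_map :> cliff cr_qs -> 'End(cr_mod);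
  cr_morph : clifford_morphism cr_map }.

Definition cr_vec (x : clrep) (v : cr_qs x) : 'End(cr_mod x) := x (cl_vec v).
Arguments cr_vec : clear implicits.

Lemma cr_vec_linear (x : clrep) : linear (cr_vec x).
Proof.
move=> a u v; rewrite /cr_vec cl_vec_is_linear.
by have [lx _ _] := cr_morph x; rewrite lx.
Qed.

Lemma cr_vec_sqr (x : clrep) v :
  (cr_vec x v \o cr_vec x v)%VF = qform v v *: \1%VF.
Proof.
have [lx x1 xM] := cr_morph x; rewrite /cr_vec -xM cl_vec_square.
have := lx (qform v v) 1 0; rewrite !addr0 x1 => ->.
have := lx (-1) 0 0; rewrite scaler0 addr0 scaleN1r addNr => ->.
by rewrite addr0.
Qed.

Definition weakly_faithful (x : clrep) : Prop := injective (cr_vec x).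

Definition clrep_morphism (x y : clrep)
    (f : 'Hom(cr_qs x, cr_qs y) * 'Hom(cr_mod x, cr_mod y)) : Prop :=
  is_isometry f.1 /\ forall v, (cr_vec y (f.1 v) \o f.2 = f.2 \o cr_vec x v)%VF.

Definition clrep_hom (x y : clrep) := {f | @clrep_morphism x y f}.

Fact clrep_id_morphism x : @clrep_morphism x x (\1%VF, \1%VF).
Proof.
split=> [|v]; first exact: isometry_id.
by rewrite id_lfunE comp_lfun1r comp_lfun1l.
Qed.

Fact clrep_comp_morphism x y z (g : clrep_hom y z) (f : clrep_hom x y) :
  @clrep_morphism x z ((sval g).1 \o (sval f).1, (sval g).2 \o (sval f).2)%VF.
Proof.
case: g f => -[g0 g1] [/= Ig gP] [[f0 f1] [/= If fP]]; split=> /= [|v].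
  exact: isometry_comp.
by rewrite comp_lfunE comp_lfunA gP -comp_lfunA fP comp_lfunA.
Qed.

Definition ClRepCat : category.
Proof.
refine (@Category clrep clrep_hom (fun x => exist _ _ (clrep_id_morphism x))
  (fun x y z g f => exist _ _ (clrep_comp_morphism g f)) _ _ _).
- by move=> x y [[f0 f] fP]; apply: sval_inj; rewrite /= !comp_lfun1l.
- by move=> x y [[f0 f] fP]; apply: sval_inj; rewrite /= !comp_lfun1r.
- by move=> x y z t h g f; apply: sval_inj; rewrite /= !comp_lfunA.
Defined.

Definition ClRepIso : category := core ClRepCat.

Definition iso_vec (x y : ClRepIso) (f : hom x y) : 'Hom(cr_qs x, cr_qs y) :=
  (sval (sval f)).1.
Definition iso_mod (x y : ClRepIso) (f : hom x y) : 'Hom(cr_mod x, cr_mod y) :=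
  (sval (sval f)).2.

End ClRep.
Arguments cr_vec {R} x v.
Arguments iso_vec {R x y} f.
Arguments iso_mod {R x y} f.

Lemma comp_lfun_bij (R : realType) (U V W : vectType R) (g : 'Hom(V, W))
  (f : 'Hom(U, V)) : bijective g -> bijective f -> bijective (g \o f)%VF.
Proof.
move=> bg bf; apply: (eq_bij (bij_comp bg bf)) => u.
by rewrite comp_lfunE.
Qed.

Section ClRepIsoTheory.
Context {R : realType}.
Implicit Types x y : clrep R.

Lemma iso_mod_bij x y (f : @hom (ClRepIso R) x y) : bijective (iso_mod f).
Proof.
case: f => -[[f0 f] fP] [[[g0 g] gP] [/= gf fg]]; rewrite /iso_mod /=.
case: gf => _ gf; case: fg => _ fg; exists g => u.
  by rewrite -comp_lfunE gf id_lfunE.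
by rewrite -comp_lfunE fg id_lfunE.
Qed.

Lemma iso_vec_bij x y (f : @hom (ClRepIso R) x y) : bijective (iso_vec f).
Proof.
case: f => -[[f0 f] fP] [[[g0 g] gP] [/= gf fg]]; rewrite /iso_vec /=.
case: gf => gf _; case: fg => fg _; exists g0 => u.
  by rewrite -comp_lfunE gf id_lfunE.
by rewrite -comp_lfunE fg id_lfunE.
Qed.

Lemma lfun_bijE (U V : vectType R) (f : 'Hom(U, V)) : bijective f ->
  lker f == 0%VS /\ limg f = fullv.
Proof.
case=> f' fK f'K; split; first exact/lker0P/(can_inj fK).
apply/eqP; rewrite eqEsubv subvf /=; apply/subvP => v _.
by rewrite -[v]f'K memv_img // memvf.
Qed.

Lemma lfun_bijV (U V : vectType R) (f : 'Hom(U, V)) : bijective f ->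
  (f^-1 \o f = \1)%VF /\ (f \o f^-1 = \1)%VF.
Proof.
move=> /lfun_bijE[k0 lf]; split; first exact: lker0_compVf.
by apply/lfunP => v; rewrite comp_lfunE id_lfunE limg_lfunVK // lf memvf.
Qed.

Lemma clrep_is_iso x y (f : @hom (ClRepCat R) x y) :
  bijective (sval f).1 -> bijective (sval f).2 -> is_iso f.
Proof.
case: f => -[f0 f] [/= If fP] /lfun_bijV[Vf0 f0V] /lfun_bijV[Vf fV].
have gP : @clrep_morphism R y x (f0^-1, f^-1)%VF.
  split=> /= [u v|v].
    by rewrite -If -!comp_lfunE f0V !id_lfunE.
  have := fP ((f0^-1)%VF v); rewrite -comp_lfunE f0V id_lfunE => E.
  rewrite -[RHS]comp_lfun1r -fV [RHS]comp_lfunA -(comp_lfunA _ _ f) E.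
  by rewrite comp_lfunA Vf comp_lfun1l.
exists (exist _ _ gP); split; apply: sval_inj => /=.
  by rewrite Vf0 Vf.
by rewrite f0V fV.
Qed.

End ClRepIsoTheory.

Section EndInverse.
Context {R : realType} {S : vectType R}.
Implicit Types a b : 'End(S).

Lemma end_bij a : lker a == 0%VS -> bijective a.
Proof. by move=> ka; exists (a^-1)%VF; [exact: lker0_lfunK|exact: lker0_lfunVK]. Qed.

Lemma lker_id : lker (\1%VF : 'End(S)) == 0%VS.
Proof. by apply/lker0P => u v; rewrite !id_lfunE. Qed.

Lemma lker_comp a b : lker a == 0%VS -> lker b == 0%VS -> lker (a \o b)%VF == 0%VS.
Proof.
move=> /lker0P ia /lker0P ib; apply/lker0P => u v.
by rewrite !comp_lfunE => /ia/ib.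
Qed.

Lemma lker_inv a : lker a == 0%VS -> lker (a^-1)%VF == 0%VS.
Proof. by move=> ka; apply/lker0P; exact: can_inj (lker0_lfunVK ka). Qed.

Lemma inv_id : ((\1%VF : 'End(S))^-1 = \1)%VF.
Proof. by rewrite -[LHS]comp_lfun1r; exact: lker0_compVf lker_id. Qed.

Lemma inv_comp a b : lker a == 0%VS -> lker b == 0%VS ->
  ((a \o b)^-1 = b^-1 \o a^-1)%VF.
Proof.
move=> ka kb; have kab := lker_comp ka kb.
rewrite -[RHS]comp_lfun1l -(lker0_compVf kab) -!comp_lfunA.
by rewrite (comp_lfunA b) (lker0_compfV kb) comp_lfun1l (lker0_compfV ka) comp_lfun1r.
Qed.

Lemma inv_inv a : lker a == 0%VS -> ((a^-1)^-1 = a)%VF.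
Proof.
move=> ka; have kV := lker_inv ka.
by rewrite -[LHS]comp_lfun1l -(lker0_compfV ka) -comp_lfunA (lker0_compfV kV) comp_lfun1r.
Qed.

Definition conj_lfun a : 'End('Hom(S, S)) := linfun (fun T => a \o T \o a^-1)%VF.

Lemma conj_lfunE a T : conj_lfun a T = (a \o T \o a^-1)%VF.
Proof.
rewrite /conj_lfun linfunE // => k u v.
by rewrite comp_lfunDr comp_lfunDl -comp_lfunZr -comp_lfunZl.
Qed.

Lemma conj_lfunM a b : lker a == 0%VS -> lker b == 0%VS ->
  conj_lfun (a \o b)%VF = (conj_lfun a \o conj_lfun b)%VF.
Proof.
by move=> ka kb; apply/lfunP => T; rewrite comp_lfunE !conj_lfunE inv_comp // !comp_lfunA.
Qed.

Lemma conj_lfun1 : conj_lfun \1%VF = \1%VF.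
Proof.
by apply/lfunP => T; rewrite conj_lfunE inv_id comp_lfun1r comp_lfun1l id_lfunE.
Qed.

End EndInverse.

Record lin_group (R : realType) := LinGroup {
  lg_sort :> groupType;
  lg_mod : vectType R;
  lg_rep : lg_sort -> 'End(lg_mod);
  lg_rep_inj : injective lg_rep;
  lg_rep1 : lg_rep 1%g = \1%VF;
  lg_repM : forall a b : lg_sort, lg_rep (a * b)%g = (lg_rep a \o lg_rep b)%VF }.

Section OrthogonalGroup.
Context {R : realType} (V : quad_space R).

Definition ortho_pred : pred 'End(V) :=
  fun f => (lker f == 0%VS) && `[< is_isometry f >].

Record ortho := Ortho { ortho_val :> 'End(V); _ : ortho_pred ortho_val }.

HB.instance Definition _ := [isSub for ortho_val].
HB.instance Definition _ := [Choice of ortho by <:].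

Lemma orthoP (f : ortho) : lker f == 0%VS /\ is_isometry f.
Proof. by case: f => f /= /andP[kf /asboolP]. Qed.

Lemma ortho_lker (f : ortho) : lker f == 0%VS.
Proof. by case: (orthoP f). Qed.

Fact ortho1_subproof : ortho_pred \1%VF.
Proof. by rewrite /ortho_pred lker_id; apply/asboolP; exact: isometry_id. Qed.
Fact orthoM_subproof (f g : ortho) : ortho_pred (f \o g)%VF.
Proof.
have [kf If] := orthoP f; have [kg Ig] := orthoP g.
by rewrite /ortho_pred lker_comp //; apply/asboolP; exact: isometry_comp.
Qed.
Fact orthoV_subproof (f : ortho) : ortho_pred (f^-1)%VF.
Proof.
have [kf If] := orthoP f; rewrite /ortho_pred lker_inv //; apply/asboolP => u v.
by rewrite -If !lker0_lfunVK.
Qed.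

Definition ortho1 := Ortho ortho1_subproof.
Definition orthoM f g := Ortho (orthoM_subproof f g).
Definition orthoV f := Ortho (orthoV_subproof f).

Fact orthoA : associative orthoM.
Proof. by move=> f g h; apply: val_inj; exact: comp_lfunA. Qed.
Fact ortho1M : left_id ortho1 orthoM.
Proof. by move=> f; apply: val_inj; exact: comp_lfun1l. Qed.
Fact orthoM1 : right_id ortho1 orthoM.
Proof. by move=> f; apply: val_inj; exact: comp_lfun1r. Qed.
Fact orthoVM : left_inverse ortho1 orthoV orthoM.
Proof. by move=> f; apply: val_inj; exact: lker0_compVf (ortho_lker f). Qed.
Fact orthoMV : right_inverse ortho1 orthoV orthoM.
Proof. by move=> f; apply: val_inj; exact: lker0_compfV (ortho_lker f). Qed.

HB.instance Definition _ := isGroup.Build ortho orthoA ortho1M orthoM1 orthoVM orthoMV.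

Definition orthogonal_group : lin_group R :=
  @LinGroup R ortho V ortho_val val_inj erefl (fun f g => erefl).

End OrthogonalGroup.

Record wf_clrep (R : realType) := WfClRep {
  wf_rep :> clrep R;
  wf_faithful : weakly_faithful wf_rep }.

Section LipschitzGroup.
Context {R : realType} (eta : wf_clrep R).
Local Notation V := (cr_qs eta).
Local Notation S0 := (cr_mod eta).

Definition cr_lin : 'Hom(V, 'Hom(S0, S0)) := linfun (cr_vec eta).

Lemma cr_linE v : cr_lin v = cr_vec eta v.
Proof. by rewrite /cr_lin linfunE //; exact: cr_vec_linear. Qed.

Lemma cr_lin_lker : lker cr_lin == 0%VS.
Proof. by apply/lker0P => u v; rewrite !cr_linE => /wf_faithful. Qed.

Definition lip_pred : pred 'End(S0) := fun a =>
  (lker a == 0%VS) && (conj_lfun a @: limg cr_lin <= limg cr_lin)%VS.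

Record lip := Lip { lip_val :> 'End(S0); _ : lip_pred lip_val }.

HB.instance Definition _ := [isSub for lip_val].
HB.instance Definition _ := [Choice of lip by <:].

Lemma lip_lker (a : lip) : lker a == 0%VS.
Proof. by case: a => a /= /andP[]. Qed.

Lemma lip_conj (a : lip) : (conj_lfun a @: limg cr_lin <= limg cr_lin)%VS.
Proof. by case: a => a /= /andP[]. Qed.

Fact lip1_subproof : lip_pred \1%VF.
Proof. by rewrite /lip_pred lker_id conj_lfun1 lim1g subvv. Qed.
Fact lipM_subproof (a b : lip) : lip_pred (a \o b)%VF.
Proof.
rewrite /lip_pred lker_comp ?lip_lker // conj_lfunM ?lip_lker // limg_comp.
by apply: subv_trans (lip_conj a); rewrite limgS // lip_conj.
Qed.
Fact lipV_subproof (a : lip) : lip_pred (a^-1)%VF.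
Proof.
have ka := lip_lker a; rewrite /lip_pred lker_inv //=.
have VK : (conj_lfun a^-1 \o conj_lfun a = \1)%VF.
  by rewrite -(conj_lfunM (lker_inv ka) ka) (lker0_compVf ka) conj_lfun1.
have kc : lker (conj_lfun a) == 0%VS.
  apply/lker0P => S T ST; rewrite -[S]id_lfunE -[T]id_lfunE -VK.
  by rewrite !comp_lfunE ST.
have E : (conj_lfun a @: limg cr_lin)%VS = limg cr_lin.
  have k0 : (limg cr_lin :&: lker (conj_lfun a) = 0)%VS by rewrite (eqP kc) capv0.
  by apply/eqP; rewrite eqEdim lip_conj (limg_dim_eq k0) leqnn.
by rewrite -{1}E -limg_comp VK lim1g subvv.
Qed.

Definition lip1 := Lip lip1_subproof.
Definition lipM a b := Lip (lipM_subproof a b).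
Definition lipV a := Lip (lipV_subproof a).

Fact lipA : associative lipM.
Proof. by move=> f g h; apply: val_inj; exact: comp_lfunA. Qed.
Fact lip1M : left_id lip1 lipM.
Proof. by move=> f; apply: val_inj; exact: comp_lfun1l. Qed.
Fact lipM1 : right_id lip1 lipM.
Proof. by move=> f; apply: val_inj; exact: comp_lfun1r. Qed.
Fact lipVM : left_inverse lip1 lipV lipM.
Proof. by move=> f; apply: val_inj; exact: lker0_compVf (lip_lker f). Qed.
Fact lipMV : right_inverse lip1 lipV lipM.
Proof. by move=> f; apply: val_inj; exact: lker0_compfV (lip_lker f). Qed.

HB.instance Definition _ := isGroup.Build lip lipA lip1M lipM1 lipVM lipMV.

Definition lipschitz_group : lin_group R :=
  @LinGroup R lip S0 lip_val val_inj erefl (fun f g => erefl).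

Definition Ad0_lfun (a : lip) : 'End(V) := (cr_lin^-1 \o conj_lfun a \o cr_lin)%VF.

Lemma Ad0_conj a v : cr_vec eta (Ad0_lfun a v) = (a \o cr_vec eta v \o a^-1)%VF.
Proof.
rewrite -cr_linE /Ad0_lfun !comp_lfunE limg_lfunVK ?conj_lfunE ?cr_linE //.
rewrite -cr_linE -conj_lfunE; apply: (subvP (lip_conj a)).
by rewrite !memv_img ?memvf.
Qed.

Lemma Ad0_comp a v : (cr_vec eta (Ad0_lfun a v) \o a = a \o cr_vec eta v)%VF.
Proof. by rewrite Ad0_conj -!comp_lfunA (lker0_compVf (lip_lker a)) comp_lfun1r. Qed.

Lemma id_end_neq0 : (\1%VF : 'End(S0)) != 0.
Proof.
apply/eqP => id0; have := qs_dim_gt0 V; rewrite lt0n dimv_eq0 => /negP; apply.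
apply/eqP/vspaceP => v; rewrite memvf memv0; apply/esym/eqP.
apply: (@wf_faithful _ eta); rewrite -(comp_lfun1r (cr_vec _ v)).
by rewrite -[RHS]comp_lfun1r id0 !comp_lfun0r.
Qed.

Lemma Ad0_isometry a : is_isometry (Ad0_lfun a).
Proof.
have sq v : qform (Ad0_lfun a v) (Ad0_lfun a v) = qform v v.
  apply/eqP; rewrite -subr_eq0.
  have : (qform (Ad0_lfun a v) (Ad0_lfun a v) - qform v v) *: (\1%VF : 'End(S0)) == 0.
    rewrite scalerBl -!cr_vec_sqr Ad0_conj -!comp_lfunA subr_eq0.
    rewrite (comp_lfunA (a : 'End(S0))^-1%VF) lker0_compVf ?lip_lker // comp_lfun1l.
    rewrite (comp_lfunA (cr_vec eta v) (cr_vec eta v)) cr_vec_sqr.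
    by rewrite -comp_lfunZl comp_lfun1l -comp_lfunZr lker0_compfV // lip_lker.
  by rewrite scaler_eq0 (negbTE id_end_neq0) orbF.
have polar (h : V -> V) u v : (forall k, qform (h k) (h k) = qform k k) ->
    linear h -> qform (h u) (h v) = qform u v.
  move=> hh hl; have hD : h (u + v) = h u + h v by have := hl 1 u v; rewrite !scale1r.
  have qD (x y : V) : qform (x + y) (x + y) = qform x x + qform x y *+ 2 + qform y y.
    have qDl (z t s : V) : qform z (t + s) = qform z t + qform z s.
      by have := @qform_linear _ V z 1 t s; rewrite scale1r mul1r.
    rewrite qDl !(qformC (x + y)) !qDl (qformC y x) mulr2n !addrA.
    by congr (_ + _).
  have := hh (u + v); rewrite hD !qD !hh => /addIr/addrI/eqP.
  by rewrite eqrMn2r => /eqP.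
by move=> u v; apply: polar => // k x y; rewrite linearP.
Qed.

Fact Ad0_subproof a : ortho_pred (Ad0_lfun a).
Proof.
by rewrite /ortho_pred (isometry_inj (Ad0_isometry a)); apply/asboolP/Ad0_isometry.
Qed.

Definition Ad0 (a : lipschitz_group) : orthogonal_group V := Ortho (Ad0_subproof a).

Lemma Ad0M a b : Ad0 (a * b)%g = (Ad0 a * Ad0 b)%g.
Proof.
apply: val_inj; apply/lfunP => v; apply: (@wf_faithful _ eta).
have ka := lip_lker a; have kb := lip_lker b.
rewrite [in RHS]/= comp_lfunE !Ad0_conj [val _]/= [lip_val _]/= inv_comp //.
by rewrite !comp_lfunA.
Qed.

Fact lip_aut_morphism a : @clrep_morphism R eta eta (Ad0_lfun a, lip_val a).
Proof. by split; [exact: Ad0_isometry|exact: Ad0_comp]. Qed.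

Fact lip_aut_is_iso a :
  is_iso (exist _ _ (lip_aut_morphism a) : @hom (ClRepCat R) eta eta).
Proof.
apply: clrep_is_iso => /=; last exact/end_bij/lip_lker.
exact/end_bij/isometry_inj/Ad0_isometry.
Qed.

Definition lip_aut (a : lip) : @hom (ClRepIso R) eta eta :=
  exist _ _ (lip_aut_is_iso a).

End LipschitzGroup.

(* A smooth principal bundle over [M] is presented by its fibers, the right
   action, and an atlas of local trivializations; a local trivialization over
   [U] is given by the corresponding local section (whose values outside of [U]
   are irrelevant).  The structure groups are groups of matrices, and a map into
   such a group is smooth when it is smooth as a matrix-valued map. *)
Section PrincipalBundles.
Context {R : realType} (M : manifold R).

Record pbundle_data (G : lin_group R) := PBundleData {
  pb_fib :> M -> Type;
  pb_act : forall m, pb_fib m -> G -> pb_fib m;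
  pb_atlas : set M -> (forall m, pb_fib m) -> Prop }.

Definition pb_smooth (G G' : lin_group R) (P : pbundle_data G)
    (P' : pbundle_data G') (f : forall m, P m -> P' m) : Prop :=
  forall U s U' s', pb_atlas (p := P) U s -> pb_atlas (p := P') U' s' ->
  forall k : M -> G',
    (forall m, (U `&` U') m -> f m (s m) = pb_act (s' m) (k m)) ->
    smooth_hom (U `&` U') (fun m => lg_rep (k m)).

Record is_principal (G : lin_group R) (P : pbundle_data G) : Prop := IsPrincipal {
  pb_act1 : forall m (q : P m), pb_act q 1%g = q;
  pb_actM : forall m (q : P m) (a b : G), pb_act q (a * b)%g = pb_act (pb_act q a) b;
  pb_inhabited : forall m, inhabited (P m);
  pb_torsor : forall m (q q' : P m), exists! a : G, q' = pb_act q a;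
  pb_open : forall U s, pb_atlas (p := P) U s -> open U;
  pb_cover : forall m, exists U s, pb_atlas (p := P) U s /\ U m;
  pb_transition : pb_smooth (fun m (q : P m) => q) }.

End PrincipalBundles.

Section Reductions.
Context {R : realType} (M : manifold R) (H G : lin_group R) (phi : H -> G).
Context (P : pbundle_data M G).

Record reduction_data := ReductionData {
  rd_bundle :> pbundle_data M H;
  rd_map : forall m, rd_bundle m -> P m }.

Record is_reduction (Q : reduction_data) : Prop := IsReduction {
  rd_principal : is_principal Q;
  rd_smooth : pb_smooth (@rd_map Q);
  rd_equiv : forall m (q : Q m) (a : H),
    rd_map (pb_act q a) = pb_act (rd_map q) (phi a) }.

Record reduction := Reduction {
  red_data :> reduction_data;
  redP : is_reduction red_data }.

Record reduction_morphism (Q Q' : reduction_data) (f : forall m, Q m -> Q' m) :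
    Prop := ReductionMorphism {
  rm_smooth : pb_smooth f;
  rm_equiv : forall m (q : Q m) (a : H), f m (pb_act q a) = pb_act (f m q) a;
  rm_map : forall m (q : Q m), rd_map (f m q) = rd_map q }.

Definition reduction_hom (Q Q' : reduction) :=
  {f : forall m, Q m -> Q' m | reduction_morphism f}.

Fact reduction_id_morphism (Q : reduction) :
  reduction_morphism (fun m (q : Q m) => q).
Proof. by split=> //; exact: pb_transition (rd_principal (redP Q)). Qed.

Fact reduction_comp_morphism (Q Q' Q'' : reduction) (g : reduction_hom Q' Q'')
    (f : reduction_hom Q Q') :
  reduction_morphism (fun m (q : Q m) => sval g m (sval f m q)).
Proof.
case: g f => g [gs ge gt] [f [fs fe ft]]; split=> /= [|m q a|m q].
- move=> U s U'' s'' Us Us'' k gfk.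
  have [PQ PQ'] := (rd_principal (redP Q), rd_principal (redP Q')).
  have PQ'' := rd_principal (redP Q'').
  have oU := pb_open PQ Us; have oU'' := pb_open PQ'' Us''.
  move=> v l; apply: smooth_fun_local => m [Um U''m].
  have [U' [s' [Us' U'm]]] := pb_cover PQ' m.
  have oU' := pb_open PQ' Us'.
  pose k1 x : H := sval (boolp.cid (pb_torsor PQ' (s' x) (f x (s x)))).
  have k1P x : f x (s x) = pb_act (s' x) (k1 x).
    by rewrite /k1; case: boolp.cid => a [].
  pose k2 x : H := sval (boolp.cid (pb_torsor PQ'' (s'' x) (g x (s' x)))).
  have k2P x : g x (s' x) = pb_act (s'' x) (k2 x).
    by rewrite /k2; case: boolp.cid => a [].
  pose O := (U `&` U') `&` (U' `&` U'').
  have oO : open O by do !apply: openI.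
  exists O; split=> //.
  have s1 : smooth_hom O (fun x => lg_rep (k1 x)).
    move=> w l'; have /(_ w l') := fs _ _ _ _ Us Us' k1 (fun x _ => k1P x).
    by apply: smooth_fun_sub => x [].
  have s2 : smooth_hom O (fun x => lg_rep (k2 x)).
    move=> w l'; have /(_ w l') := gs _ _ _ _ Us' Us'' k2 (fun x _ => k2P x).
    by apply: smooth_fun_sub => x [].
  have := smooth_hom_comp oO s2 s1 v l; apply: smooth_fun_ext => // x.
  rewrite inE => -[[Ux U'x] [_ U''x]]; rewrite -lg_repM; congr (l (lg_rep _ v)).
  have E : pb_act (s'' x) (k x) = pb_act (s'' x) (k2 x * k1 x)%g.
    by rewrite -gfk // k1P ge k2P (pb_actM PQ'').
  have [a [_ ua]] := pb_torsor PQ'' (s'' x) (pb_act (s'' x) (k x)).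
  by rewrite -(ua _ erefl) (ua _ E).
- by rewrite fe ge.
- by rewrite gt ft.
Qed.

Definition ReductionCat : category.
Proof.
refine (@Category reduction reduction_hom
  (fun Q => exist _ _ (reduction_id_morphism Q))
  (fun x y z g f => exist _ _ (reduction_comp_morphism g f)) _ _ _).
- by move=> x y f; apply: sval_inj.
- by move=> x y f; apply: sval_inj.
- by move=> x y z t h g f; apply: sval_inj.
Defined.

End Reductions.

Section VectorBundles.
Context {R : realType} (M : manifold R).

(* likewise for vector bundles: fibers, typical fiber, and local
   trivializations, of which only the values over [U] matter *)
Record vbundle_data := VBundleData {
  vb_fib :> M -> vectType R;
  vb_model : vectType R;
  vb_atlas : set M -> (forall m, 'Hom(vb_model, vb_fib m)) -> Prop }.

Definition vb_smooth (E E' : vbundle_data) (f : forall m, 'Hom(E m, E' m)) : Prop :=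
  forall U t U' t', vb_atlas (v := E) U t -> vb_atlas (v := E') U' t' ->
    smooth_hom (U `&` U') (fun m => (t' m)^-1 \o f m \o t m)%VF.

Definition vb_smooth_end (E : vbundle_data) (U : set M) (A : forall m, 'End(E m)) :
    Prop :=
  forall U' t, vb_atlas (v := E) U' t ->
    smooth_hom (U `&` U') (fun m => (t m)^-1 \o A m \o t m)%VF.

Record is_vbundle (E : vbundle_data) : Prop := IsVBundle {
  vb_open : forall U t, vb_atlas (v := E) U t -> open U;
  vb_bij : forall U t, vb_atlas (v := E) U t -> forall m, U m -> bijective (t m);
  vb_cover : forall m, exists U t, vb_atlas (v := E) U t /\ U m;
  vb_transition : vb_smooth (fun m => \1%VF : 'End(E m)) }.

Lemma vb_smooth_comp (E E' E'' : vbundle_data) (g : forall m, 'Hom(E' m, E'' m))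
    (f : forall m, 'Hom(E m, E' m)) :
  is_vbundle E -> is_vbundle E' -> is_vbundle E'' ->
  vb_smooth g -> vb_smooth f -> vb_smooth (fun m => g m \o f m)%VF.
Proof.
move=> hE hE' hE'' gs fs U t U'' t'' Ut Ut'' v l.
have oU := vb_open hE Ut; have oU'' := vb_open hE'' Ut''.
apply: smooth_fun_local => m [Um U''m].
have [U' [t' [Ut' U'm]]] := vb_cover hE' m.
have oU' := vb_open hE' Ut'.
pose O := (U `&` U') `&` (U' `&` U'').
have oO : open O by do !apply: openI.
exists O; split=> //.
have s1 : smooth_hom O (fun x => (t' x)^-1 \o f x \o t x)%VF.
  move=> w l'; have /(_ w l') := fs _ _ _ _ Ut Ut'.
  by apply: smooth_fun_sub => x [].
have s2 : smooth_hom O (fun x => (t'' x)^-1 \o g x \o t' x)%VF.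
  move=> w l'; have /(_ w l') := gs _ _ _ _ Ut' Ut''.
  by apply: smooth_fun_sub => x [].
have := smooth_hom_comp oO s2 s1 v l; apply: smooth_fun_ext => // x.
rewrite inE => -[[Ux U'x] _]; congr (l _).
have [_ tV] := lfun_bijV (vb_bij hE' Ut' U'x).
congr (fun_of_lfun _ v).
by rewrite -!comp_lfunA (comp_lfunA (t' x)) tV comp_lfun1l.
Qed.

End VectorBundles.

Section PinorBundles.
Context {R : realType} {M : manifold R} (g : metric M).
Local Notation n := (mfd_dim M).

(* The products of the coordinate covectors over the subsets of the indices
   are the local frame of the vector bundle Cl(T*M, g* ) over the domain of a
   chart. *)
Definition cl_frame (c : chart R M n) (m : M) (I : {set 'I_n}) :
    cliff (cotangent_qs g m) :=
  \prod_(i <- enum I) cl_vec (dcoord c m i : cotangent_qs g m).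

Record pinor_data := PinorData {
  pd_bundle :> vbundle_data M;
  pd_gam : forall m, cliff (cotangent_qs g m) -> 'End(pd_bundle m) }.

Record is_pinor (S : pinor_data) : Prop := IsPinor {
  pd_vbundle : is_vbundle S;
  pd_neq0 : forall m, (0 < \dim {:S m})%N;
  pd_morph : forall m, clifford_morphism (@pd_gam S m);
  pd_smooth : forall c, atlas c -> forall I : {set 'I_n},
    vb_smooth_end (cdom c) (fun m => pd_gam S (cl_frame c m I)) }.

Record pinor := Pinor { pn_data :> pinor_data; pnP : is_pinor pn_data }.

Definition pinor_fiber (S : pinor) (m : M) : clrep R :=
  ClRep (pd_morph (pnP S) m).

Record pinor_morphism (S S' : pinor_data) (f : forall m, 'Hom(S m, S' m)) : Prop :=
  PinorMorphism {
    pm_smooth : vb_smooth f;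
    pm_comm : forall m (x : cliff (cotangent_qs g m)),
      (f m \o pd_gam S x = pd_gam S' x \o f m)%VF }.

Definition pinor_hom (S S' : pinor) :=
  {f : forall m, 'Hom(S m, S' m) | pinor_morphism f}.

Fact pinor_id_morphism (S : pinor) :
  pinor_morphism (fun m => \1%VF : 'End(S m)).
Proof.
split; first exact: vb_transition (pd_vbundle (pnP S)).
by move=> m x; rewrite comp_lfun1l comp_lfun1r.
Qed.

Fact pinor_comp_morphism (S S' S'' : pinor) (f' : pinor_hom S' S'')
    (f : pinor_hom S S') :
  pinor_morphism (fun m => sval f' m \o sval f m)%VF.
Proof.
case: f' f => f' [f's f'c] [f [fs fc]]; split=> /= [|m x].
  by apply: vb_smooth_comp => //; exact: pd_vbundle (pnP _).
by rewrite -comp_lfunA fc comp_lfunA f'c comp_lfunA.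
Qed.

Definition PinorCat : category.
Proof.
refine (@Category pinor pinor_hom (fun S => exist _ _ (pinor_id_morphism S))
  (fun x y z f' f => exist _ _ (pinor_comp_morphism f' f)) _ _ _).
- by move=> x y [f fP]; apply: sval_inj; apply/functional_extensionality_dep => m; exact: comp_lfun1l.
- by move=> x y [f fP]; apply: sval_inj; apply/functional_extensionality_dep => m; exact: comp_lfun1r.
- by move=> x y z t h g' f; apply: sval_inj; apply/functional_extensionality_dep => m; exact: comp_lfunA.
Defined.

End PinorBundles.

Section Groupoids.
Context {R : realType} {M : manifold R} (g : metric M) (eta : wf_clrep R).

Definition pinor_of_type (S : PinorCat g) : Prop :=
  (forall m, weakly_faithful (pinor_fiber S m)) /\
  (forall m, inhabited (@hom (ClRepIso R) eta (pinor_fiber S m))).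

Definition PinorGroupoid : category := core (full_subcategory pinor_of_type).

Definition coframe (V : quad_space R) (m : M) : Type :=
  {f : 'Hom(V, cotangent_qs g m) | is_isometry f /\ bijective f}.

Fact coframe_act_subproof V m (f : coframe V m) (a : ortho V) :
  is_isometry (sval f \o ortho_val a)%VF /\ bijective (sval f \o ortho_val a)%VF.
Proof.
case: f => f [If bf]; have [ka Ia] := orthoP a.
by split; [exact: isometry_comp|exact/comp_lfun_bij/end_bij].
Qed.

(* P_O(V,h)(M,g), with the smooth structure it has inside Hom(V, T*M) *)
Definition coframe_bundle (V : quad_space R) : pbundle_data M (orthogonal_group V) :=
  @PBundleData R M (orthogonal_group V) (coframe V)
    (fun m f a => exist _ _ (coframe_act_subproof f a))
    (fun U s => open U /\ forall v, smooth_covector U (fun m => sval (s m) v)).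

Definition LipschitzCat : category :=
  @ReductionCat R M (lipschitz_group eta) (orthogonal_group (cr_qs eta))
    (@Ad0 R eta) (coframe_bundle (cr_qs eta)).

Definition LipschitzGroupoid : category := core LipschitzCat.

End Groupoids.

Section CoreFunctors.

Lemma core_is_iso (C : category) (x y : core C) (f : hom x y) : is_iso f.
Proof.
case: f => f [g [gf fg]]; have ig : is_iso g by exists f.
exists (exist _ g ig); split; exact: sval_inj.
Qed.

Lemma fmap_is_iso (C D : category) (F : functor C D) (x y : C) (f : hom x y) :
  is_iso f -> is_iso (fmap F f).
Proof.
by case=> g [gf fg]; exists (fmap F g); rewrite -!fmap_comp gf fg !fmap_id.
Qed.

Definition core_lift (C D : category) (F : functor (core C) D) :
  functor (core C) (core D).
Proof.
refine (@Functor (core C) (core D) F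
  (fun x y f => exist _ (fmap F f) (fmap_is_iso F (core_is_iso f))) _ _).
- by move=> x; apply: sval_inj; exact: fmap_id.
- by move=> x y z g f; apply: sval_inj; exact: fmap_comp.
Defined.

End CoreFunctors.

Section QFunctor.
Context {R : realType} {M : manifold R} (g : metric M) (eta : wf_clrep R).
Local Notation B := (PinorGroupoid g eta).
Local Notation L := (LipschitzGroupoid g eta).
Local Notation V := (cr_qs eta).

Definition Q_fiber (S : pinor g) (m : M) : Type :=
  @hom (ClRepIso R) eta (pinor_fiber S m).

(* A local section of Hom(eta, gamma) is smooth when both of its components, in
   Hom(V, T*M) and in Hom(S_0, S), are. *)
Definition Q_bundle (S : pinor g) : pbundle_data M (lipschitz_group eta) :=
  @PBundleData R M (lipschitz_group eta) (Q_fiber S)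
    (fun m q a => compm q (lip_aut a))
    (fun U s => [/\ open U,
       forall v, smooth_covector U (fun m => iso_vec (s m) v) &
       forall U' t, vb_atlas (v := S) U' t ->
         smooth_hom (U `&` U') (fun m => (t m)^-1 \o iso_mod (s m))%VF]).

Fact Q_tau_subproof S m (q : Q_fiber S m) :
  is_isometry (iso_vec q) /\ bijective (iso_vec q).
Proof. by split; [case: q => -[f []]|exact: iso_vec_bij]. Qed.

Definition Q_data (S : pinor g) :
    reduction_data (lipschitz_group eta) (coframe_bundle g V) :=
  @ReductionData R M (lipschitz_group eta) (orthogonal_group V)
    (coframe_bundle g V) (Q_bundle S)
    (fun m q => exist _ _ (Q_tau_subproof q)).

Fact pinor_fiber_morphism (S S' : pinor g) (f : pinor_hom S S') m :
  @clrep_morphism R (pinor_fiber S m) (pinor_fiber S' m) (\1%VF, sval f m).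
Proof.
split=> /= [|v]; first exact: isometry_id.
by rewrite id_lfunE /cr_vec /= (pm_comm (svalP f)).
Qed.

Fact pinor_fiber_is_iso (S S' : pinor g) (f : @hom (PinorCat g) S S') m :
  is_iso f -> @is_iso (ClRepCat R) (pinor_fiber S m) (pinor_fiber S' m)
    (exist _ _ (pinor_fiber_morphism f m)).
Proof.
case: f => f fP [[f' f'P] [/= f'f ff']]; apply: clrep_is_iso => /=.
  by exists id => u; rewrite id_lfunE.
have /= f'fm := congr1 (fun h => sval h m) f'f.
have /= ff'm := congr1 (fun h => sval h m) ff'.
by exists (f' m) => u; rewrite -comp_lfunE ?f'fm ?ff'm id_lfunE.
Qed.

Definition pinor_fiber_iso (x y : B) (f : hom x y) (m : M) :
    @hom (ClRepIso R) (pinor_fiber (sval x) m) (pinor_fiber (sval y) m) :=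
  exist _ _ (pinor_fiber_is_iso m (svalP f)).

Definition Q_map (x y : B) (f : hom x y) (m : M) (q : Q_data (sval x) m) :
    Q_data (sval y) m :=
  compm (pinor_fiber_iso f m) q.

(* [Q_data] and [Q_map] are only raw data; that they consist of smooth bundles and
   smooth morphisms is part of what the main theorem asserts. *)
Record Q_well_defined : Prop := QWellDefined {
  Qwd_ob : forall x : B, is_reduction (@Ad0 R eta) (Q_data (sval x));
  Qwd_mor : forall (x y : B) (f : hom x y), reduction_morphism (Q_map f) }.

Definition Q_reduction_functor (w : Q_well_defined) :
  functor B (LipschitzCat g eta).
Proof.
refine (@Functor B (LipschitzCat g eta)
  (fun x => Reduction (Qwd_ob w x))
  (fun x y f => exist _ (Q_map f) (Qwd_mor w f)) _ _).
- move=> x; apply: sval_inj; apply/functional_extensionality_dep => m.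
  apply/funext => q; do 2!apply: sval_inj; rewrite /= !comp_lfun1l.
  by case: (sval (sval q)).
- move=> x y z f' f; apply: sval_inj; apply/functional_extensionality_dep => m.
  apply/funext => q; do 2!apply: sval_inj; rewrite /= !comp_lfun1l.
  by rewrite comp_lfunA.
Defined.

Definition Q_functor (w : Q_well_defined) : functor B L :=
  core_lift (Q_reduction_functor w).

End QFunctor.

Section AssociatedBundle.
Context {R : realType} {M : manifold R} {H : lin_group R} {Q : pbundle_data M H}.
Context (PQ : is_principal Q) (m : M).
Local Notation S0 := (lg_mod H).

(* the fiber at [m] of the bundle associated to [Q] through the tautological
   representation of the matrix group [H]: classes of pairs, where
   (q a, s) ~ (q, a s) *)
Definition assoc_pair (P : is_principal Q) : Type := Q m * S0.

HB.instance Definition _ := gen_eqMixin (assoc_pair PQ).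
HB.instance Definition _ := gen_choiceMixin (assoc_pair PQ).

Definition assoc_eqv : rel (assoc_pair PQ) := fun x y =>
  `[< exists a : H, x.1 = pb_act y.1 a /\ y.2 = lg_rep a x.2 >].

Fact assoc_eqv_refl : reflexive assoc_eqv.
Proof.
by move=> x; apply/asboolP; exists 1%g; rewrite (pb_act1 PQ) lg_rep1 id_lfunE.
Qed.

Fact assoc_eqv_sym : symmetric assoc_eqv.
Proof.
suff sym1 x y : assoc_eqv x y -> assoc_eqv y x by move=> x y; apply/idP/idP; exact: sym1.
move=> /asboolP[a [xy yx]]; apply/asboolP; exists a^-1%g; split.
  by rewrite xy -(pb_actM PQ) mulgV (pb_act1 PQ).
by rewrite yx -comp_lfunE -lg_repM mulVg lg_rep1 id_lfunE.
Qed.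

Fact assoc_eqv_trans : transitive assoc_eqv.
Proof.
move=> y x z /asboolP[a [xy yx]] /asboolP[b [yz zy]]; apply/asboolP.
exists (b * a)%g; split; first by rewrite xy yz (pb_actM PQ).
by rewrite zy yx -comp_lfunE lg_repM.
Qed.

Canonical assoc_equiv :=
  EquivRel assoc_eqv assoc_eqv_refl assoc_eqv_sym assoc_eqv_trans.

Definition assoc := {eq_quot assoc_equiv}%qT.

HB.instance Definition _ := Choice.on assoc.
HB.instance Definition _ := Quotient.on assoc.

Definition assoc_class (q : Q m) (s : S0) : assoc := (\pi_assoc (q, s))%qT.

Lemma assoc_classP q s q' s' : assoc_class q s = assoc_class q' s' <->
  exists a : H, q = pb_act q' a /\ s' = lg_rep a s.
Proof.
split=> [/eqP|qs]; first by rewrite eqmodE => /asboolP.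
by apply/eqP; rewrite eqmodE; apply/asboolP.
Qed.

Lemma assoc_class_act q a s :
  assoc_class (pb_act q a) s = assoc_class q (lg_rep a s).
Proof. by apply/assoc_classP; exists a. Qed.

Lemma assoc_reprP (x : assoc) : assoc_class (repr x).1 (repr x).2 = x.
Proof. by rewrite /assoc_class -surjective_pairing; exact: reprK. Qed.

Definition pb_diff (q q' : Q m) : H := sval (boolp.cid (pb_torsor PQ q q')).

Lemma pb_diffP q q' : q' = pb_act q (pb_diff q q').
Proof. by rewrite /pb_diff; case: boolp.cid => a []. Qed.

Lemma pb_act_inj (q : Q m) : injective (@pb_act _ _ _ Q m q).
Proof.
move=> a b ab; have [c [_ uc]] := pb_torsor PQ q (pb_act q a).
by rewrite -(uc a erefl) (uc b ab).
Qed.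

Lemma lg_rep_bij (a : H) : bijective (lg_rep a).
Proof.
exists (lg_rep a^-1%g) => s; rewrite -comp_lfunE -lg_repM.
  by rewrite mulVg lg_rep1 id_lfunE.
by rewrite mulgV lg_rep1 id_lfunE.
Qed.

Lemma assoc_class_inj q : injective (assoc_class q).
Proof.
move=> s s' /assoc_classP[a [qa ->]].
have -> : a = 1%g by apply: (@pb_act_inj q); rewrite (pb_act1 PQ) -qa.
by rewrite lg_rep1 id_lfunE.
Qed.

(* A base point of the fiber; the vector space structure below does not depend
   on it, see [assoc_class_linear]. *)
Definition pb_point : Q m :=
  sval (boolp.cid (let: inhabits q := pb_inhabited PQ m in ex_intro (fun=> True) q I)).

Definition assoc_coord (x : assoc) : S0 :=
  lg_rep (pb_diff pb_point (repr x).1) (repr x).2.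

Lemma assoc_coordK x : assoc_class pb_point (assoc_coord x) = x.
Proof. by rewrite -assoc_class_act -pb_diffP assoc_reprP. Qed.

Lemma assoc_classK s : assoc_coord (assoc_class pb_point s) = s.
Proof. by apply: (@assoc_class_inj pb_point); rewrite assoc_coordK. Qed.

Definition assoc_zero : assoc := assoc_class pb_point 0.
Definition assoc_opp (x : assoc) : assoc := assoc_class pb_point (- assoc_coord x).
Definition assoc_add (x y : assoc) : assoc :=
  assoc_class pb_point (assoc_coord x + assoc_coord y).
Definition assoc_scale (a : R) (x : assoc) : assoc :=
  assoc_class pb_point (a *: assoc_coord x).

Let coord_inj : injective assoc_coord := can_inj assoc_coordK.
Let coordE := assoc_classK.

Fact assoc_addA : associative assoc_add.
Proof. by move=> x y z; apply: coord_inj; rewrite !coordE addrA. Qed.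
Fact assoc_addC : commutative assoc_add.
Proof. by move=> x y; apply: coord_inj; rewrite !coordE addrC. Qed.
Fact assoc_add0 : left_id assoc_zero assoc_add.
Proof. by move=> x; apply: coord_inj; rewrite !coordE add0r. Qed.
Fact assoc_addN : left_inverse assoc_zero assoc_opp assoc_add.
Proof. by move=> x; apply: coord_inj; rewrite !coordE addNr. Qed.

HB.instance Definition _ := GRing.isZmodule.Build assoc
  assoc_addA assoc_addC assoc_add0 assoc_addN.

Fact assoc_scaleA a b x : assoc_scale a (assoc_scale b x) = assoc_scale (a * b) x.
Proof. by apply: coord_inj; rewrite !coordE scalerA. Qed.
Fact assoc_scale1 : left_id 1 assoc_scale.
Proof. by move=> x; apply: coord_inj; rewrite !coordE scale1r. Qed.
Fact assoc_scaleDr : right_distributive assoc_scale +%R.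
Proof. by move=> a x y; apply: coord_inj; rewrite !coordE scalerDr. Qed.
Fact assoc_scaleDl x : {morph assoc_scale^~ x : a b / a + b}.
Proof. by move=> a b; apply: coord_inj; rewrite !coordE scalerDl. Qed.

HB.instance Definition _ := GRing.Zmodule_isLmodule.Build R assoc
  assoc_scaleA assoc_scale1 assoc_scaleDr assoc_scaleDl.

Lemma assoc_coord_linear : linear assoc_coord.
Proof. by move=> a x y; rewrite !coordE. Qed.

Fact assoc_vect_axiom : vector_axiom (\dim {:S0}) assoc.
Proof.
exists (fun x => \row_i coord (vbasis {:S0}) i (assoc_coord x)).
  move=> a x y; apply/rowP => i; rewrite !mxE assoc_coord_linear.
  by rewrite linearP.
exists (fun v : 'rV[R]_(\dim {:S0}) => assoc_class pb_point (\sum_i v 0 i *: (vbasis {:S0})`_i)) => [x|v].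
  apply: coord_inj; rewrite coordE [RHS](coord_vbasis (memvf _)).
  by apply: eq_bigr => i _; rewrite mxE.
apply/rowP => i; rewrite mxE coordE coord_sum_free //.
exact: (basis_free (vbasisP _)).
Qed.

HB.instance Definition _ := Lmodule_hasFinDim.Build R assoc assoc_vect_axiom.

Lemma assoc_class_linear q : linear (assoc_class q).
Proof.
move=> a s s'; rewrite (pb_diffP pb_point q) !assoc_class_act linearP.
by apply: coord_inj; rewrite !coordE.
Qed.

End AssociatedBundle.

Section SFunctor.
Context {R : realType} {M : manifold R} (g : metric M) (eta : wf_clrep R).
Local Notation B := (PinorGroupoid g eta).
Local Notation L := (LipschitzGroupoid g eta).
Local Notation V := (cr_qs eta).
Local Notation S0 := (cr_mod eta).
Local Notation lipschitz :=
  (@reduction R M (lipschitz_group eta) (orthogonal_group V) (@Ad0 R eta)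
    (coframe_bundle g V)).

Definition S_fiber (Q : lipschitz) (m : M) : vectType R :=
  assoc (rd_principal (redP Q)) m.

Definition S_class (Q : lipschitz) (m : M) (q : Q m) (s : S0) : S_fiber Q m :=
  assoc_class (rd_principal (redP Q)) q s.

Definition S_bundle (Q : lipschitz) : vbundle_data M :=
  @VBundleData R M (S_fiber Q) S0
    (fun U t => exists2 q : forall m, Q m, pb_atlas (p := Q) U q &
       forall m, t m = linfun (S_class (q m))).

Definition S_gam_fun (Q : lipschitz) (m : M) (x : cliff (cotangent_qs g m))
    (c : S_fiber Q m) : S_fiber Q m :=
  let: (q, s) := repr c in
  S_class q (eta (cl_map (sval (rd_map q))^-1%VF x) s).

Definition S_data (Q : lipschitz) : pinor_data g :=
  @PinorData R M g (S_bundle Q) (fun m x => linfun (S_gam_fun x)).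

Definition S_map_fun (Q Q' : lipschitz) (f : reduction_hom Q Q') (m : M)
    (c : S_fiber Q m) : S_fiber Q' m :=
  let: (q, s) := repr c in S_class (sval f m q) s.

Definition S_map (Q Q' : lipschitz) (f : reduction_hom Q Q') (m : M) :
    'Hom(S_data Q m, S_data Q' m) := linfun (@S_map_fun Q Q' f m).

Lemma S_class_surj (Q : lipschitz) m (P : S_fiber Q m -> Prop) :
  (forall q s, P (S_class q s)) -> forall c, P c.
Proof.
by move=> H c; have := H (repr c).1 (repr c).2; rewrite /S_class assoc_reprP.
Qed.

Lemma S_class_linear (Q : lipschitz) m (q : Q m) : linear (S_class q).
Proof. by move=> a s s'; exact: (@assoc_class_linear R M _ Q (rd_principal (redP Q)) m q a s s'). Qed.

Lemma isometry_inv (W W' : quad_space R) (f : 'Hom(W, W')) :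
  is_isometry f -> bijective f -> is_isometry (f^-1)%VF.
Proof.
by move=> If /lfun_bijV[_ fV] u v; rewrite -If -!comp_lfunE fV !id_lfunE.
Qed.

Lemma cl_map_conj (W : quad_space R) (f f' : 'Hom(W, V)) (a : 'End(S0)) x :
  is_isometry f -> is_isometry f' ->
  (forall w, (cr_vec eta (f w) \o a = a \o cr_vec eta (f' w))%VF) ->
  (eta (cl_map f x) \o a = a \o eta (cl_map f' x))%VF.
Proof.
move=> If If' fa; have [el e1 eM] := cr_morph eta.
move: x; apply: cliff_ind => [|v|k x y Hx Hy|x y Hx Hy].
- by rewrite !cl_map1 // e1 comp_lfun1l comp_lfun1r.
- by rewrite !cl_map_vec //; exact: fa.
- by rewrite !cl_map_is_linear // !el comp_lfunDl comp_lfunDr -comp_lfunZl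
    -comp_lfunZr Hx Hy.
- by rewrite !cl_mapM // !eM -comp_lfunA Hy !comp_lfunA Hx.
Qed.

Lemma S_gam_fun_class (Q : lipschitz) m x (q : Q m) s :
  S_gam_fun x (S_class q s) =
  S_class q (eta (cl_map (sval (rd_map q))^-1%VF x) s).
Proof.
rewrite /S_gam_fun; case E: (repr _) => [q' s'].
have := assoc_reprP (S_class q s); rewrite E /= => /assoc_classP[a [-> ->]].
rewrite /S_class assoc_class_act; congr assoc_class.
rewrite [lg_rep a]/= -!comp_lfunE; congr (fun_of_lfun _ s').
have [It bt] := svalP (rd_map q).
have [It' bt'] := svalP (rd_map (pb_act q a)).
symmetry; apply: cl_map_conj; [exact: isometry_inv|exact: isometry_inv|].
move=> w; rewrite -Ad0_comp; congr (cr_vec eta _ \o _)%VF.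
have [tVt ttV] := lfun_bijV bt; have [tVt' ttV'] := lfun_bijV bt'.
have Et : (sval (rd_map (pb_act q a)) = sval (rd_map q) \o Ad0_lfun a)%VF.
  by rewrite (rd_equiv (redP Q)).
apply: (can_inj (lker0_lfunK (lfun_bijE bt).1)).
by rewrite -!comp_lfunE comp_lfunA -Et ttV ttV' .
Qed.

Lemma S_gam_fun_linear (Q : lipschitz) m x : linear (@S_gam_fun Q m x).
Proof.
move=> k; elim/S_class_surj=> q s; elim/S_class_surj=> q' s'.
have E : S_class q' s' =
    S_class q (lg_rep (pb_diff (rd_principal (redP Q)) q q') s').
  by rewrite /S_class -assoc_class_act -pb_diffP.
by rewrite E -S_class_linear !S_gam_fun_class linearP S_class_linear.
Qed.

Lemma S_gamE (Q : lipschitz) m x (q : Q m) s :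
  pd_gam (S_data Q) x (S_class q s) =
  S_class q (eta (cl_map (sval (rd_map q))^-1%VF x) s).
Proof. by rewrite /= linfunE ?S_gam_fun_class //; exact: S_gam_fun_linear. Qed.

Lemma S_map_fun_class (Q Q' : lipschitz) (f : reduction_hom Q Q') m (q : Q m) s :
  S_map_fun f (S_class q s) = S_class (sval f m q) s.
Proof.
rewrite /S_map_fun; case E: (repr _) => [q' s'].
have := assoc_reprP (S_class q s); rewrite E /= => /assoc_classP[a [-> ->]].
by rewrite (rm_equiv (svalP f)) /S_class assoc_class_act.
Qed.

Lemma S_map_fun_linear (Q Q' : lipschitz) (f : reduction_hom Q Q') m :
  linear (@S_map_fun Q Q' f m).
Proof.
move=> k; elim/S_class_surj=> q s; elim/S_class_surj=> q' s'.
have E : S_class q' s' =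
    S_class q (lg_rep (pb_diff (rd_principal (redP Q)) q q') s').
  by rewrite /S_class -assoc_class_act -pb_diffP.
by rewrite E -S_class_linear !S_map_fun_class S_class_linear.
Qed.

Lemma S_mapE (Q Q' : lipschitz) (f : reduction_hom Q Q') m (q : Q m) s :
  S_map f m (S_class q s) = S_class (sval f m q) s.
Proof. by rewrite linfunE ?S_map_fun_class //; exact: S_map_fun_linear. Qed.

Record S_well_defined : Prop := SWellDefined {
  Swd_ob : forall Q : lipschitz, is_pinor (S_data Q);
  Swd_type : forall Q : lipschitz, pinor_of_type eta (Pinor (Swd_ob Q));
  Swd_mor : forall (Q Q' : L) (f : hom Q Q'), pinor_morphism (S_map (sval f)) }.

Definition S_pinor_functor (w : S_well_defined) :
  functor L (full_subcategory (@pinor_of_type R M g eta)).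
Proof.
refine (@Functor L (full_subcategory (@pinor_of_type R M g eta))
  (fun Q => exist _ _ (Swd_type w Q))
  (fun Q Q' f => exist _ (S_map (sval f)) (Swd_mor w f)) _ _).
- move=> Q; apply: sval_inj; apply/functional_extensionality_dep => m.
  apply/lfunP; elim/S_class_surj=> q s.
  by rewrite [LHS]S_mapE /= id_lfunE.
- move=> Q Q' Q'' f' f; apply: sval_inj; apply/functional_extensionality_dep => m.
  apply/lfunP; elim/S_class_surj=> q s.
  by rewrite [LHS]S_mapE /= comp_lfunE !S_mapE.
Defined.

Definition S_functor (w : S_well_defined) : functor L B :=
  core_lift (S_pinor_functor w).

End SFunctor.

(* Main.v *)
Require Import Defs.
From HB Require Import structures.
From mathcomp Require Import all_boot all_order all_algebra.
From mathcomp Require Import generic_quotient.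
From mathcomp Require Import all_classical all_reals topology normedtype derive realfun.

(** Around a point of M, a smooth coframe isometric to (V,h) extending a given
    one is obtained by Gram-Schmidt.  In such a coframe and in a local
    trivialization of S, a pinor bundle is a smooth family of representations
    of Cl(V,h) on a fixed space.  Applying successively, to the vectors x of an
    orthogonal basis of V, the commuting projections
    T |-> (T + gamma(x) T eta(x)^-1) / 2
    turns an intertwiner at the base point into a smooth family of intertwiners,
    which stay invertible nearby: this yields smooth local sections of
    Hom(eta, gamma), hence the smooth bundle Q_eta(S, gamma).  The natural
    transformations are then [q,s] |-> q(s) and q |-> (tau(q), s |-> [q,s]);
    they are bijective on fibers, and the inverse of a smooth family of
    invertible linear maps is smooth by Cramer's rule. *)

Set Implicit Arguments.
Unset Strict Implicit.
Unset Printing Implicit Defensive.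
Import Order.TTheory GRing.Theory Num.Theory.
Import numFieldNormedType.Exports passmx.
Import Defs.
Local Open Scope classical_set_scope.
Local Open Scope ring_scope.

(** * Smooth functions and families of linear maps *)

(** The type condition is pointwise: it gives an isomorphism with [eta] in each fiber, with no
    control on how it varies. The analytic core is to spread a single isomorphism to a smooth local
    section; the rest transports smoothness between charts and trivializations. The projections
    exist in every signature because orthogonal bases of anisotropic vectors do: for such an [x] the
    inverse of [eta(x)] is a multiple of [eta(x)], and the signs produced by exchanging two
    orthogonal vectors on the left and on the right cancel. A finite composite thus replaces an
    average over a group that is not compact when [h] is indefinite. The map fed to it is constant
    in the trivialization, so only [gamma] varies; an intertwiner is left fixed, so the section has
    the prescribed value at the base point. Weak faithfulness makes an isomorphism determined by its
    action on the modules, so transition functions can be studied as matrices on [S_0] alone. Since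
    both sides are groupoids, inverses of the two natural transformations come for free once their
    components are known to be isomorphisms. *)

Section ClassOfComposites.
Context {R : realType} {V : normedModType R}.
Implicit Types (O : set V) (f : V -> R).

(** The derivative [- f^-2 * 'D_v f] involves only [f^-1], already of class [k] by induction, and
    ['D_v f]. *)
Lemma of_classV k O f : open O -> (forall x, O x -> f x != 0) ->
  of_class k O f -> of_class k O (fun x => (f x)^-1).
Proof.
move=> oO f0; elim: k => [|k IH] Hf.
  by move=> x Ox; apply: continuousV; [exact: f0|exact: Hf].
have If := IH (of_classW Hf); case: Hf => df Df; split=> [x Ox|v].
  by apply: differentiableV; [exact: df|exact: f0].
have H := of_classM oO (of_classM oO (of_class_cst k O (-1 : R)) (of_classM oO If If)) (Df v).
apply: of_class_ext H => // x; rewrite inE => Ox.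
rewrite deriveV; [|exact: f0|exact: diff_derivable (df _ Ox)].
by rewrite !fctE /= -exprVn expr2 mulN1r.
Qed.

Lemma of_class_sqrt k O f : open O -> (forall x, O x -> 0 < f x) ->
  of_class k O f -> of_class k O (fun x => Num.sqrt (f x)).
Proof.
move=> oO f0; elim: k => [|k IH] Hf.
  move=> x Ox; apply: (@continuous_comp _ _ _ f Num.sqrt); first exact: Hf.
  exact: sqrt_continuous.
have If := IH (of_classW Hf); case: Hf => df Df.
have dS x : O x -> is_derive (f x) 1 (@Num.sqrt R) (2 * Num.sqrt (f x))^-1.
  by move=> Ox; apply: is_derive1_sqrt; exact: f0.
have dfS x : O x -> differentiable (@Num.sqrt R) (f x).
  by move=> Ox; apply/derivable1_diffP; have [] := dS x Ox.
split=> [x Ox|v].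
  by apply: differentiable_comp; [exact: df|exact: dfS].
have s0 x : O x -> 2 * Num.sqrt (f x) != 0.
  by move=> Ox; rewrite mulf_neq0 ?gt_eqF ?sqrtr_gt0 ?f0.
have H2 := of_classM oO (of_class_cst k O (2 : R)) If.
have H := of_classM oO (of_classV oO s0 H2) (Df v).
apply: of_class_ext H => // x; rewrite inE => Ox.
have dfx := df _ Ox; have dSx := dfS _ Ox.
rewrite deriveE; last exact: differentiable_comp.
rewrite (diff_comp dfx dSx) /= diff1E // derive1E.
have [_ ->] := dS x Ox.
by rewrite /= deriveE // mulrC.
Qed.

End ClassOfComposites.

(** * Smooth scalar functions: inverses, roots, determinants *)

Section SmoothScalars.
Context {R : realType} {M : manifold R}.
Implicit Types (U : set M) (f : M -> R).

Lemma smooth_funV U f : open U -> (forall m, U m -> f m != 0) ->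
  smooth_fun U f -> smooth_fun U (fun m => (f m)^-1).
Proof.
move=> oU f0 sf c ac k.
apply: (of_classV _ _ (sf c ac k)); first exact: open_chart_preimage.
by move=> x [_ Ux]; exact: f0.
Qed.

Lemma smooth_fun_sqrt U f : open U -> (forall m, U m -> 0 < f m) ->
  smooth_fun U f -> smooth_fun U (fun m => Num.sqrt (f m)).
Proof.
move=> oU f0 sf c ac k.
apply: (of_class_sqrt _ _ (sf c ac k)); first exact: open_chart_preimage.
by move=> x [_ Ux]; exact: f0.
Qed.

Lemma smooth_fun_continuous U f m : open U -> U m -> smooth_fun U f ->
  {for m, continuous f}.
Proof.
move=> oU Um sf; have [c ac cm] := atlas_cover m.
have cf : {for cmap c m, continuous (f \o cinv c)}.
  by apply: (sf c ac 0); split; [exact: cmap_img|rewrite /= cmapK].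
have : {for m, continuous ((f \o cinv c) \o cmap c)}.
  by apply: continuous_comp; [exact: cmap_continuous|exact: cf].
rewrite /prop_for /continuous_at /= cmapK //; apply: cvg_trans.
apply: near_eq_cvg; have : nbhs m (cdom c).
  by apply: open_nbhs_nbhs; split=> //; exact: cdom_open.
by apply: filterS => x cx /=; rewrite cmapK.
Qed.

Lemma smooth_fun_near U f m (A : set R) : open U -> U m -> smooth_fun U f ->
  open A -> A (f m) -> exists U', [/\ open U', U' m, U' `<=` U & forall x, U' x -> A (f x)].
Proof.
(* [f] is controlled on [U] only, so the preimage of [A] need not be open; its interior is taken. *)
move=> oU Um sf oA Am; exists (U `&` (f @^-1` A)°); split.
- by apply: openI => //; exact: open_interior.
- split=> //; apply: (smooth_fun_continuous oU Um sf).
  by apply: open_nbhs_nbhs; split.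
- by move=> x [].
- by move=> x [_] /interior_subset.
Qed.

Lemma smooth_fun_scale U a f : open U -> smooth_fun U f ->
  smooth_fun U (fun m => a * f m).
Proof. by move=> oU; apply: smooth_funM => //; exact: smooth_fun_cst. Qed.

Lemma smooth_fun_prod U (I : Type) (r : seq I) (f : I -> M -> R) : open U ->
  (forall i, smooth_fun U (f i)) -> smooth_fun U (fun m => \prod_(i <- r) f i m).
Proof.
move=> oU sf; elim: r => [|i r IH].
  apply: smooth_fun_ext (smooth_fun_cst U 1) => // m _.
  by rewrite big_nil.
apply: smooth_fun_ext (smooth_funM oU (sf i) IH) => // m _.
by rewrite big_cons.
Qed.

Lemma smooth_fun_det U n (A : M -> 'M[R]_n) : open U ->
  (forall i j, smooth_fun U (fun m => A m i j)) ->
  smooth_fun U (fun m => \det (A m)).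
Proof.
move=> oU sA; apply: smooth_fun_sum => // s; apply: smooth_fun_scale => //.
by apply: smooth_fun_prod => // i.
Qed.

Lemma smooth_fun_invmx U n (A : M -> 'M[R]_n) i j : open U ->
  (forall m, U m -> A m \in unitmx) ->
  (forall i j, smooth_fun U (fun m => A m i j)) ->
  smooth_fun U (fun m => invmx (A m) i j).
Proof.
move=> oU uA sA.
have sdet := smooth_fun_det oU sA.
have sadj : smooth_fun U (fun m => (\adj (A m)) i j).
  apply: (@smooth_fun_ext _ _ U
    (fun m => (-1) ^+ (j + i) * \det (row' j (col' i (A m))))) => //.
    by move=> m _; rewrite mxE.
  apply: smooth_fun_scale => //; apply: smooth_fun_det => // a b.
  by apply: smooth_fun_ext (sA (lift j a) (lift i b)) => // m _; rewrite !mxE.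
have dV : smooth_fun U (fun m => (\det (A m))^-1).
  by apply: smooth_funV => // m Um; rewrite -unitfE -unitmxE uA.
apply: smooth_fun_ext (smooth_funM oU dV sadj) => // m; rewrite inE => Um.
by rewrite /invmx uA // mxE.
Qed.

End SmoothScalars.

(** * Smooth families of linear maps and their inverses *)

Section SmoothMaps.
Context {R : realType} {M : manifold R}.
Implicit Types (U : set M) (F : vectType R).

Lemma smooth_vec_ext F U (f f' : M -> F) : open U -> {in U, f =1 f'} ->
  smooth_vec U f -> smooth_vec U f'.
Proof.
move=> oU ff' sf l; apply: smooth_fun_ext (sf l) => // m Um.
by rewrite ff'.
Qed.

Lemma smooth_vec_sub F U U' (f : M -> F) : U' `<=` U ->
  smooth_vec U f -> smooth_vec U' f.
Proof. by move=> UU' sf l; exact: smooth_fun_sub (sf l). Qed.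

Lemma smooth_vec_cst F U (v : F) : smooth_vec U (fun=> v).
Proof. by move=> l; exact: smooth_fun_cst. Qed.

Lemma smooth_vecD F U (f f' : M -> F) : open U -> smooth_vec U f ->
  smooth_vec U f' -> smooth_vec U (fun m => f m + f' m).
Proof.
move=> oU sf sf' l; apply: smooth_fun_ext (smooth_funD oU (sf l) (sf' l)) => // m _.
by rewrite linearD.
Qed.

Lemma smooth_vecZ F U (a : M -> R) (f : M -> F) : open U -> smooth_fun U a ->
  smooth_vec U f -> smooth_vec U (fun m => a m *: f m).
Proof.
move=> oU sa sf l; apply: smooth_fun_ext (smooth_funM oU sa (sf l)) => // m _.
by rewrite linearZ.
Qed.

Lemma smooth_vec_sum F U (I : Type) (r : seq I) (f : I -> M -> F) : open U ->
  (forall i, smooth_vec U (f i)) -> smooth_vec U (fun m => \sum_(i <- r) f i m).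
Proof.
move=> oU sf l; apply: smooth_fun_ext (smooth_fun_sum r oU (fun i => sf i l)) => // m _.
by rewrite linear_sum.
Qed.

Lemma smooth_vec_coord F U n (X : n.-tuple F) i (f : M -> F) : open U ->
  smooth_vec U f -> smooth_fun U (fun m => coord X i (f m)).
Proof.
move=> oU sf; have := sf (linfun (coord X i : F -> R^o)).
by apply: smooth_fun_ext => // m _; rewrite lfunE.
Qed.

Lemma smooth_hom_ext F F' U (A A' : M -> 'Hom(F, F')) : open U ->
  (forall m, U m -> A m = A' m) -> smooth_hom U A -> smooth_hom U A'.
Proof.
move=> oU AA' sA v; apply: smooth_vec_ext (sA v) => // m; rewrite inE => Um.
by rewrite AA'.
Qed.

Lemma smooth_hom_sub F F' U U' (A : M -> 'Hom(F, F')) : U' `<=` U ->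
  smooth_hom U A -> smooth_hom U' A.
Proof. by move=> UU' sA v; exact: smooth_vec_sub (sA v). Qed.

Lemma smooth_hom_local F F' U (A : M -> 'Hom(F, F')) :
  (forall m, U m -> exists U', [/\ open U', U' m & smooth_hom U' A]) ->
  smooth_hom U A.
Proof.
move=> H v l; apply: smooth_fun_local => m /H[U' [oU' U'm sA]].
by exists U'; split=> //; exact: sA.
Qed.

Lemma smooth_hom_cst F F' U (A : 'Hom(F, F')) : smooth_hom U (fun=> A).
Proof. by move=> v; exact: smooth_vec_cst. Qed.

Lemma smooth_homD F F' U (A A' : M -> 'Hom(F, F')) : open U -> smooth_hom U A ->
  smooth_hom U A' -> smooth_hom U (fun m => A m + A' m).
Proof.
move=> oU sA sA' v; apply: smooth_vec_ext (smooth_vecD oU (sA v) (sA' v)) => // m _.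
by rewrite add_lfunE.
Qed.

Lemma smooth_homZ F F' U (a : M -> R) (A : M -> 'Hom(F, F')) : open U ->
  smooth_fun U a -> smooth_hom U A -> smooth_hom U (fun m => a m *: A m).
Proof.
move=> oU sa sA v; apply: smooth_vec_ext (smooth_vecZ oU sa (sA v)) => // m _.
by rewrite scale_lfunE.
Qed.

Lemma smooth_hom_sum F F' U (I : Type) (r : seq I) (A : I -> M -> 'Hom(F, F')) :
  open U -> (forall i, smooth_hom U (A i)) ->
  smooth_hom U (fun m => \sum_(i <- r) A i m).
Proof.
move=> oU sA v; apply: smooth_vec_ext (smooth_vec_sum r oU (fun i => sA i v)) => // m _.
by rewrite sum_lfunE.
Qed.

Lemma smooth_hom_app F F' U (A : M -> 'Hom(F, F')) (f : M -> F) : open U ->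
  smooth_hom U A -> smooth_vec U f -> smooth_vec U (fun m => A m (f m)).
Proof.
move=> oU sA sf; pose X := vbasis {:F}.
apply: (@smooth_vec_ext F' U (fun m => \sum_(i < \dim {:F}) coord X i (f m) *: A m X`_i)) => //.
  move=> m _; rewrite [in RHS](coord_vbasis (memvf (f m))) linear_sum.
  by apply: eq_bigr => i _; rewrite linearZ.
apply: smooth_vec_sum => // i; apply: smooth_vecZ => //.
exact: smooth_vec_coord.
Qed.

Let vb F := vbasisP {:F}.

(** Matrices act on row vectors, which reverses the order of composition. *)
Let mxofM F (A B : 'End(F)) : mxof (vbasis {:F}) (vbasis {:F}) (A \o B)%VF =
  mxof (vbasis {:F}) (vbasis {:F}) B *m mxof (vbasis {:F}) (vbasis {:F}) A.
Proof. exact: mxof_comp (vb F) _ _. Qed.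

Lemma bij_mxof_unit F (A : 'End(F)) :
  bijective A <-> mxof (vbasis {:F}) (vbasis {:F}) A \in unitmx.
Proof.
have fX := basis_free (vb F).
split=> [bA|uA].
  have [_ AV] := lfun_bijV bA.
  have := congr1 (mxof (vbasis {:F}) (vbasis {:F})) AV.
  by rewrite mxofM mxof1 // => /mulmx1_unit[].
have := hommxK (vb F) (vb F) (invmx (mxof (vbasis {:F}) (vbasis {:F}) A)).
set B := hommx _ _ _ => EB.
have BA : (B \o A = \1)%VF.
  by apply: (can_inj (mxofK (vb F) (vb F))); rewrite mxofM EB mulmxV // mxof1.
have AB : (A \o B = \1)%VF.
  by apply: (can_inj (mxofK (vb F) (vb F))); rewrite mxofM EB mulVmx // mxof1.
by exists B => v; rewrite -comp_lfunE ?AB ?BA id_lfunE.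
Qed.

Lemma smooth_mxof F U (A : M -> 'End(F)) i j : open U -> smooth_hom U A ->
  smooth_fun U (fun m => mxof (vbasis {:F}) (vbasis {:F}) (A m) i j).
Proof.
move=> oU sA; have := smooth_vec_coord (vbasis {:F}) j oU (sA (vbasis {:F})`_i).
by apply: smooth_fun_ext => // m _; rewrite mxE /= vecof_delta mxE.
Qed.

Lemma smooth_hom_mxof F U (A : M -> 'End(F)) : open U ->
  (forall i j, smooth_fun U (fun m => mxof (vbasis {:F}) (vbasis {:F}) (A m) i j)) ->
  smooth_hom U A.
Proof.
move=> oU sA v; pose X := vbasis {:F}.
apply: (@smooth_vec_ext F U (fun m =>
    \sum_j (\sum_i coord X i v * mxof X X (A m) i j) *: X`_j)) => //.
  move=> m _; rewrite -[A m v](rVofK (vb F)) (rVof_app _ (vb F)) /vecof.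
  by apply: eq_bigr => j _; rewrite mxE; congr (_ *: _);
    apply: eq_bigr => i _; rewrite coord_rVof.
apply: smooth_vec_sum => // j; apply: smooth_vecZ => //; last exact: smooth_vec_cst.
by apply: smooth_fun_sum => // i; apply: smooth_fun_scale => //; exact: sA.
Qed.

Lemma smooth_end_inv F U (A : M -> 'End(F)) : open U ->
  (forall m, U m -> bijective (A m)) -> smooth_hom U A ->
  smooth_hom U (fun m => (A m)^-1)%VF.
Proof.
move=> oU bA sA; apply: smooth_hom_mxof => // i j.
have uA m : U m -> mxof (vbasis {:F}) (vbasis {:F}) (A m) \in unitmx.
  by move=> Um; apply/bij_mxof_unit/bA.
have := smooth_fun_invmx i j oU uA (fun i j => smooth_mxof i j oU sA).
apply: smooth_fun_ext => // m; rewrite inE => Um.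
have [_ AV] := lfun_bijV (bA m Um).
have := congr1 (mxof (vbasis {:F}) (vbasis {:F})) AV.
rewrite mxofM mxof1 ?(basis_free (vb F)) // => E.
have /(congr1 (mulmx^~ (invmx (mxof (vbasis {:F}) (vbasis {:F}) (A m))))) := E.
by rewrite mulmxK ?uA // mul1mx => ->.
Qed.

Lemma lfun_inv_bij F F' (f : 'Hom(F, F')) : bijective f -> bijective (f^-1)%VF.
Proof.
move=> /lfun_bijV[Vf fV]; exists f => v; rewrite -comp_lfunE ?Vf ?fV id_lfunE //.
Qed.

Lemma lfun_invP F F' (f : 'Hom(F, F')) (f' : 'Hom(F', F)) :
  (f' \o f = \1)%VF -> (f \o f' = \1)%VF -> (f^-1 = f')%VF.
Proof.
move=> f'f ff'; have bf : bijective f.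
  by exists f' => v; rewrite -comp_lfunE ?f'f ?ff' id_lfunE.
have [Vf _] := lfun_bijV bf.
by rewrite -[LHS]comp_lfun1r -ff' comp_lfunA Vf comp_lfun1l.
Qed.

Lemma lfun_inv_comp F F' F'' (g : 'Hom(F', F'')) (f : 'Hom(F, F')) :
  bijective g -> bijective f -> ((g \o f)^-1 = f^-1 \o g^-1)%VF.
Proof.
move=> /lfun_bijV[Vg gV] /lfun_bijV[Vf fV]; apply: lfun_invP.
  by rewrite -comp_lfunA (comp_lfunA _ g) Vg comp_lfun1l.
by rewrite -comp_lfunA (comp_lfunA f) fV comp_lfun1l.
Qed.

Lemma lfun_invK F F' (f : 'Hom(F, F')) : bijective f -> ((f^-1)^-1 = f)%VF.
Proof. by move=> /lfun_bijV[Vf fV]; exact: lfun_invP. Qed.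

Lemma smooth_hom_inv F F' U (A : M -> 'Hom(F, F')) : open U ->
  (forall m, U m -> bijective (A m)) -> smooth_hom U A ->
  smooth_hom U (fun m => (A m)^-1)%VF.
Proof.
(* The neighbourhood is all of [U]: localizing only provides a point [m0], hence a fixed isomorphism
   from [F'] to [F] that reduces the claim to endomorphisms. *)
move=> oU bA sA; apply: smooth_hom_local => m0 Um0; exists U; split=> //.
pose B := ((A m0)^-1)%VF; have bB : bijective B by exact/lfun_inv_bij/bA.
have sBA : smooth_hom U (fun m => B \o A m)%VF.
  by apply: smooth_hom_comp => //; exact: smooth_hom_cst.
have bBA m : U m -> bijective (B \o A m)%VF.
  by move=> Um; apply: comp_lfun_bij => //; exact: bA.
have := smooth_hom_comp oU (smooth_end_inv oU bBA sBA) (smooth_hom_cst U B).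
apply: smooth_hom_ext => // m Um; rewrite (lfun_inv_comp bB (bA m Um)).
by rewrite -comp_lfunA (lfun_bijV bB).1 comp_lfun1r.
Qed.

(** Composed with the inverse of [A m0], the family consists of endomorphisms; its determinant is 1
    at [m0], hence nonzero nearby. *)
Lemma smooth_hom_bij_near F F' U (A : M -> 'Hom(F, F')) m0 : open U -> U m0 ->
  smooth_hom U A -> bijective (A m0) ->
  exists U', [/\ open U', U' m0, U' `<=` U & forall m, U' m -> bijective (A m)].
Proof.
move=> oU Um0 sA bA.
pose B := ((A m0)^-1)%VF; have bB : bijective B by exact/lfun_inv_bij.
have sBA : smooth_hom U (fun m => B \o A m)%VF.
  by apply: smooth_hom_comp => //; exact: smooth_hom_cst.
have sd := smooth_fun_det oU (fun i j => smooth_mxof i j oU sBA).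
have [|U' [oU' U'm sU' H]] := smooth_fun_near oU Um0 sd (@open_neq R 0).
  rewrite /= (lfun_bijV bA).1 mxof1 ?(basis_free (vb F)) // det1.
  exact: oner_neq0.
exists U'; split=> // m /H /=; rewrite -unitfE -[_ \is a _]unitmxE => /bij_mxof_unit bBA.
have -> : A m = (B^-1 \o (B \o A m))%VF by rewrite comp_lfunA (lfun_bijV bB).1 comp_lfun1l.
by apply: comp_lfun_bij => //; exact: lfun_inv_bij.
Qed.

End SmoothMaps.

(** * Orthogonal bases and averaged intertwiners *)

Section OrthogonalBases.
Context {R : realType} (V : quad_space R).
Implicit Types (u v w x y : V) (X : seq V).

Lemma qformZDl a u v w : qform (a *: u + v) w = a * qform u w + qform v w.
Proof. by rewrite qformC qform_linear !(qformC w). Qed.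

Lemma qformD u v w : qform u (v + w) = qform u v + qform u w.
Proof. by have := qform_linear u 1 v w; rewrite scale1r mul1r. Qed.

Lemma qformZ u a v : qform u (a *: v) = a * qform u v.
Proof. by have := qform_linear u a v 0; rewrite qform0 !addr0. Qed.

Lemma qformBl u v w : qform (u - v) w = qform u w - qform v w.
Proof. by rewrite addrC -scaleN1r qformZDl mulN1r addrC. Qed.

Lemma qform_sum u (I : Type) (r : seq I) (f : I -> V) :
  qform u (\sum_(i <- r) f i) = \sum_(i <- r) qform u (f i).
Proof.
elim: r => [|i r IH]; first by rewrite !big_nil qform0.
by rewrite !big_cons qformD IH.
Qed.

(** No normalization is imposed, so that every signature is covered; anisotropy is what allows
    division by [qform x x]. *)
Fixpoint orthogonal_seq X : Prop :=
  if X is x :: X' then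
    [/\ qform x x != 0, forall y, y \in X' -> qform x y = 0 & orthogonal_seq X']
  else True.

Lemma orthogonal_seq_anisotropic X x : orthogonal_seq X -> x \in X -> qform x x != 0.
Proof.
elim: X => // y X IH [yy _ oX]; rewrite inE => /orP[/eqP->//|].
exact: IH.
Qed.

Lemma orthogonal_seq_pairwise X x y : orthogonal_seq X ->
  x \in X -> y \in X -> x != y -> qform x y = 0.
Proof.
elim: X => // z X IH [_ zX oX]; rewrite !inE.
move=> /orP[/eqP->|xX] /orP[/eqP->|yX]; rewrite ?eqxx // => xy.
- exact: zX.
- by rewrite qformC zX.
- exact: IH.
Qed.

Lemma orthogonal_seq_uniq X : orthogonal_seq X -> uniq X.
Proof.
elim: X => // x X IH [xx xX oX] /=; rewrite IH // andbT.
by apply: contra xx => /xX ->.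
Qed.

Definition orth_proj X v : V := \sum_(x <- X) (qform v x / qform x x) *: x.

Lemma orth_projP X v y : orthogonal_seq X -> y \in X ->
  qform (v - orth_proj X v) y = 0.
Proof.
rewrite /orth_proj; elim: X => // x X IH [xx xX oX].
rewrite big_cons inE => /orP[/eqP->|yX]; rewrite qformBl qformZDl.
  rewrite (qformC (\sum_(_ <- _) _)) qform_sum big1_seq ?addr0.
    by rewrite divfK // subrr.
  by move=> z /= zX; rewrite qformZ xX ?mulr0.
by rewrite (xX y yX) mulr0 add0r -qformBl; exact: IH.
Qed.

(** Otherwise the form vanishes on squares of the orthogonal complement of [X], hence by
    polarization on the whole complement. Then [v - orth_proj X v] is orthogonal to the complement
    and to [X], thus to everything, against nondegeneracy. *)
Lemma anisotropic_vector (X : seq V) : orthogonal_seq X ->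
  (exists v, v != orth_proj X v) ->
  exists u, qform u u != 0 /\ forall y, y \in X -> qform u y = 0.
Proof.
move=> oX [v vX]; apply: contrapT => H.
pose perp u := forall y, y \in X -> qform u y = 0.
have iso u : perp u -> qform u u = 0.
  by move=> pu; apply/eqP; apply/negP => /negP uu; apply: H; exists u.
have iso2 u w : perp u -> perp w -> qform u w = 0.
  move=> pu pw; have puw : perp (u + w).
    by move=> y yX; rewrite qformC qformD !(qformC y) pu // pw // addr0.
  have := iso _ puw; rewrite qformD !(qformC (u + w)) !qformD !iso // add0r addr0.
  rewrite (qformC w u) => /eqP; rewrite -mulr2n mulrn_eq0 /= => /eqP //.
have pperp w : perp (w - orth_proj X w) by move=> y yX; apply: orth_projP.
move: vX; rewrite -subr_eq0 => /eqP; apply; apply: qform_nondeg => w.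
rewrite -[w](subrK (orth_proj X w)) qformD iso2 // add0r /orth_proj qform_sum.
by rewrite big1_seq // => x /= xX; rewrite qformZ pperp ?mulr0.
Qed.

Lemma orthogonal_seq_notin_span X u : (forall y, y \in X -> qform u y = 0) ->
  qform u u != 0 -> u \notin <<X>>%VS.
Proof.
move=> uX uu; apply: contra uu => /(@coord_span _ _ _ (in_tuple X)) {2}->.
rewrite qform_sum big1 // => i _; rewrite qformZ uX ?mulr0 //.
by apply: mem_nth.
Qed.

Lemma orthogonal_basis : exists X, orthogonal_seq X /\
  forall v, v = orth_proj X v.
Proof.
(* Induction on a lower bound for the dimension of the span; past [\dim {:V}] only the first
   alternative survives. *)
suff H k : exists X, orthogonal_seq X /\
    ((forall v, v = orth_proj X v) \/ (k <= \dim <<X>>)%N).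
  have [X [oX [//|]]] := H (\dim {:V}).+1; first by exists X.
  by rewrite ltnNge dimvS ?subvf.
elim: k => [|k [X [oX [HX|kX]]]]; first by exists [::]; split=> //; right.
  by exists X; split=> //; left.
have [all_proj|/existsNP[v vX]] := pselect (forall v, v = orth_proj X v).
  by exists X; split=> //; left.
have [||u [uu uX]] := @anisotropic_vector X; first exact: oX.
  by exists v; apply/eqP.
exists (u :: X); split=> //; right; apply: leq_ltn_trans kX _.
rewrite ltn_neqAle dimvS ?andbT; last by rewrite span_cons addvSr.
apply: contra (orthogonal_seq_notin_span uX uu).
rewrite (eq_sym (\dim _)); move=> /eqP E.
have : (<<X>> == <<u :: X>>)%VS by rewrite eqEdim span_cons addvSr -span_cons E leqnn.
by move=> /eqP->; rewrite memv_span // mem_head.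
Qed.

End OrthogonalBases.

(** * Averaging linear maps into intertwiners *)

Section Intertwiners.
Context {R : realType} {V : quad_space R} {S S' : vectType R}.

Definition clifford_map (F : vectType R) (N : V -> 'End(F)) : Prop :=
  linear N /\ forall v, (N v \o N v)%VF = qform v v *: \1%VF.

(** Polarization: removing the squares from the expansion of [N (u + v)] squared leaves the
    anticommutator. *)
Lemma clifford_map_anticomm (F : vectType R) (N : V -> 'End(F)) u v :
  clifford_map N -> qform u v = 0 -> (N u \o N v)%VF = - (N v \o N u)%VF.
Proof.
move=> [lN sN] uv; have ND : N (u + v) = N u + N v.
  by have := lN 1 u v; rewrite !scale1r.
have := sN (u + v); rewrite ND comp_lfunDl !comp_lfunDr !sN.
rewrite qformD !(qformC (u + v)) !qformD (qformC v u) uv addr0 add0r scalerDl.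
move=> /eqP; rewrite -addrA (inj_eq (addrI _)) addrA -[X in _ == X]add0r.
by rewrite (inj_eq (addIr _)) addr_eq0 => /eqP.
Qed.

Context (N : V -> 'End(S')) (E : V -> 'End(S)).

(** For a Clifford map [E] and anisotropic [x], [(qform x x)^-1 *: E x] is the inverse of [E x];
    this is half the sum of [T] and its conjugate by [x]. *)
Definition clifford_average1 x (T : 'Hom(S, S')) : 'Hom(S, S') :=
  2^-1 *: (T + (qform x x)^-1 *: (N x \o T \o E x)%VF).

Definition clifford_average (X : seq V) (T : 'Hom(S, S')) : 'Hom(S, S') :=
  foldr clifford_average1 T X.

(** Averaging over [x] gives commutation with [x], since composing with [N x] or [E x] merely swaps
    the two terms. It keeps commutation with an orthogonal [y]: moving [N y] past [N x] and [E y]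
    past [E x] costs two signs, which cancel. Hence the outer averages do not destroy what the inner
    ones achieved. *)
Lemma clifford_average_intertwines X T : clifford_map N -> clifford_map E ->
  orthogonal_seq X -> forall x, x \in X ->
  (N x \o clifford_average X T = clifford_average X T \o E x)%VF.
Proof.
move=> cN cE; have [_ sN] := cN; have [_ sE] := cE.
elim: X => // x X IH [xx xX oX] y; rewrite inE => /orP[/eqP->|yX] /=.
  set T' := clifford_average X T; rewrite /clifford_average1 -comp_lfunZr -comp_lfunZl.
  congr (_ *: _); rewrite comp_lfunDr comp_lfunDl -comp_lfunZr -comp_lfunZl.
  rewrite !comp_lfunA sN -[X in _ = _ + _ *: X]comp_lfunA sE.
  rewrite -comp_lfunZl comp_lfun1l -!comp_lfunA -comp_lfunZr comp_lfun1r.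
  by rewrite -comp_lfunZl -comp_lfunZr !scalerA mulVf // !scale1r addrC.
have := IH oX y yX; set T' := clifford_average X T => NyT.
rewrite /clifford_average1 -comp_lfunZr -comp_lfunZl.
congr (_ *: _); rewrite comp_lfunDr comp_lfunDl -comp_lfunZr -comp_lfunZl NyT.
congr (_ + _ *: _); have yx : qform y x = 0 by rewrite qformC xX.
rewrite !comp_lfunA (clifford_map_anticomm cN yx) -!comp_lfunA.
rewrite (clifford_map_anticomm cE (xX y yX)).
by rewrite comp_lfunNl !comp_lfunNr -!comp_lfunA (comp_lfunA (N y)) NyT -!comp_lfunA.
Qed.

(** For an intertwiner the conjugate term is [(qform x x)^-1 *: (N x \o N x \o T)], which is [T]
    again. *)
Lemma clifford_average_fixed X T : orthogonal_seq X ->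
  clifford_map N -> clifford_map E ->
  (forall x, (N x \o T = T \o E x)%VF) -> clifford_average X T = T.
Proof.
move=> oX [_ sN] _ NT; elim: X oX => //= x X IH [xx _ oX]; rewrite (IH oX).
rewrite /clifford_average1 -comp_lfunA -NT comp_lfunA sN -comp_lfunZl comp_lfun1l.
transitivity (2^-1 *: (T + T)); first by congr (_ *: (_ + _)); exact: scalerK.
rewrite -mulr2n -(scaler_nat _ T) scalerK ?pnatr_eq0 //.
Qed.

End Intertwiners.

(** * Smooth coframes *)

Section ClassOfCompositions.
Context {R : realType} {V : normedModType R} {n : nat}.
Implicit Types (O : set V).

Lemma diff_coord (i : 'I_n) (x v : 'rV[R]_n) :
  'd (fun y : 'rV[R]_n => y 0 i : R^o) x v = v 0 i.
Proof.
pose f := fun y : 'rV[R]_n => y 0 i : R^o.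
have lf : linear f by move=> a u w; rewrite /f !mxE.
pose fl := HB.pack f (GRing.isLinear.Build _ _ _ _ f lf) : {linear 'rV[R]_n -> R^o}.
have -> : (fun y : 'rV[R]_n => y 0 i : R^o) = fl by [].
by rewrite diff_lin //; exact: coord_continuous.
Qed.

Lemma of_class_coord k O (h : V -> 'rV[R]_n) i :
  open O -> of_class k O h -> of_class k O (fun x => h x 0 i).
Proof.
move=> oO; elim: k h => [|k IH] h Hh.
  move=> x Ox; apply: (@continuous_comp _ _ _ h (fun y : 'rV[R]_n => y 0 i)).
    exact: Hh.
  exact: coord_continuous.
case: Hh => dh Dh; have dc x : differentiable (fun y : 'rV[R]_n => y 0 i) x.
  exact: differentiable_coord.
split=> [x Ox|v].
  by apply: (@differentiable_comp _ _ _ _ h (fun y : 'rV[R]_n => y 0 i)); [exact: dh|].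
apply: of_class_ext (IH _ (Dh v)) => // x; rewrite inE => Ox.
rewrite deriveE; last by exact: dh.
rewrite deriveE; last first.
  by apply: (@differentiable_comp _ _ _ _ h (fun y : 'rV[R]_n => y 0 i)); [exact: dh|].
rewrite (@diff_comp _ _ _ _ h (fun y : 'rV[R]_n => y 0 i)) //=; last exact: dh.
by rewrite diff_coord.
Qed.

Lemma of_class_sum k O (I : Type) (r : seq I) (f : I -> V -> R) : open O ->
  (forall i, of_class k O (f i)) -> of_class k O (fun x => \sum_(i <- r) f i x).
Proof.
move=> oO Hf; elim: r => [|i r IH].
  apply: of_class_ext (of_class_cst k O (0 : R)) => // x _.
  by rewrite big_nil.
apply: of_class_ext (of_classD oO (Hf i) IH) => // x _.
by rewrite big_cons.
Qed.

(** By the chain rule the derivative is a sum of products of coordinates of ['D_v g] with partial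
    derivatives of [f] composed with [g]. The latter fall under the induction hypothesis because it
    is quantified over [f]. *)
Lemma of_class_comp k O (O' : set 'rV[R]_n) (g : V -> 'rV[R]_n) (f : 'rV[R]_n -> R) :
  open O -> (forall x, O x -> O' (g x)) ->
  of_class k O g -> of_class k O' f -> of_class k O (f \o g).
Proof.
move=> oO OO'; elim: k f => [|k IH] f Hg Hf.
  by move=> x Ox; apply: continuous_comp; [exact: Hg|apply: Hf; exact: OO'].
have g' := of_classW Hg; case: Hg => dg Dg; case: Hf => df Df; split=> [x Ox|v].
  by apply: differentiable_comp; [exact: dg|apply: df; exact: OO'].
have H : of_class k O (fun x => \sum_i ('D_v g x) 0 i * 'D_('e_i) f (g x)).
  apply: of_class_sum => // i; apply: (of_classM oO (of_class_coord i oO (Dg v))).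
  exact: (IH ('D_('e_i) f) g' (Df _)).
apply: of_class_ext H => // x; rewrite inE => Ox.
have dgx := dg _ Ox; have dfx := df _ (OO' _ Ox).
rewrite [RHS]deriveE; last exact: differentiable_comp.
rewrite (diff_comp dgx dfx) /= -(deriveE v dgx).
rewrite {2}['D_v g x]row_sum_delta linear_sum; apply: eq_bigr => i _.
by rewrite linearZ /= -deriveE.
Qed.

End ClassOfCompositions.

(** * Smoothness tested in a single chart *)

Section ChartSmoothness.
Context {R : realType} {M : manifold R}.
Local Notation n := (mfd_dim M).
Implicit Types (U : set M) (c : chart R M n).

Lemma smooth_fun_chart c U (f : M -> R) : atlas c -> open U -> U `<=` cdom c ->
  smooth_on (cimg c `&` cinv c @^-1` U) (f \o cinv c) -> smooth_fun U f.
Proof.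
move=> ac oU Uc sf c' ac' k.
have oO := open_chart_preimage (c := c') oU.
have H : of_class k (cimg c' `&` cinv c' @^-1` U) ((f \o cinv c) \o transition c' c).
  apply: (of_class_comp (O' := cimg c `&` cinv c @^-1` U)) => //.
  - move=> x [c'x /= Ux]; have cx := Uc _ Ux; split.
      exact: cmap_img.
    by rewrite /transition /= cmapK.
  - apply: of_class_sub (atlas_smooth ac' ac k) => x [c'x Ux]; split=> //.
    exact: Uc.
apply: of_class_ext H => // x; rewrite inE => -[c'x Ux].
by rewrite /transition /= cmapK //; exact: Uc.
Qed.

Lemma smooth_tvec_coord c c' w i : atlas c -> atlas c' ->
  smooth_fun (cdom c `&` cdom c') (fun m => (tvec c' m w : chart R M n -> 'rV[R]_n) c 0 i).
Proof.
move=> ac ac'; apply: (smooth_fun_chart ac').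
- by apply: openI; exact: cdom_open.
- by move=> x [].
have oU : open (cdom c `&` cdom c') by apply: openI; exact: cdom_open.
have oO := open_chart_preimage (c := c') oU.
move=> k.
(* The components are directional derivatives of the transition map, so class [k] for them requires
   class [k.+1] for that map. *)
have [dT DT] := atlas_smooth ac' ac k.+1.
have sDT : of_class k (cimg c' `&` cinv c' @^-1` (cdom c `&` cdom c')) ('D_w (transition c' c)).
  by apply: of_class_sub (DT w) => x [c'x [cx _]].
apply: of_class_ext (of_class_coord i oO sDT) => // x; rewrite inE => -[c'x [cx c'cx]].
have mc' : chart_at (cinv c' x) c' by [].
have mc : chart_at (cinv c' x) c by [].
rewrite /= (insubdK (0 : tangent M _) (chart_vecP w mc')) /chart_vec (asboolT mc).
by rewrite cinvK // deriveE //; apply: dT.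
Qed.

Lemma tvec_linear c m : chart_at m c -> linear (tvec c m).
Proof.
move=> mc a u v; rewrite [RHS](tangentE _ mc); congr tvec.
by rewrite -[X in X = _]/(a *: u + v) -{1}(tvec_val u mc) -{1}(tvec_val v mc).
Qed.

Lemma tvec_coordE c c' m w : chart_at m c ->
  tvec c' m w = \sum_i (tvec c' m w : chart R M n -> 'rV[R]_n) c 0 i *: tvec c m 'e_i.
Proof.
move=> mc; rewrite [LHS](tangentE _ mc) {1}[tan_val _ c]row_sum_delta.
have lt := tvec_linear mc.
pose T : {linear 'rV[R]_n -> tangent M m} :=
  HB.pack (tvec c m) (GRing.isLinear.Build _ _ _ _ _ lt).
rewrite -[tvec c m]/(T : _ -> _) linear_sum; apply: eq_bigr => i _.
by rewrite linearZ.
Qed.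

Lemma smooth_covector_chart c U (a : forall m, cotangent M m) : atlas c ->
  open U -> U `<=` cdom c -> (forall v, smooth_fun U (fun m => a m (tvec c m v))) ->
  smooth_covector U a.
Proof.
move=> ac oU Uc sa c' ac' w.
have oU' : open (U `&` cdom c') by apply: openI => //; exact: cdom_open.
apply: (@smooth_fun_ext _ _ _ (fun m =>
   \sum_i (tvec c' m w : chart R M n -> 'rV[R]_n) c 0 i * a m (tvec c m 'e_i))) => //.
  move=> m; rewrite inE => -[Um c'm].
  rewrite [in RHS](@tvec_coordE c c' m w) ?linear_sum; last by split=> //; exact: Uc.
  by apply: eq_bigr => i _; rewrite linearZ.
apply: smooth_fun_sum => // i; apply: smooth_funM => //.
  by apply: smooth_fun_sub (smooth_tvec_coord w i ac ac') => x [/Uc].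
by apply: smooth_fun_sub (sa 'e_i) => x [].
Qed.

Lemma smooth_covector_sub U U' (a : forall m, cotangent M m) : U' `<=` U ->
  smooth_covector U a -> smooth_covector U' a.
Proof.
move=> UU' sa c ac v; apply: smooth_fun_sub (sa c ac v).
by move=> x [/UU' Ux cx].
Qed.

End ChartSmoothness.

(** * Gram-Schmidt for a smooth family of symmetric bilinear forms *)

Section GramSchmidt.
Context {R : realType} {M : manifold R} (V : quad_space R).
Implicit Types (U : set M).

Lemma bilinear_sumr (b : V -> V -> R) (I : Type) (r : seq I) (f : I -> V) u :
  (forall a v w, b u (a *: v + w) = a * b u v + b u w) ->
  b u (\sum_(i <- r) f i) = \sum_(i <- r) b u (f i).
Proof.
move=> lb; have b0 : b u 0 = 0.
  by have := lb (-1) 0 0; rewrite scaler0 addr0 mulN1r addNr.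
elim: r => [|i r IH]; first by rewrite !big_nil b0.
by rewrite !big_cons -IH -[f i in LHS]scale1r lb mul1r.
Qed.

Lemma smooth_bilinear U (b : M -> V -> V -> R) (f f' : M -> V) : open U ->
  (forall m u v, U m -> b m u v = b m v u) ->
  (forall m u a v w, U m -> b m u (a *: v + w) = a * b m u v + b m u w) ->
  (forall u v, smooth_fun U (fun m => b m u v)) ->
  smooth_vec U f -> smooth_vec U f' -> smooth_fun U (fun m => b m (f m) (f' m)).
Proof.
move=> oU Cb lb sb sf sf'; pose X := vbasis {:V}.
have lin m u v : U m -> b m u v = \sum_(i < \dim {:V}) coord X i v * b m u X`_i.
  move=> Um; rewrite {1}(coord_vbasis (memvf v)) bilinear_sumr; last first.
    by move=> *; exact: lb.
  apply: eq_bigr => i _; rewrite -[_ *: _]addr0 lb //.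
  have := lb m u (-1) 0 0 Um; rewrite scaler0 addr0 mulN1r addNr => ->.
  by rewrite addr0.
apply: (@smooth_fun_ext _ _ U (fun m => \sum_(i < \dim {:V}) \sum_(j < \dim {:V})
    coord X i (f m) * (coord X j (f' m) * b m X`_i X`_j))) => //.
  move=> m; rewrite inE => Um; rewrite Cb // [RHS]lin //.
  apply: eq_bigr => i _; rewrite -mulr_sumr; congr (_ * _).
  by rewrite Cb // [RHS]lin.
apply: smooth_fun_sum => // i; apply: smooth_fun_sum => // j.
apply: smooth_funM => //; first exact: smooth_vec_coord.
by apply: smooth_funM => //; exact: smooth_vec_coord.
Qed.

(** The indefinite case needs no discussion of signs: at [m0] the vectors already have the wanted
    products, so each new vector has a square close to the nonzero number [qform x x] and can be
    rescaled nearby. Every step may shrink the neighbourhood. *)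
Lemma gram_schmidt_near (X : seq V) U m0 (b : M -> V -> V -> R) :
  open U -> U m0 ->
  (forall m u v, U m -> b m u v = b m v u) ->
  (forall m u a v w, U m -> b m u (a *: v + w) = a * b m u v + b m u w) ->
  (forall u v, smooth_fun U (fun m => b m u v)) ->
  (forall u v, b m0 u v = qform u v) -> orthogonal_seq X ->
  exists U' (P : M -> 'End(V)), [/\ open U', U' m0, U' `<=` U, smooth_hom U' P &
    P m0 = \1%VF /\ forall m x y, U' m -> x \in X -> y \in X ->
      b m (P m x) (P m y) = qform x y].
Proof.
move=> oU Um0 Cb lb sb b0; elim: X => [_|x X IH /= [xx xX oX]].
  by exists U, (fun=> \1%VF); split=> //; exact: smooth_hom_cst.
have [U1 [P [oU1 U1m0 U1U sP [P0 bP]]]] := IH oX.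
have sb1 u v : smooth_fun U1 (fun m => b m u v) by exact: smooth_fun_sub (sb u v).
have Cb1 m u v : U1 m -> b m u v = b m v u by move=> /U1U; exact: Cb.
have lb1 m u a v w : U1 m -> b m u (a *: v + w) = a * b m u v + b m u w.
  by move=> /U1U; exact: lb.
(* By induction [P m z] has square [qform z z], so on [U1] this is minus the projection of [x] to
   the span of the [P m z]. *)
pose corr m := \sum_(z <- X) (b m x (P m z) * - (qform z z)^-1) *: P m z.
pose y' m := x + corr m.
have sy' : smooth_vec U1 y'.
  apply: smooth_vecD => //; first exact: smooth_vec_cst.
  apply: smooth_vec_sum => // z; apply: smooth_vecZ => //.
  apply: smooth_funM => //; last exact: smooth_fun_cst.
  by apply: smooth_bilinear => //; exact: smooth_vec_cst.
have lin0 m u : U1 m -> b m u 0 = 0.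
  by move=> U1m; have := lb1 m u (-1) 0 0 U1m; rewrite scaler0 addr0 mulN1r addNr.
have bZ m u a v : U1 m -> b m u (a *: v) = a * b m u v.
  by move=> U1m; rewrite -[_ *: _]addr0 lb1 // lin0 // addr0.
have bD m u v w : U1 m -> b m u (v + w) = b m u v + b m u w.
  by move=> U1m; rewrite -[v in LHS]scale1r lb1 // mul1r.
have uX := orthogonal_seq_uniq oX.
have y'P m z : U1 m -> z \in X -> b m (y' m) (P m z) = 0.
  move=> U1m zX; rewrite Cb1 // bD // (bilinear_sumr _ _ (fun a v w => lb1 m _ a v w U1m)).
  rewrite (bigD1_seq z) //= big1_seq; last first.
    move=> w /andP[wz wX]; rewrite bZ // bP //.
    have zw : z != w by rewrite eq_sym.
    by rewrite (orthogonal_seq_pairwise oX zX wX zw) mulr0.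
  rewrite addr0 bZ // bP // -mulrA mulNr mulVf ?(orthogonal_seq_anisotropic oX) // mulrN1.
  by rewrite Cb1 // subrr.
have y'0 : y' m0 = x.
  rewrite /y' /corr big1_seq ?addr0 // => z /= zX.
  by rewrite P0 id_lfunE b0 xX // mul0r scale0r.
(* Ratio of the actual square to the wanted one: it is 1 at [m0], hence positive nearby whatever the
   sign of [qform x x]. *)
pose r m := b m (y' m) (y' m) * (qform x x)^-1.
have sr : smooth_fun U1 r.
  by apply: smooth_funM => //; [exact: smooth_bilinear|exact: smooth_fun_cst].
have r0 : r m0 = 1 by rewrite /r b0 y'0 mulfV.
have [|U2 [oU2 U2m0 U21 rpos]] := smooth_fun_near oU1 U1m0 sr (@open_gt R 0).
  by rewrite /= r0.
have sub2 := U21.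
have sr2 : smooth_fun U2 (fun m => Num.sqrt (r m)^-1).
  apply: smooth_fun_sqrt => //; first by move=> m /rpos /=; rewrite invr_gt0.
  apply: smooth_funV => //; first by move=> m /rpos /= /gt_eqF ->.
  exact: smooth_fun_sub sr.
pose y m := Num.sqrt (r m)^-1 *: y' m.
have sy : smooth_vec U2 y.
  by apply: smooth_vecZ => //; exact: smooth_vec_sub sy'.
(* Rank-one correction: the coefficient is 1 at [x] and 0 on [X], so [x] is sent to [y m] and the
   values on [X] are kept. *)
pose P' m := P m + linfun (fun v => (qform x v / qform x x) *: (y m - P m x)).
have P'E m v : P' m v = P m v + (qform x v / qform x x) *: (y m - P m x).
  rewrite add_lfunE linfunE // => a u w.
  by rewrite qform_linear mulrDl scalerDl -mulrA scalerA.
have P'x m : P' m x = y m by rewrite P'E mulfV // scale1r addrC subrK.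
have P'X m z : z \in X -> P' m z = P m z.
  by move=> zX; rewrite P'E xX // mul0r scale0r addr0.
exists U2, P'; split=> //; first by move=> m /U21/U1U.
  move=> v; apply: (@smooth_vec_ext _ _ _ U2
    (fun m => P m v + (qform x v / qform x x) *: (y m + (-1) *: P m x))) => //.
    by move=> m _; rewrite P'E scaleN1r.
  have sP2 := smooth_hom_sub U21 sP.
  apply: smooth_vecD => //; apply: smooth_vecZ => //; first exact: smooth_fun_cst.
  by apply: smooth_vecD => //; apply: smooth_vecZ => //; exact: smooth_fun_cst.
split.
  apply/lfunP => v; rewrite P'E /y r0 invr1 sqrtr1 scale1r y'0 P0 !id_lfunE.
  by rewrite subrr scaler0 addr0.
move=> m z w U2m; have U1m := U21 _ U2m; have rm := rpos _ U2m.
have yP v : v \in X -> b m (y m) (P m v) = 0.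
  by move=> vX; rewrite Cb1 // bZ // Cb1 // y'P // mulr0.
rewrite !inE => /orP[/eqP->|zX] /orP[/eqP->|wX].
- rewrite P'x bZ // Cb1 // bZ // mulrA -expr2 sqr_sqrtr ?invr_ge0 ?ltW //.
  rewrite /r invfM invrK mulrAC mulVf ?mul1r //.
  by apply: contraTneq rm => b00; rewrite /= /r b00 mul0r ltxx.
- by rewrite P'x P'X // yP // xX.
- by rewrite P'x P'X // Cb1 // yP // qformC xX.
- by rewrite !P'X // bP.
Qed.

Lemma orthonormalization_near U m0 (b : M -> V -> V -> R) :
  open U -> U m0 ->
  (forall m u v, U m -> b m u v = b m v u) ->
  (forall m u a v w, U m -> b m u (a *: v + w) = a * b m u v + b m u w) ->
  (forall u v, smooth_fun U (fun m => b m u v)) ->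
  (forall u v, b m0 u v = qform u v) ->
  exists U' (P : M -> 'End(V)), [/\ open U', U' m0, U' `<=` U, smooth_hom U' P &
    P m0 = \1%VF /\ forall m u v, U' m -> b m (P m u) (P m v) = qform u v].
Proof.
move=> oU Um0 Cb lb sb b0; have [X [oX XV]] := orthogonal_basis V.
have [U' [P [oU' U'm0 U'U sP [P0 bP]]]] := gram_schmidt_near oU Um0 Cb lb sb b0 oX.
exists U', P; split=> //; split=> // m u v U'm; have Um := U'U _ U'm.
have bZ z a w : b m z (a *: w) = a * b m z w.
  have := lb m z (-1) 0 0 Um; rewrite scaler0 addr0 mulN1r addNr => z0.
  by rewrite -[_ *: _]addr0 lb // z0 addr0.
have half z w : z \in X -> b m (P m z) (P m w) = qform z w.
  move=> zX; rewrite (XV w) /orth_proj linear_sum qform_sum.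
  rewrite (bilinear_sumr _ _ (fun a v w => lb m _ a v w Um)).
  by apply: eq_big_seq => t tX; rewrite linearZ bZ bP // qformZ.
rewrite Cb // qformC (XV u) /orth_proj linear_sum qform_sum.
rewrite (bilinear_sumr _ _ (fun a v w => lb m _ a v w Um)).
by apply: eq_big_seq => t tX; rewrite linearZ bZ Cb // half // qformZ (qformC v).
Qed.

End GramSchmidt.

Lemma lker0_dim_bij (R : realType) (F F' : vectType R) (f : 'Hom(F, F')) :
  lker f == 0%VS -> \dim {:F} = \dim {:F'} -> bijective f.
Proof.
move=> kf dF; have lf : limg f = fullv.
  apply/eqP; rewrite eqEdim subvf limg_dim_eq ?(eqP kf) ?capv0 //.
  by rewrite dF leqnn.
exists (f^-1)%VF; first exact: lker0_lfunK.
by move=> v; rewrite limg_lfunVK // lf memvf.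
Qed.

Lemma bij_lfun_dim (R : realType) (F F' : vectType R) (f : 'Hom(F, F')) :
  bijective f -> \dim {:F} = \dim {:F'}.
Proof.
move=> /lfun_bijE[kf lf]; rewrite -lf limg_dim_eq // (eqP kf).
exact: capv0.
Qed.

(** * Extending an isometric coframe from a point *)

Section Coframes.
Context {R : realType} {M : manifold R} (g : metric M) (V : quad_space R).

(** Smoothness is given for the metric and not for the cometric, so [f0] is moved to tangent vectors
    by [flat], extended with constant components in a chart, corrected there, and carried back. The
    forms to be corrected thus live on the fixed space [V]. *)
Lemma smooth_coframe_extension m0 (f0 : 'Hom(V, cotangent_qs g m0)) :
  is_isometry f0 -> bijective f0 ->
  exists U (e : forall m, 'Hom(V, cotangent_qs g m)), [/\ open U, U m0,
    forall m, U m -> is_isometry (e m) /\ bijective (e m),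
    forall v, smooth_covector U (fun m => e m v) & e m0 = f0].
Proof.
move=> If0 bf0; have [c ac cm0] := atlas_cover m0.
have mc0 : chart_at m0 c by [].
pose A v := (((flat g m0)^-1)%VF (f0 v) : chart R M (mfd_dim M) -> 'rV[R]_(mfd_dim M)) c.
have lA : linear A by move=> a u v; rewrite /A !linearP.
pose b m u v := met g (tvec c m (A u)) (tvec c m (A v)).
have lt m : cdom c m -> linear (tvec c m) by move=> cm; exact: tvec_linear.
have [|||U [P [oU Um0 Uc sP [P0 bP]]]] := @orthonormalization_near R M V (cdom c) m0 b
  (cdom_open c) cm0 (fun m u v _ => metC g _ _) _ _ _.
- by move=> m u a v w cm; rewrite /b lA lt // met_linear.
- by move=> u v; exact: met_smooth.
- by move=> u v; rewrite /b /A -!tangentE // -If0.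
pose B m v := tvec c m (A (P m v)).
have lB m : cdom c m -> linear (B m).
  by move=> cm a u v; rewrite /B linearP lA lt.
pose e m : 'Hom(V, cotangent_qs g m) := (flat g m \o linfun (B m))%VF.
have eE m v : U m -> e m v = flat g m (B m v).
  by move=> Um; rewrite comp_lfunE (linfunE (lB m (Uc m Um))).
exists U, e; split=> //.
- move=> m Um; have Ie : is_isometry (e m).
    by move=> u v; rewrite !eE // /qform /= /cometric !flatK -/(b m _ _) bP.
  split=> //; apply: lker0_dim_bij; first exact: isometry_inj.
  by rewrite (bij_lfun_dim bf0) !dimvf /dim /= !muln1.
- move=> v; apply: (smooth_covector_chart ac) => // w.
  pose X := vbasis {:V}.
  apply: (@smooth_fun_ext _ _ U (fun m => \sum_(i < \dim {:V})
      coord X i (P m v) * met g (tvec c m (A X`_i)) (tvec c m w))) => //.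
    move=> m; rewrite inE => Um; rewrite eE // flatE /B.
    have lb u : forall a z z', met g (tvec c m u) (tvec c m (A (a *: z + z'))) =
        a * met g (tvec c m u) (tvec c m (A z)) + met g (tvec c m u) (tvec c m (A z')).
      by move=> a z z'; rewrite lA lt ?met_linear //; exact: Uc.
    rewrite [in RHS](coord_vbasis (memvf (P m v))) [RHS]metC.
    (* Here only linearity in the summed argument matters; the first argument of [b] is ignored, and
       0 is a dummy value for it. *)
    rewrite (bilinear_sumr (b := fun _ z => met g (tvec c m w) (tvec c m (A z)))
      (u := 0) _ _ (lb w)).
    apply: eq_bigr => i _; rewrite metC; have := lb w (coord X i (P m v)) X`_i 0.
    have := lb w (-1) 0 0; rewrite scaler0 addr0 mulN1r addNr => ->.
    by rewrite !addr0 => ->.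
  apply: smooth_fun_sum => // i; apply: smooth_funM => //.
    by apply: smooth_vec_coord.
  by apply: (smooth_fun_sub Uc); exact: met_smooth.
- apply/lfunP => v; rewrite eE // /B P0 id_lfunE /A -tangentE //.
  exact: flatVK.
Qed.
End Coframes.

(** * Covectors in chart coordinates *)

Section LocalFrames.
Context {R : realType} {M : manifold R}.
Local Notation n := (mfd_dim M).
Implicit Types (U : set M) (c : chart R M n).

Definition covector_row c m (a : cotangent M m) : 'rV[R]_n :=
  \row_i a (tvec c m 'e_i).

Lemma covector_row_linear c m : linear (@covector_row c m).
Proof.
move=> a u v; apply/rowP => i; rewrite !mxE.
by rewrite add_lfunE scale_lfunE.
Qed.

(** It carries the moving space of covectors to a fixed one, where [smooth_hom] makes sense. *)
Definition covector_lfun c m : 'Hom(cotangent M m, 'rV[R]_n) :=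
  linfun (@covector_row c m).

Lemma covector_lfunE c m a : covector_lfun c m a = covector_row c a.
Proof. exact: (linfunE (@covector_row_linear c m)). Qed.

Lemma dcoordE c m i (x : tangent M m) : dcoord c m i x = (x : chart R M n -> 'rV[R]_n) c 0 i.
Proof.
rewrite /dcoord linfunE // => a u v.
rewrite -[X in X = _]/((a *: (u : chart R M n -> 'rV[R]_n) +
  (v : chart R M n -> 'rV[R]_n)) c 0 i).
by rewrite !fctE !mxE.
Qed.

Lemma covector_lfun_dcoord c m i : chart_at m c ->
  covector_lfun c m (dcoord c m i) = 'e_i.
Proof.
move=> mc; apply/rowP => j; rewrite covector_lfunE !mxE dcoordE tvec_val //.
by rewrite mxE eq_sym.
Qed.

Lemma dcoord_sum c m (a : cotangent M m) : chart_at m c ->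
  a = \sum_i a (tvec c m 'e_i) *: dcoord c m i.
Proof.
move=> mc; apply/lfunP => x; rewrite [in LHS](tangentE x mc) sum_lfunE.
rewrite {1}[tan_val _ c]row_sum_delta.
have lt := tvec_linear mc.
pose T : {linear 'rV[R]_n -> tangent M m} :=
  HB.pack (tvec c m) (GRing.isLinear.Build _ _ _ _ _ lt).
rewrite -[tvec c m]/(T : _ -> _) !linear_sum; apply: eq_bigr => i _.
by rewrite !linearZ scale_lfunE dcoordE -[RHS]/(_ * _) mulrC.
Qed.

Lemma covector_lfun_bij c m : chart_at m c -> bijective (covector_lfun c m).
Proof.
move=> mc; apply: lker0_dim_bij.
  apply/lker0P => a b; rewrite !covector_lfunE => /rowP ab.
  rewrite (dcoord_sum a mc) (dcoord_sum b mc); apply: eq_bigr => i _.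
  by have := ab i; rewrite !mxE => ->.
by rewrite !dimvf /dim /= muln1 mul1n.
Qed.

Lemma smooth_row U (F : M -> 'rV[R]_n) : open U ->
  (forall i, smooth_fun U (fun m => F m 0 i)) -> smooth_vec U F.
Proof.
move=> oU sF; apply: (@smooth_vec_ext _ _ _ U (fun m => \sum_i F m 0 i *: 'e_i)) => //.
  by move=> m _; rewrite -row_sum_delta.
by apply: smooth_vec_sum => // i; apply: smooth_vecZ => //; exact: smooth_vec_cst.
Qed.

Lemma smooth_covector_lfun (F : vectType R) c U (e : forall m, 'Hom(F, cotangent M m)) :
  atlas c -> open U -> (forall v, smooth_covector U (fun m => e m v)) ->
  smooth_hom (U `&` cdom c) (fun m => covector_lfun c m \o e m)%VF.
Proof.
move=> ac oU se v; have oU' : open (U `&` cdom c) by apply: openI => //; exact: cdom_open.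
apply: smooth_row => // i.
apply: smooth_fun_ext (se v c ac 'e_i) => // m _.
by rewrite comp_lfunE covector_lfunE mxE.
Qed.

Lemma smooth_covector_ext U (a b : forall m, cotangent M m) : open U ->
  (forall m, U m -> a m = b m) -> smooth_covector U a -> smooth_covector U b.
Proof.
move=> oU ab sa c ac v; apply: smooth_fun_ext (sa c ac v).
  by apply: openI => //; exact: cdom_open.
by move=> m; rewrite inE => -[Um _]; rewrite ab.
Qed.

(** In chart coordinates both frames become smooth families of maps into row vectors, and [k] is the
    inverse of the second composed with the first. *)
Lemma smooth_frame_transition (F F' : vectType R) U U'
    (e : forall m, 'Hom(F, cotangent M m)) (e' : forall m, 'Hom(F', cotangent M m))
    (k : M -> 'Hom(F, F')) : open U -> open U' ->
  (forall v, smooth_covector U (fun m => e m v)) ->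
  (forall v, smooth_covector U' (fun m => e' m v)) ->
  (forall m, U' m -> bijective (e' m)) ->
  (forall m, (U `&` U') m -> e m = (e' m \o k m)%VF) ->
  smooth_hom (U `&` U') k.
Proof.
move=> oU oU' se se' be' ek; apply: smooth_hom_local => m0 [Um0 U'm0].
have [c ac cm0] := atlas_cover m0; pose O := (U `&` cdom c) `&` (U' `&` cdom c).
have oO : open O by do !apply: openI => //; exact: cdom_open.
exists O; split=> //.
have s1 : smooth_hom O (fun m => covector_lfun c m \o e m)%VF.
  by apply: smooth_hom_sub (smooth_covector_lfun ac oU se) => m [].
have s2 : smooth_hom O (fun m => covector_lfun c m \o e' m)%VF.
  by apply: smooth_hom_sub (smooth_covector_lfun ac oU' se') => m [].
have b2 m : O m -> bijective (covector_lfun c m \o e' m)%VF.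
  move=> [[Um cm] [U'm _]]; apply: comp_lfun_bij; first exact: covector_lfun_bij.
  exact: be'.
have := smooth_hom_comp oO (smooth_hom_inv oO b2 s2) s1.
apply: smooth_hom_ext => // m Om; have [[Um cm] [U'm _]] := Om.
by rewrite ek // (comp_lfunA (covector_lfun c m)) comp_lfunA
  (lfun_bijV (b2 m Om)).1 comp_lfun1l.
Qed.

End LocalFrames.

(** * Isomorphisms of Clifford representations *)

Section CliffordIsos.
Context {R : realType}.
Implicit Types x y : clrep R.

Lemma clrep_iso_intro x y (f0 : 'Hom(cr_qs x, cr_qs y)) (f : 'Hom(cr_mod x, cr_mod y)) :
  is_isometry f0 -> bijective f0 -> bijective f ->
  (forall v, (cr_vec y (f0 v) \o f = f \o cr_vec x v)%VF) ->
  exists q : @hom (ClRepIso R) x y, iso_vec q = f0 /\ iso_mod q = f.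
Proof.
move=> If0 bf0 bf cf.
have fP : @clrep_morphism R x y (f0, f) by [].
have qP : is_iso (exist _ _ fP : @hom (ClRepCat R) x y) by apply: clrep_is_iso.
by exists (exist _ _ qP).
Qed.

Lemma iso_isometry x y (q : @hom (ClRepIso R) x y) : is_isometry (iso_vec q).
Proof. by case: q => -[f []]. Qed.

Lemma iso_comm x y (q : @hom (ClRepIso R) x y) v :
  (cr_vec y (iso_vec q v) \o iso_mod q = iso_mod q \o cr_vec x v)%VF.
Proof. by case: q => -[f []]. Qed.

Lemma lfun_comp_injr (F F' F'' : vectType R) (f : 'Hom(F, F')) (g h : 'Hom(F', F'')) :
  bijective f -> (g \o f = h \o f)%VF -> g = h.
Proof.
move=> /lfun_bijV[_ fV] /(congr1 (fun k => k \o f^-1)%VF).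
by rewrite -!comp_lfunA fV !comp_lfun1r.
Qed.

Lemma lfun_comp_injl (F F' F'' : vectType R) (f : 'Hom(F', F'')) (g h : 'Hom(F, F')) :
  bijective f -> (f \o g = f \o h)%VF -> g = h.
Proof.
move=> /lfun_bijV[Vf _] /(congr1 (fun k => f^-1 \o k)%VF).
by rewrite !comp_lfunA Vf !comp_lfun1l.
Qed.

(** The module map [f] determines the operator of [f0 v] as the conjugate of that of [v] by [f];
    weak faithfulness of [y] then recovers [f0 v]. *)
Lemma iso_mod_inj x y (q q' : @hom (ClRepIso R) x y) : weakly_faithful y ->
  iso_mod q = iso_mod q' -> q = q'.
Proof.
move=> wy E; have E0 : iso_vec q = iso_vec q'.
  apply/lfunP => v; apply: wy; apply: (lfun_comp_injr (iso_mod_bij q)).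
  by rewrite iso_comm E iso_comm.
case: q q' E E0 => -[[f0 f] fP] qP [[[f0' f'] fP'] qP'].
rewrite /iso_mod /iso_vec /= => E E0.
by apply: sval_inj; apply: sval_inj; rewrite /= E E0.
Qed.

(** Conjugation by the module map of [p] sends the operator of [v] to that of [iso_vec p v], so it
    preserves the image of [V]. This is what makes the action of the Lipschitz group on isomorphisms
    transitive. *)
Lemma lip_aut_surj (eta : wf_clrep R) (p : @hom (ClRepIso R) eta eta) :
  exists a : lip eta, p = lip_aut a.
Proof.
have bp := iso_mod_bij p; have kp := (lfun_bijE bp).1.
have aP : lip_pred (iso_mod p : 'End(cr_mod eta)).
  rewrite /lip_pred kp /=; apply/subvP => _ /memv_imgP[_ /memv_imgP[v _ ->] ->].
  rewrite conj_lfunE cr_linE -iso_comm -comp_lfunA (lfun_bijV bp).2 comp_lfun1r.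
  by rewrite -cr_linE memv_img ?memvf.
exists (Lip aP); apply: iso_mod_inj => //; exact: wf_faithful.
Qed.

End CliffordIsos.

(** * The functor Q *)

Section PinorSmoothness.
Context {R : realType} {M : manifold R} (g : metric M).
Local Notation n := (mfd_dim M).
Implicit Types (U : set M) (S : pinor g).

Lemma pd_gam_vec_linear S m : linear (fun v : cotangent_qs g m => pd_gam S (cl_vec v)).
Proof. exact: (@cr_vec_linear R (pinor_fiber S m)). Qed.

Lemma cl_frame1 c m i : cl_frame g c m [set i]%SET = cl_vec (dcoord c m i : cotangent_qs g m).
Proof. by rewrite /cl_frame enum_set1 big_seq1. Qed.

(** A pinor bundle is smooth by definition on products of coordinate covectors; the one-factor
    products suffice, since [a] has smooth coefficients in that frame. *)
Lemma pd_gam_smooth S U (a : forall m, cotangent_qs g m) : open U ->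
  smooth_covector U a -> vb_smooth_end (E := S) U (fun m => pd_gam S (cl_vec (a m))).
Proof.
move=> oU sa U' t Ut; have oU' := vb_open (pd_vbundle (pnP S)) Ut.
apply: smooth_hom_local => m0 [Um0 U'm0].
have [c ac cm0] := atlas_cover m0; pose O := (U `&` U') `&` cdom c.
have oO : open O by do !apply: openI => //; exact: cdom_open.
exists O; split=> //.
apply: (@smooth_hom_ext _ _ _ _ O (fun m => \sum_i (a m : cotangent M m) (tvec c m 'e_i) *:
   ((t m)^-1 \o pd_gam S (cl_frame g c m [set i]%SET) \o t m)%VF)) => //.
  move=> m [_ cm]; rewrite {2}(dcoord_sum (a m) (conj ac cm)).
  pose L := fun v : cotangent_qs g m => ((t m)^-1 \o pd_gam S (cl_vec v) \o t m)%VF.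
  have lL : linear L.
    move=> k u v; rewrite /L pd_gam_vec_linear comp_lfunDr comp_lfunDl.
    by rewrite -comp_lfunZr -comp_lfunZl.
  pose Ll : {linear cotangent_qs g m -> 'End(vb_model S)} :=
    HB.pack L (GRing.isLinear.Build _ _ _ _ _ lL).
  rewrite -[RHS]/(Ll _) linear_sum; apply: eq_bigr => i _.
  by rewrite linearZ cl_frame1.
apply: smooth_hom_sum => // i; apply: smooth_homZ => //.
  by apply: smooth_fun_sub (sa c ac 'e_i) => m [[Um _] cm].
by apply: smooth_hom_sub (pd_smooth (pnP S) ac [set i]%SET Ut) => m [[_ U'm] cm].
Qed.

End PinorSmoothness.

Section SmoothAverage.
Context {R : realType} {M : manifold R} {V : quad_space R} {S S' : vectType R}.

Lemma smooth_clifford_average U (N : M -> V -> 'End(S')) (E : V -> 'End(S)) X T :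
  open U -> (forall v, smooth_hom U (fun m => N m v)) ->
  smooth_hom U (fun m => clifford_average (N m) E X T).
Proof.
move=> oU sN; elim: X => [|x X IH] /=; first exact: smooth_hom_cst.
apply: (@smooth_homZ _ _ _ _ _ (fun=> 2^-1)) => //; first exact: smooth_fun_cst.
apply: smooth_homD => //.
apply: (@smooth_homZ _ _ _ _ _ (fun=> (qform x x)^-1)) => //; first exact: smooth_fun_cst.
apply: smooth_hom_comp => //; last exact: smooth_hom_cst.
exact: smooth_hom_comp.
Qed.

Lemma intertwines_span (N : V -> 'End(S')) (E : V -> 'End(S)) X (T : 'Hom(S, S')) :
  linear N -> linear E -> (forall v, v = orth_proj X v) ->
  (forall x, x \in X -> (N x \o T = T \o E x)%VF) ->
  forall v, (N v \o T = T \o E v)%VF.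
Proof.
move=> lN lE XV NT v.
pose L u := (N u \o T)%VF; pose L' u := (T \o E u)%VF.
have lL : linear L by move=> k u w; rewrite /L lN comp_lfunDl -comp_lfunZl.
have lL' : linear L' by move=> k u w; rewrite /L' lE comp_lfunDr -comp_lfunZr.
pose Ll : {linear V -> 'Hom(S, S')} := HB.pack L (GRing.isLinear.Build _ _ _ _ _ lL).
pose Ll' : {linear V -> 'Hom(S, S')} := HB.pack L' (GRing.isLinear.Build _ _ _ _ _ lL').
rewrite -[LHS]/(Ll v) -[RHS]/(Ll' v) (XV v) /orth_proj !linear_sum.
apply: eq_big_seq => x xX; rewrite !linearZ; congr (_ *: _); exact: NT.
Qed.

End SmoothAverage.

(** * Smooth local sections and the principal bundle of isomorphisms *)

Section QBundle.
Context {R : realType} {M : manifold R} (g : metric M) (eta : wf_clrep R).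
Local Notation V := (cr_qs eta).
Local Notation S0 := (cr_mod eta).
Implicit Types S : pinor g.

Lemma Q_local_section S m0 : (forall m, inhabited (Q_fiber eta S m)) ->
  exists U s, pb_atlas (p := Q_bundle eta S) U s /\ U m0.
Proof.
move=> inh; have [q0] := inh m0; have hS := pd_vbundle (pnP S).
(* The coframe must start at the vector part of [q0]: then [T0] below intertwines [E] with [N m0],
   and averaging fixes it. *)
have [U1 [e [oU1 U1m0 be se e0]]] :=
  @smooth_coframe_extension R M g V m0 (iso_vec q0)
    (@iso_isometry R eta (pinor_fiber S m0) q0) (iso_vec_bij q0).
have [U2 [t [Ut U2m0]]] := vb_cover hS m0; have oU2 := vb_open hS Ut.
have [X [oX XV]] := orthogonal_basis V.
(* Coframe and trivialization turn the moving representations into Clifford maps of the fixed [V] on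
   the fixed model space. *)
pose N m v := ((t m)^-1 \o pd_gam S (cl_vec (e m v)) \o t m)%VF.
pose E := cr_vec eta.
pose T0 := ((t m0)^-1 \o iso_mod q0)%VF.
pose F m := clifford_average (N m) E X T0.
pose O := U1 `&` U2; have oO : open O by exact: openI.
have sN v : smooth_hom O (fun m => N m v) by exact: (pd_gam_smooth oU1 (se v) Ut).
have sF : smooth_hom O F by exact: smooth_clifford_average.
have lN m : linear (N m).
  move=> k u v; rewrite /N linearP pd_gam_vec_linear comp_lfunDr comp_lfunDl.
  by rewrite -comp_lfunZr -comp_lfunZl.
have cN m : O m -> clifford_map (N m).
  move=> [U1m U2m]; split=> // v; have [_ tV] := lfun_bijV (vb_bij hS Ut U2m).
  have [Ie _] := be m U1m.
  rewrite /N -!comp_lfunA (comp_lfunA (t m)) tV comp_lfun1l.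
  have sq : (pd_gam S (cl_vec (e m v)) \o pd_gam S (cl_vec (e m v)))%VF = qform v v *: \1%VF.
    by rewrite -Ie; exact: (@cr_vec_sqr R (pinor_fiber S m)).
  rewrite (comp_lfunA _ _ (t m)) sq -comp_lfunZl comp_lfun1l -comp_lfunZr.
  by rewrite (lfun_bijV (vb_bij hS Ut U2m)).1.
have cE : clifford_map E by split; [exact: cr_vec_linear|exact: cr_vec_sqr].
have FE m v : O m -> (N m v \o F m = F m \o E v)%VF.
  move=> Om; apply: (intertwines_span (lN m) cE.1 XV).
  exact: (clifford_average_intertwines T0 (cN m Om) cE oX).
have Om0 : O m0 by [].
have F0 : F m0 = T0.
  apply: (clifford_average_fixed oX (cN _ Om0) cE) => v.
  rewrite /N /T0 -!comp_lfunA (comp_lfunA (t m0)) (lfun_bijV (vb_bij hS Ut U2m0)).2.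
  by rewrite comp_lfun1l e0; congr (_ \o _)%VF; exact: (@iso_comm R eta (pinor_fiber S m0) q0).
have bF0 : bijective (F m0).
  rewrite F0; apply: comp_lfun_bij; last exact: (iso_mod_bij q0).
  exact/lfun_inv_bij/(vb_bij hS Ut).
have [U [oU Um0 UO bF]] := smooth_hom_bij_near oO Om0 sF bF0.
(* A section needs values everywhere; outside [U] any isomorphism of the fiber will do. *)
have hs m : exists q : Q_fiber eta S m, U m -> iso_vec q = e m /\ iso_mod q = (t m \o F m)%VF.
  have [Um|] := pselect (U m); last by have [q] := inh m; exists q.
  have [U1m U2m] := UO _ Um; have [Ie bem] := be m U1m.
  have [||q [q1 q2]] := @clrep_iso_intro R eta (pinor_fiber S m) (e m) (t m \o F m)%VF Ie bem.
  - by apply: comp_lfun_bij; [exact: (vb_bij hS Ut)|exact: bF].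
  - move=> v; rewrite -comp_lfunA -FE // /N !comp_lfunA.
    by rewrite (lfun_bijV (vb_bij hS Ut U2m)).2 comp_lfun1l.
  by exists q.
pose s m := sval (boolp.cid (hs m)).
have sP m : U m -> iso_vec (s m) = e m /\ iso_mod (s m) = (t m \o F m)%VF.
  by rewrite /s; case: boolp.cid.
exists U, s; split=> //; split=> //.
  move=> v; apply: (smooth_covector_ext oU (a := fun m => e m v)).
    by move=> m Um; have [-> _] := sP m Um.
  by apply: smooth_covector_sub (se v) => m /UO[].
move=> U' t' Ut'; have oU' := vb_open hS Ut'; have oUU' : open (U `&` U') by exact: openI.
have st : smooth_hom (U `&` U') (fun m => (t' m)^-1 \o \1 \o t m)%VF.
  by apply: smooth_hom_sub (vb_transition hS Ut Ut') => m [/UO[]].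
have sF' : smooth_hom (U `&` U') F by apply: smooth_hom_sub sF => m [/UO].
have := smooth_hom_comp oUU' st sF'; apply: smooth_hom_ext => // m [Um _].
by have [_ ->] := sP m Um; rewrite comp_lfun1r comp_lfunA.
Qed.

(** The map [phi] is kept general to serve twice: the identity gives the transition functions of the
    bundle, a morphism of pinor bundles gives smoothness of its image. In trivializations [k] is a
    composite of smooth families with one inverse. *)
Lemma Q_transition_smooth S S' (phi : forall m, 'Hom(S m, S' m)) U s U' s'
    (k : M -> lipschitz_group eta) :
  pb_atlas (p := Q_bundle eta S) U s -> pb_atlas (p := Q_bundle eta S') U' s' ->
  vb_smooth (E := S) (E' := S') phi ->
  (forall m, (U `&` U') m ->
     (phi m \o iso_mod (s m) = iso_mod (s' m) \o lg_rep (k m))%VF) ->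
  smooth_hom (U `&` U') (fun m => lg_rep (k m)).
Proof.
move=> [oU _ sU] [oU' _ sU'] sphi phik; apply: smooth_hom_local => m0 [Um0 U'm0].
have hS := pd_vbundle (pnP S); have hS' := pd_vbundle (pnP S').
have [W [t [Wt Wm0]]] := vb_cover hS m0; have oW := vb_open hS Wt.
have [W' [t' [Wt' W'm0]]] := vb_cover hS' m0; have oW' := vb_open hS' Wt'.
pose O := (U `&` U') `&` (W `&` W'); have oO : open O by do !apply: openI.
exists O; split=> //.
have s1 : smooth_hom O (fun m => (t m)^-1 \o iso_mod (s m))%VF.
  by apply: smooth_hom_sub (sU _ _ Wt) => m [[? ?] [? ?]].
have s2 : smooth_hom O (fun m => (t' m)^-1 \o phi m \o t m)%VF.
  by apply: smooth_hom_sub (sphi _ _ _ _ Wt Wt') => m [[? ?] [? ?]].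
have s3 : smooth_hom O (fun m => (t' m)^-1 \o iso_mod (s' m))%VF.
  by apply: smooth_hom_sub (sU' _ _ Wt') => m [[? ?] [? ?]].
have b3 m : O m -> bijective ((t' m)^-1 \o iso_mod (s' m))%VF.
  move=> [_ [_ W'm]]; apply: comp_lfun_bij; last exact: (iso_mod_bij (s' m)).
  exact/lfun_inv_bij/(vb_bij hS' Wt').
have := smooth_hom_comp oO (smooth_hom_inv oO b3 s3) (smooth_hom_comp oO s2 s1).
apply: smooth_hom_ext => // m Om; have [UU'm [Wm W'm]] := Om.
apply: (lfun_comp_injl (b3 m Om)); rewrite comp_lfunA (lfun_bijV (b3 m Om)).2 comp_lfun1l.
rewrite -!comp_lfunA (comp_lfunA (t m)) (lfun_bijV (vb_bij hS Wt Wm)).2 comp_lfun1l.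
by rewrite phik.
Qed.

Lemma iso_mod_act S m (q : Q_fiber eta S m) (a : lipschitz_group eta) :
  iso_mod (pb_act (p := Q_bundle eta S) q a) = (iso_mod q \o lg_rep a)%VF.
Proof. by []. Qed.

Lemma Q_bundle_principal S : (forall m, weakly_faithful (pinor_fiber S m)) ->
  (forall m, inhabited (Q_fiber eta S m)) -> is_principal (Q_bundle eta S).
Proof.
move=> wS inh; split=> //.
- move=> m q; apply: iso_mod_inj; first exact: wS.
  by rewrite iso_mod_act lg_rep1 comp_lfun1r.
- move=> m q a b; apply: iso_mod_inj; first exact: wS.
  by rewrite !iso_mod_act lg_repM comp_lfunA.
(* The group element relating [q] to [q'] is the automorphism of [eta] obtained by following [q']
   with the inverse [r] of [q]. *)
- move=> m q q'; have [r [rq qr]] := core_is_iso q.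
  have [a aP] := lip_aut_surj (compm r q'); exists a; split.
    by rewrite -[pb_act _ _]/(compm q (lip_aut a)) -aP compmA qr comp1m.
  move=> b qb; apply: (@lg_rep_inj _ (lipschitz_group eta)).
  apply: (lfun_comp_injl (iso_mod_bij q)).
  rewrite -[RHS](iso_mod_act q b) -qb -[LHS]/(iso_mod (compm q (lip_aut a))) -aP.
  by rewrite compmA qr comp1m.
- by move=> U s [].
- by move=> m; exact: Q_local_section.
- move=> U s U' s' Us Us' k sk.
  apply: (Q_transition_smooth Us Us' (vb_transition (pd_vbundle (pnP S)))) => m UU'm.
  by rewrite comp_lfun1l sk.
Qed.

Lemma Q_data_reduction S : (forall m, weakly_faithful (pinor_fiber S m)) ->
  (forall m, inhabited (Q_fiber eta S m)) -> is_reduction (@Ad0 R eta) (Q_data eta S).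
Proof.
move=> wS inh; split; first exact: Q_bundle_principal.
- move=> U s U' s' [oU sU _] [oU' sU'] k sk.
  apply: (smooth_frame_transition oU oU' sU sU').
    by move=> m _; have [] := svalP (s' m).
  by move=> m UU'm; have /(congr1 sval) := sk m UU'm.
- move=> m q a; apply: sval_inj; by [].
Qed.

Lemma Q_map_morphism (x y : PinorGroupoid g eta) (f : hom x y) :
  reduction_morphism (Q_map f).
Proof.
split.
- move=> U s U' s' Us Us' k sk.
  have := Q_transition_smooth Us Us' (pm_smooth (svalP (sval f))); apply=> m UU'm.
  by rewrite -[RHS]iso_mod_act -sk.
- by move=> m q a; exact: compmA.
- by move=> m q; apply: sval_inj; exact: comp_lfun1l.
Qed.

Lemma Q_is_well_defined : Q_well_defined g eta.
Proof.
split; last exact: Q_map_morphism.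
by move=> x; have [wx tx] := svalP x; exact: Q_data_reduction.
Qed.

End QBundle.

(** * The functor S *)

Section CoframeBundle.
Context {R : realType} {M : manifold R} (g : metric M) (V : quad_space R).
Context (h_isometric : forall m : M, exists f : 'Hom(V, cotangent_qs g m),
  is_isometry f /\ bijective f).

Lemma coframe_local_section m0 :
  exists U s, pb_atlas (p := coframe_bundle g V) U s /\ U m0.
Proof.
have [f0 [If0 bf0]] := h_isometric m0.
have [U [e [oU Um0 be se e0]]] := smooth_coframe_extension If0 bf0.
have hs m : exists f : coframe g V m, U m -> sval f = e m.
  have [Um|nUm] := pselect (U m); first by exists (exist _ (e m) (be m Um)).
  by have [f fP] := h_isometric m; exists (exist _ f fP).
exists U, (fun m => sval (boolp.cid (hs m))); split=> //; split=> // v.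
apply: (smooth_covector_ext oU _ (se v)) => m Um.
by case: boolp.cid => f /= ->.
Qed.

Lemma coframe_diff m (f f' : coframe g V m) :
  exists k : orthogonal_group V, f' = pb_act (p := coframe_bundle g V) f k.
Proof.
case: f f' => [f [If bf]] [f' [If' bf']].
have [Vf fV] := lfun_bijV bf.
have kP : ortho_pred (f^-1 \o f')%VF.
  apply/andP; split.
    by apply: (lfun_bijE _).1; apply: comp_lfun_bij => //; exact: lfun_inv_bij.
  by apply/asboolP/isometry_comp => //; exact: isometry_inv.
by exists (Ortho kP); apply: sval_inj; rewrite /= comp_lfunA fV comp_lfun1l.
Qed.

End CoframeBundle.

(** * The associated pinor bundle *)

Section SBundle.
Context {R : realType} {M : manifold R} (g : metric M) (eta : wf_clrep R).
Local Notation V := (cr_qs eta).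
Local Notation S0 := (cr_mod eta).
Local Notation lipschitz :=
  (@reduction R M (lipschitz_group eta) (orthogonal_group V) (@Ad0 R eta)
    (coframe_bundle g V)).
Implicit Types Q : lipschitz.

Lemma lipschitz_isometric Q m : exists f : 'Hom(V, cotangent_qs g m),
  is_isometry f /\ bijective f.
Proof.
have [q] := pb_inhabited (rd_principal (redP Q)) m.
by exists (sval (rd_map q)); exact: (svalP (rd_map q)).
Qed.

(** Smoothness of a reduction map is phrased through group-valued functions relative to smooth
    coframes. A smooth coframe [s] near the point turns it into smoothness of covectors, because the
    image of [q] is [s] moved by a smooth [k]. *)
Lemma rd_map_smooth Q U (q : forall m, Q m) v : pb_atlas (p := Q) U q ->
  smooth_covector U (fun m => sval (rd_map (q m)) v).
Proof.
move=> Uq c ac w; apply: smooth_fun_local => m0 [Um0 cm0].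
have oU := pb_open (rd_principal (redP Q)) Uq.
have [U' [s [U's U'm0]]] := coframe_local_section (lipschitz_isometric Q) m0.
have [oU' sU'] := U's.
pose k m := sval (boolp.cid (coframe_diff (s m) (rd_map (q m)))).
have kP m : rd_map (q m) = pb_act (p := coframe_bundle g V) (s m) (k m).
  by rewrite /k; case: boolp.cid.
have sk : smooth_hom (U `&` U') (fun m => lg_rep (k m)).
  exact: (rd_smooth (redP Q) Uq U's (k := k) (fun m _ => kP m)).
pose O := (U `&` U') `&` cdom c; have oO : open O by do !apply: openI => //; exact: cdom_open.
exists O; split=> //; pose X := vbasis {:V}.
apply: (@smooth_fun_ext _ _ O (fun m => \sum_(i < \dim {:V})
    coord X i (lg_rep (k m) v) * sval (s m) X`_i (tvec c m w))) => //.
  move=> m _; rewrite kP /= comp_lfunE [in RHS](coord_vbasis (memvf (ortho_val (k m) v))).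
  rewrite linear_sum sum_lfunE; apply: eq_bigr => i _.
  by rewrite linearZ scale_lfunE.
apply: smooth_fun_sum => // i; apply: smooth_funM => //.
  apply: smooth_vec_coord => //.
  by apply: smooth_vec_sub (sk v) => m [].
by apply: smooth_fun_sub (sU' X`_i c ac w) => m [[]].
Qed.

Lemma S_class_act Q m (q : Q m) (a : lipschitz_group eta) s :
  S_class (pb_act q a) s = S_class q (lg_rep a s).
Proof. exact: assoc_class_act. Qed.

Lemma S_classE Q m (q : Q m) s : linfun (S_class q) s = S_class q s.
Proof. by apply: linfunE; exact: S_class_linear. Qed.

Lemma S_class_bij Q m (q : Q m) : bijective (linfun (S_class q)).
Proof.
apply: lker0_dim_bij.
  by apply/lker0P => s s'; rewrite !S_classE => /assoc_class_inj.
by rewrite [in RHS]dimvf.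
Qed.

Lemma S_class_actE Q m (q : Q m) (a : lipschitz_group eta) :
  linfun (S_class (pb_act q a)) = (linfun (S_class q) \o lg_rep a)%VF.
Proof. by apply/lfunP => s; rewrite comp_lfunE !S_classE S_class_act. Qed.

Lemma S_class_inv Q m (q : Q m) : ((linfun (S_class q))^-1 \o linfun (S_class q) = \1)%VF.
Proof. exact: (lfun_bijV (S_class_bij q)).1. Qed.

(** The transition maps are those of the principal bundle, read as matrices on [S0]. *)
Lemma S_bundle_vbundle Q : is_vbundle (S_bundle Q).
Proof.
have PQ := rd_principal (redP Q); split.
- by move=> U t [q Uq _]; exact: (pb_open PQ Uq).
- by move=> U t [q Uq tq] m _; rewrite tq; exact: S_class_bij.
- move=> m; have [U [q [Uq Um]]] := pb_cover PQ m.
  by exists U, (fun m => linfun (S_class (q m))); split=> //; exists q.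
- move=> U t U' t' [q Uq tq] [q' U'q' tq'].
  have sk := pb_transition PQ Uq U'q' (fun m _ => pb_diffP PQ (q' m) (q m)).
  apply: smooth_hom_ext sk.
    by apply: openI; [exact: (pb_open PQ Uq)|exact: (pb_open PQ U'q')].
  move=> m _; rewrite tq tq' [in RHS](pb_diffP PQ (q' m) (q m)) S_class_actE.
  by rewrite comp_lfun1r comp_lfunA S_class_inv comp_lfun1l.
Qed.

Lemma S_gam_class Q m (q : Q m) x :
  (pd_gam (S_data Q) x \o linfun (S_class q) =
   linfun (S_class q) \o eta (cl_map (sval (rd_map q))^-1%VF x))%VF.
Proof. by apply/lfunP => s; rewrite !comp_lfunE !S_classE S_gamE. Qed.

Lemma rd_map_inv_isometry Q m (q : Q m) : is_isometry ((sval (rd_map q))^-1)%VF.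
Proof. by have [It bt] := svalP (rd_map q); exact: isometry_inv. Qed.

Lemma S_gam_morphism Q m : clifford_morphism (@pd_gam _ _ _ (S_data Q) m).
Proof.
have [q] := pb_inhabited (rd_principal (redP Q)) m.
have Iq := rd_map_inv_isometry q; have [el e1 eM] := cr_morph eta.
split=> [a x y||x y]; apply: (lfun_comp_injr (S_class_bij q)).
- rewrite comp_lfunDl -comp_lfunZl !S_gam_class cl_map_is_linear // el.
  by rewrite comp_lfunDr -comp_lfunZr.
- by rewrite S_gam_class cl_map1 // e1 comp_lfun1r comp_lfun1l.
- by rewrite -comp_lfunA !S_gam_class cl_mapM // eM !comp_lfunA S_gam_class.
Qed.

(** In the trivialization by [q], Clifford multiplication by a covector is [eta] of its preimage
    under the coframe of [q]. For [dcoord c m i] this preimage is the inverse of a smooth family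
    applied to the constant vector ['e_i]; products of such factors stay smooth. *)
Lemma S_gam_smooth Q c : atlas c -> forall I : {set 'I_(mfd_dim M)},
  vb_smooth_end (E := S_bundle Q) (cdom c) (fun m => pd_gam (S_data Q) (cl_frame g c m I)).
Proof.
move=> ac I U t [q Uq tq]; have PQ := rd_principal (redP Q).
have oU := pb_open PQ Uq; pose O := cdom c `&` U.
have oO : open O by apply: openI => //; exact: cdom_open.
pose T m := (sval (rd_map (q m)))^-1%VF.
have sT : smooth_hom O (fun m => covector_lfun c m \o sval (rd_map (q m)))%VF.
  rewrite /O setIC; apply: smooth_covector_lfun => // v; exact: rd_map_smooth.
have bT m : O m -> bijective (covector_lfun c m \o sval (rd_map (q m)))%VF.
  move=> [cm _]; apply: comp_lfun_bij; first exact: covector_lfun_bij.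
  by have [] := svalP (rd_map (q m)).
have sd i : smooth_vec O (fun m => T m (dcoord c m i)).
  apply: (smooth_vec_ext oO _ (smooth_hom_inv oO bT sT 'e_i)) => m; rewrite inE => Om.
  have [cm _] := Om; have bq := (svalP (rd_map (q m))).2.
  have bc := covector_lfun_bij (conj ac cm).
  have ei : ((covector_lfun c m)^-1)%VF 'e_i = dcoord c m i.
    by rewrite -(covector_lfun_dcoord i (conj ac cm)) -comp_lfunE (lfun_bijV bc).1 id_lfunE.
  by rewrite (lfun_inv_comp bc bq) comp_lfunE ei.
have [el e1 eM] := cr_morph eta.
have sprod r : smooth_hom O (fun m =>
    eta (cl_map (T m) (\prod_(i <- r) cl_vec (dcoord c m i : cotangent_qs g m)))).
  elim: r => [|i r IH].
    apply: (smooth_hom_ext oO _ (smooth_hom_cst O \1%VF)) => m Om.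
    by rewrite big_nil cl_map1 ?e1 //; exact: rd_map_inv_isometry.
  have sv : smooth_hom O (fun m => cr_lin eta (T m (dcoord c m i))).
    move=> s; have E : linear (fun v : V => cr_lin eta v s).
      by move=> a u v; rewrite linearP add_lfunE scale_lfunE.
    apply: (smooth_vec_ext oO _ (smooth_hom_app oO
      (smooth_hom_cst O (linfun (fun v : V => cr_lin eta v s))) (sd i))).
    by move=> m _; rewrite linfunE.
  apply: (smooth_hom_ext oO _ (smooth_hom_comp oO sv IH)) => m Om.
  have Iq := rd_map_inv_isometry (q m).
  by rewrite big_cons cl_mapM // eM cl_map_vec // cr_linE.
apply: (smooth_hom_ext oO _ (sprod (enum I))) => m Om.
by rewrite tq -comp_lfunA S_gam_class comp_lfunA S_class_inv comp_lfun1l.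
Qed.

Lemma S_data_pinor Q : is_pinor (S_data Q).
Proof.
split.
- exact: S_bundle_vbundle.
(* [S0] is nonzero because [eta] is injective on the nonzero space [V]. *)
- move=> m; have [q] := pb_inhabited (rd_principal (redP Q)) m.
  rewrite -(bij_lfun_dim (S_class_bij q)) lt0n; apply/negP; rewrite dimv_eq0 => /eqP d0.
  have := id_end_neq0 eta; rewrite -[_ == _]negbK => /negP; apply; apply/negPn/eqP/lfunP => s.
  by apply/eqP; rewrite id_lfunE zero_lfunE -memv0 -d0 memvf.
- exact: S_gam_morphism.
- exact: S_gam_smooth.
Qed.

(** Besides proving that the fibers have type [eta], this isomorphism is the value at [q] of the
    unit constructed below. *)
Lemma S_fiber_iso Q (PS : is_pinor (S_data Q)) m (q : Q m) :
  exists p : Q_fiber eta (Pinor PS) m,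
    iso_vec p = sval (rd_map q) /\ iso_mod p = linfun (S_class q).
Proof.
have [It bt] := svalP (rd_map q).
apply: clrep_iso_intro => //; first exact: S_class_bij.
move=> v; rewrite /cr_vec /= S_gam_class cl_map_vec; last exact: rd_map_inv_isometry.
by rewrite -comp_lfunE (lfun_bijV bt).1 id_lfunE.
Qed.

Lemma S_data_type Q : pinor_of_type eta (Pinor (S_data_pinor Q)).
Proof.
split=> m; have [q] := pb_inhabited (rd_principal (redP Q)) m;
  have [p _] := S_fiber_iso (S_data_pinor Q) q; last by exists.
(* Weak faithfulness is pulled back from [eta] along the inverse isomorphism [r]. *)
have [r [rp pr]] := core_is_iso p.
move=> u v uv; have b := iso_vec_bij r.
have H w : (cr_vec eta (iso_vec r w) \o iso_mod r =
    iso_mod r \o cr_vec (pinor_fiber (Pinor (S_data_pinor Q)) m) w)%VF.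
  exact: (@iso_comm R (pinor_fiber (Pinor (S_data_pinor Q)) m) eta r).
apply: (bij_inj b); apply: (@wf_faithful _ eta).
by apply: (lfun_comp_injr (iso_mod_bij r)); rewrite !H uv.
Qed.

Lemma S_map_class Q Q' (f : reduction_hom Q Q') m (q : Q m) :
  (S_map f m \o linfun (S_class q) = linfun (S_class (sval f m q)))%VF.
Proof. by apply/lfunP => s; rewrite comp_lfunE !S_classE S_mapE. Qed.

Lemma S_map_morphism Q Q' (f : reduction_hom Q Q') : pinor_morphism (S_map f).
Proof.
have PQ := rd_principal (redP Q); have PQ' := rd_principal (redP Q'); split.
- move=> U t U' t' [q Uq tq] [q' U'q' tq'].
  have sk := rm_smooth (svalP f) Uq U'q' (fun m _ => pb_diffP PQ' (q' m) (sval f m (q m))).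
  apply: smooth_hom_ext sk.
    by apply: openI; [exact: (pb_open PQ Uq)|exact: (pb_open PQ' U'q')].
  move=> m _; rewrite tq tq' -comp_lfunA S_map_class.
  rewrite [in RHS](pb_diffP PQ' (q' m) (sval f m (q m))) S_class_actE.
  by rewrite comp_lfunA S_class_inv comp_lfun1l.
- move=> m x; have [q] := pb_inhabited PQ m.
  apply: (lfun_comp_injr (S_class_bij q)).
  rewrite -!comp_lfunA S_gam_class S_map_class S_gam_class comp_lfunA S_map_class.
  by rewrite (rm_map (svalP f)).
Qed.

Lemma S_is_well_defined : S_well_defined g eta.
Proof. exact: (SWellDefined S_data_type (fun Q Q' f => S_map_morphism (sval f))). Qed.

End SBundle.

(** * The natural transformations *)

(** In a core every component has an inverse, and pointwise inverses are natural by cancelling in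
    the naturality square. Only the transformations themselves remain to be built. *)
Lemma nat_trans_core_invertible (C D : category) (F G : functor C (core D))
  (a : nat_trans F G) : nat_invertible a.
Proof.
pose b x := sval (boolp.cid (core_is_iso (a x))).
have bP x : compm (b x) (a x) = idm (F x) /\ compm (a x) (b x) = idm (G x).
  by rewrite /b; case: boolp.cid.
unshelve eexists (@NatTrans _ _ G F b _).
  move=> x y f; have [ba _] := bP y; have [_ ab] := bP x.
  rewrite -[LHS]compm1 -ab compmA -[compm (compm (b y) _) (a x)]compmA.
  by rewrite -(ntP a) compmA ba comp1m.
exact: bP.
Qed.

(** * Smoothness of fiberwise inverses *)

Section BijectiveMorphisms.
Context {R : realType} {M : manifold R} (g : metric M).

Lemma pinor_bijective_is_iso (S S' : pinor g) (f : @hom (PinorCat g) S S') :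
  (forall m, bijective (sval f m)) -> is_iso f.
Proof.
case: f => f fP /= bf; have hS := pd_vbundle (pnP S); have hS' := pd_vbundle (pnP S').
have f'P : pinor_morphism (S := S') (S' := S) (fun m => (f m)^-1)%VF.
  split=> [U' t' U t U't' Ut|m x].
    have oU := vb_open hS Ut; have oU' := vb_open hS' U't'.
    have oUU' : open (U' `&` U) by exact: openI.
    have bft m : (U' `&` U) m -> bijective ((t' m)^-1 \o f m \o t m)%VF.
      move=> [U'm Um]; apply: comp_lfun_bij; last exact: (vb_bij hS Ut).
      apply: comp_lfun_bij; last exact: bf.
      exact/lfun_inv_bij/(vb_bij hS' U't').
    have sft : smooth_hom (U' `&` U) (fun m => (t' m)^-1 \o f m \o t m)%VF.
      by rewrite setIC; exact: (pm_smooth fP Ut U't').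
    apply: (smooth_hom_ext oUU' _ (smooth_hom_inv oUU' bft sft)) => m [U'm Um].
    have bt := vb_bij hS Ut Um; have bt' := vb_bij hS' U't' U'm.
    have bVt' := lfun_inv_bij bt'.
    rewrite (lfun_inv_comp (comp_lfun_bij bVt' (bf m)) bt) (lfun_inv_comp bVt' (bf m)).
    by rewrite (lfun_invK bt') comp_lfunA.
  have [Vf fV] := lfun_bijV (bf m).
  apply: (lfun_comp_injl (bf m)); rewrite !comp_lfunA fV comp_lfun1l.
  by rewrite (pm_comm fP) -comp_lfunA fV comp_lfun1r.
exists (exist _ _ f'P); split; apply: sval_inj;
  apply/functional_extensionality_dep => m /=.
- exact: (lfun_bijV (bf m)).1.
- exact: (lfun_bijV (bf m)).2.
Qed.

(** An equivariant map between torsors is automatically bijective, and the transition matrices of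
    its inverse are inverses of its own. *)
Lemma reduction_is_iso (H G : lin_group R) (phi : H -> G) (P : pbundle_data M G)
  (Q Q' : reduction phi P) (f : @hom (ReductionCat phi P) Q Q') : is_iso f.
Proof.
case: f => f [fs fe ft]; have PQ := rd_principal (redP Q).
have PQ' := rd_principal (redP Q').
have fK m : exists h, cancel (f m) h /\ cancel h (f m).
  have [q] := pb_inhabited PQ m.
  exists (fun q' => pb_act q (pb_diff PQ' (f m q) q')); split=> [r|q'].
    apply/esym; rewrite [LHS](pb_diffP PQ q r); congr pb_act.
    apply: (@pb_act_inj _ _ _ _ PQ' m (f m q)).
    by rewrite -pb_diffP -fe -pb_diffP.
  by rewrite fe -pb_diffP.
pose f' m := sval (boolp.cid (fK m)).
have f'K m : cancel (f m) (f' m) by rewrite /f'; case: boolp.cid => ? [].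
have fK' m : cancel (f' m) (f m) by rewrite /f'; case: boolp.cid => ? [].
have f'P : reduction_morphism (Q := Q') (Q' := Q) f'.
  split=> [U' s' U s U's' Us k sk|m q a|m q].
  - have oU := pb_open PQ Us; have oU' := pb_open PQ' U's'.
    have oUU' : open (U' `&` U) by exact: openI.
    pose kV m := (k m)^-1%g.
    have kVP m : (U `&` U') m -> f m (s m) = pb_act (s' m) (kV m).
      move=> [Um U'm]; rewrite -{1}[s' m](fK' m) sk //.
      by rewrite -fe -(pb_actM PQ) mulgV (pb_act1 PQ).
    have := fs _ _ _ _ Us U's' kV kVP; rewrite setIC => skV.
    have repV m : (lg_rep (kV m) \o lg_rep (k m) = \1)%VF /\
                  (lg_rep (k m) \o lg_rep (kV m) = \1)%VF.
      by rewrite -!lg_repM mulVg mulgV lg_rep1.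
    have bV m : (U' `&` U) m -> bijective (lg_rep (kV m)).
      by move=> _; exact: lg_rep_bij.
    apply: (smooth_hom_ext oUU' _ (smooth_hom_inv oUU' bV skV)) => m _.
    by have [Vk kVk] := repV m; exact: lfun_invP.
  - by apply: (can_inj (f'K m)); rewrite fe !fK'.
  - by rewrite -[in RHS](fK' m q) ft.
exists (exist _ _ f'P); split; apply: sval_inj;
  apply/functional_extensionality_dep => m; apply/funext => q.
- exact: f'K.
- exact: fK'.
Qed.

End BijectiveMorphisms.

(** * The counit and the unit *)

Section CounitUnit.
Context {R : realType} {M : manifold R} (g : metric M) (eta : wf_clrep R).
Local Notation B := (PinorGroupoid g eta).
Local Notation L := (LipschitzGroupoid g eta).
Context (wQ : Q_well_defined g eta) (wS : S_well_defined g eta).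
Local Notation Qr x := (Reduction (Qwd_ob wQ x)).

Definition counit_fun (x : B) m (c : S_fiber (Qr x) m) : sval x m :=
  iso_mod (repr c).1 (repr c).2.

Definition counit_lfun (x : B) m : 'Hom(S_data (Qr x) m, sval x m) :=
  linfun (@counit_fun x m).

(** Replacing [q] by its translate under [a] amounts to applying [a] to [s] first, so the value does
    not depend on the representative. *)
Lemma counit_fun_class x m (q : Qr x m) s :
  counit_fun (S_class q s) = iso_mod q s.
Proof.
rewrite /counit_fun; have := assoc_reprP (S_class q s).
case: (repr _) => q' s' /= /assoc_classP[a [-> ->]].
by rewrite -comp_lfunE.
Qed.

Lemma counit_linear x m : linear (@counit_fun x m).
Proof.
have PQ := rd_principal (redP (Qr x)).
move=> k; elim/(@S_class_surj R M g eta (Qr x) m)=> q s.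
elim/(@S_class_surj R M g eta (Qr x) m)=> q' s'.
have -> : S_class q' s' = S_class q (lg_rep (pb_diff PQ q q') s').
  by rewrite -S_class_act -pb_diffP.
by rewrite -S_class_linear !counit_fun_class linearP.
Qed.

Lemma counit_class x m (q : Qr x m) :
  (counit_lfun x m \o linfun (S_class q) = iso_mod q)%VF.
Proof.
apply/lfunP => s; rewrite comp_lfunE S_classE (linfunE (@counit_linear x m)).
exact: counit_fun_class.
Qed.

(** Morphisms of representations are tested on vectors only; as vectors generate the Clifford
    algebra, the relation extends to all of it. *)
Lemma iso_gam (S : pinor g) m (q : Q_fiber eta S m) x :
  (pd_gam S x \o iso_mod q =
   iso_mod q \o eta (cl_map ((iso_vec q)^-1)%VF x))%VF.
Proof.
have [_ tV] := lfun_bijV (iso_vec_bij q).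
have Iq : is_isometry ((iso_vec q)^-1)%VF.
  by apply: isometry_inv; [exact: iso_isometry|exact: iso_vec_bij].
have [el e1 eM] := cr_morph eta; have [sl s1 sM] := pd_morph (pnP S) m.
move: x; apply: cliff_ind => [|v|a x y Hx Hy|x y Hx Hy].
- by rewrite cl_map1 // s1 e1 comp_lfun1l comp_lfun1r.
- rewrite cl_map_vec // -[eta _]/(cr_vec eta _) -iso_comm.
  by rewrite -[in RHS]comp_lfunE tV id_lfunE.
- by rewrite cl_map_is_linear // sl el comp_lfunDl comp_lfunDr -comp_lfunZl -comp_lfunZr Hx Hy.
- by rewrite cl_mapM // sM eM -comp_lfunA Hy !comp_lfunA Hx.
Qed.

Lemma counit_morphism x :
  pinor_morphism (S := S_data (Qr x)) (S' := sval x) (counit_lfun x).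
Proof.
split.
(* In trivializations the counit is the module part of the local section [q], smooth by the very
   definition of the atlas of [Q_bundle]. *)
- move=> U t U' t' [q [oU _ sq] tq] U't'.
  have oU' := vb_open (pd_vbundle (pnP (sval x))) U't'.
  apply: (smooth_hom_ext (openI oU oU') _ (sq _ _ U't')) => m _.
  by rewrite tq -comp_lfunA counit_class.
- move=> m y; have [q] := pb_inhabited (rd_principal (redP (Qr x))) m.
  apply: (lfun_comp_injr (S_class_bij q)).
  rewrite -!comp_lfunA counit_class S_gam_class comp_lfunA counit_class.
  exact/esym/iso_gam.
Qed.

Lemma counit_bij x m : bijective (counit_lfun x m).
Proof.
have [q] := pb_inhabited (rd_principal (redP (Qr x))) m.
have [V1 _] := lfun_bijV (S_class_bij q).
have -> : counit_lfun x m = (iso_mod q \o (linfun (S_class q))^-1)%VF.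
  rewrite -counit_class -comp_lfunA (lfun_bijV (S_class_bij q)).2.
  by rewrite comp_lfun1r.
by apply: comp_lfun_bij; [exact: (iso_mod_bij q)|exact/lfun_inv_bij/S_class_bij].
Qed.

Lemma counit_exists :
  inhabited (nat_trans (comp_functor (S_functor wS) (Q_functor wQ)) (id_functor B)).
Proof.
pose F x : @hom (PinorCat g) (Pinor (Swd_ob wS (Qr x))) (sval x) :=
  exist _ (counit_lfun x) (counit_morphism x).
have iF x : is_iso (F x) by apply: pinor_bijective_is_iso; exact: counit_bij.
pose F' x : @hom B (comp_functor (S_functor wS) (Q_functor wQ) x) (id_functor B x) :=
  exist _ (F x) (iF x).
constructor; apply: (NatTrans (ntc := F')) => x y f.
apply: sval_inj; apply: sval_inj; apply/functional_extensionality_dep => m.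
have [q] := pb_inhabited (rd_principal (redP (Qr x))) m.
apply: (lfun_comp_injr (S_class_bij q)).
rewrite /= -!comp_lfunA counit_class.
rewrite (S_map_class _ q) counit_class.
by [].
Qed.

(** The choice is harmless, since [unit_mapP] determines both components. *)
Definition unit_map (Q : L) m (q : Q m) : Q_fiber eta (Pinor (Swd_ob wS Q)) m :=
  sval (boolp.cid (S_fiber_iso (Swd_ob wS Q) q)).

Lemma unit_mapP (Q : L) m (q : Q m) :
  iso_vec (unit_map q) = sval (rd_map q) /\ iso_mod (unit_map q) = linfun (S_class q).
Proof. by rewrite /unit_map; case: boolp.cid. Qed.

Let SQ (Q : L) : B := S_functor wS Q.

Lemma unit_inj (Q : L) m (p p' : Qr (SQ Q) m) : iso_mod p = iso_mod p' -> p = p'.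
Proof. by apply: iso_mod_inj; exact: (svalP (SQ Q)).1. Qed.

Lemma unit_morphism (Q : L) :
  reduction_morphism (Q := Q) (Q' := Qr (SQ Q)) (@unit_map Q).
Proof.
split=> [U q U' p' Uq [oU' _ sp'] k pk|m q a|m q].
- have PQ := rd_principal (redP Q); have oU := pb_open PQ Uq.
  pose t m := linfun (S_class (q m)).
  have St : vb_atlas (v := S_bundle Q) U t by exists q.
  have sp := sp' _ _ St; rewrite setIC in sp.
  have oUU' := openI oU oU'.
  have bp m : (U `&` U') m -> bijective ((t m)^-1 \o iso_mod (p' m))%VF.
    move=> _; apply: comp_lfun_bij; last exact: (iso_mod_bij (p' m)).
    exact/lfun_inv_bij/S_class_bij.
  (* The unit at [q m] acts on [S0] as the trivialization [t m], so [k] is the inverse of the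
     composite of [p' m] with the inverse of [t m]; that composite is smooth by the atlas condition
     on [p']. *)
  apply: (smooth_hom_ext oUU' _ (smooth_hom_inv oUU' bp sp)) => m UU'm.
  apply: (lfun_comp_injl (bp m UU'm)); rewrite (lfun_bijV (bp m UU'm)).2.
  have E : iso_mod (unit_map (q m)) = (iso_mod (p' m) \o lg_rep (k m))%VF by rewrite pk.
  by rewrite -comp_lfunA -E (unit_mapP (q m)).2 S_class_inv.
- apply: unit_inj; rewrite (unit_mapP _).2 S_class_actE.
  by rewrite iso_mod_act (unit_mapP q).2.
- by apply: sval_inj; rewrite /= (unit_mapP q).1.
Qed.

Lemma unit_exists :
  inhabited (nat_trans (id_functor L) (comp_functor (Q_functor wQ) (S_functor wS))).
Proof.
pose G Q : @hom (LipschitzCat g eta) Q (Qr (SQ Q)) :=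
  exist _ (@unit_map Q) (unit_morphism Q).
pose G' Q : @hom L (id_functor L Q) (comp_functor (Q_functor wQ) (S_functor wS) Q) :=
  exist _ (G Q) (reduction_is_iso (G Q)).
constructor; apply: (NatTrans (ntc := G')) => Q Q' f.
apply: sval_inj; apply: sval_inj; apply/functional_extensionality_dep => m.
apply/funext => q; apply: unit_inj.
rewrite [LHS](unit_mapP (sval (sval f) m q)).2.
rewrite -[RHS]/(S_map (sval f) m \o iso_mod (unit_map q))%VF.
by rewrite (unit_mapP q).2 S_map_class.
Qed.

End CounitUnit.

Theorem theorem6p2 (R : realType) (M : manifold R) (g : metric M)
    (eta : wf_clrep R)
    (h_isometric : forall m : M, exists f : 'Hom(cr_qs eta, cotangent_qs g m),
       is_isometry f /\ bijective f) :
  exists (wQ : Q_well_defined g eta) (wS : S_well_defined g eta),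
    let Q_eta : functor (PinorGroupoid g eta) (LipschitzGroupoid g eta) :=
      Q_functor wQ in
    let S_eta : functor (LipschitzGroupoid g eta) (PinorGroupoid g eta) :=
      S_functor wS in
    [/\ exists F_eta : nat_trans (comp_functor S_eta Q_eta)
                                 (id_functor (PinorGroupoid g eta)),
          nat_invertible F_eta,
        exists G_eta : nat_trans (id_functor (LipschitzGroupoid g eta))
                                 (comp_functor Q_eta S_eta),
          nat_invertible G_eta &
        quasi_inverse Q_eta S_eta].
Proof.
exists (Q_is_well_defined g eta), (S_is_well_defined g eta) => Q_eta S_eta.
have [F] : inhabited (nat_trans (comp_functor S_eta Q_eta) (id_functor (PinorGroupoid g eta))).
  exact: counit_exists.
have [G] : inhabited (nat_trans (id_functor (LipschitzGroupoid g eta))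
    (comp_functor Q_eta S_eta)).
  exact: unit_exists.
have Finv := nat_trans_core_invertible F; have Ginv := nat_trans_core_invertible G.
split; [by exists F|by exists G|split; first by exists F].
(* [quasi_inverse] orients its second isomorphism towards the identity, so the inverse of [G] is the
   witness. *)
have [G' GG'] := Ginv; exists G', G => Q; have [? ?] := GG' Q.
by split.
Qed.
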